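(* A $\mathcal D$-differential ring $(K,\Delta,\partial)$ is existentially closed in the class $\mathcal K$ if and only if: (I) $(K,\Delta)$ is a differentially closed field; (II) the associated endomorphisms $\sigma_0,\dots,\sigma_t$ are automorphisms; and (III) whenever $V\subseteq K^n$ is an irreducible $\Delta$-closed set and $W\subseteq\tau V$ is an irreducible $\Delta$-closed subset such that $\widehat\pi_i(W)$ is $\Delta$-dense in $V^{\sigma_i}$ for all $i=0,\dots,t$, there exists $a\in V$ with $\nabla(a)\in W$.
   Context: Fix a field $k$ of characteristic zero, a finite-dimensional commutative $k$-algebra $B$ such that $B/\mathfrak n=k$ for every maximal ideal $\mathfrak n$ of $B$, a $k$-algebra homomorphism $\pi:B\to k$, and a $k$-basis $(\epsilon_0,\dots,\epsilon_\ell)$ of $B$ with $\pi(\epsilon_0)=1$, $\pi(\epsilon_i)=0$ for $i\neq0$. For a $k$-algebra $R$, $\mathcal D(R):=B\otimes_kR$, free over $R$ with basis $\epsilon_0,\dots,\epsilon_\ell$, and $\pi^R$ the base change of $\pi$; if $R$ has commuting derivations $\Delta=\{\delta_1,\dots,\delta_m\}$, $\mathcal D(R)$ is a $\Delta$-ring via $\delta_j(b\otimes r)=b\otimes\delta_j(r)$. A $\mathcal D$-differential ring is a $k$-algebra $R$ with commuting $k$-linear derivations $\Delta$ and operators $\partial=(\partial_1,\dots,\partial_\ell)$ such that $e:R\to\mathcal D(R)$, $e(r)=r\epsilon_0+\sum_{i=1}^\ell\partial_i(r)\epsilon_i$, is a homomorphism of differential $k$-algebras. Write $B=\prod_{i=0}^tB_i$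 as a product of local $k$-algebras, $\pi_i:B\to k$ the projection to $B_i$ followed by the residue map (with $\pi_0=\pi$), $\pi_i^R$ its base change to $R$; the associated endomorphisms are $\sigma_i=\pi_i^R\circ e$. The language consists of that of $k$-algebras with function symbols for the $\delta_j$ and $\partial_i$. $\mathcal K$ is the class of $\mathcal D$-differential rings that are integral domains with injective associated endomorphisms. Differentially closed means a model of $\mathrm{DCF}_{0,m}$; $\Delta$-closed, irreducible, $\Delta$-dense refer to the Kolchin topology. For $f\in K\{x\}$, $x=(x_1,\dots,x_n)$, let $f^e\in\mathcal D(K)\{x\}$ be obtained by applying $e$ to the coefficients, and define $f^{(0)},\dots,f^{(\ell)}\in K\{\overline x\}$, $\overline x=(x^{(0)},\dots,x^{(\ell)})$, by $f^e(\sum_{j}x^{(j)}\epsilon_j)=\sum_j f^{(j)}(\overline x)\epsilon_j$ (with $\epsilon_j$ treated as $\Delta$-constants). For a $\Delta$-closed $V\subseteq K^n$ over $K$ with ideal $I_\Delta(V/K)$, the $\mathcal D$-prolongation $\tau V\subseteq K^{(\ell+1)n}$ is the zero set of $\{f^{(j)}:f\in I_\Delta(V/K),\ 0\le j\le\ell\}$. $V^{\sigma_i}$ is obtained by applying $\sigma_i$ to the coefficients of the defining equations of $V$; $\widehat\pi_i:\tau V\to V^{\sigma_i}$ is $\overline a\mapsto\sum_{j=0}^\ell a^{(j)}\pi_i(\epsilon_j)$; and $\nabla(a)=(a,\partial_1a,\dots,\partial_\ell a)$ for $a\in V$. *)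

(* Defs.v *)
From HB Require Import structures.
From mathcomp Require Import all_boot all_order all_algebra all_field.
Set Implicit Arguments. Unset Strict Implicit. Unset Printing Implicit Defensive.
Import GRing.Theory.
Local Open Scope ring_scope.

(* Delta-polynomials over K are the terms with parameters in K and l = 0.   *)
(* (Constants of k are represented as parameters c *: 1.)                   *)
Inductive dterm (A X : Type) (m l : nat) : Type :=
| TVar : X -> dterm A X m l
| TPar : A -> dterm A X m l
| TAdd : dterm A X m l -> dterm A X m l -> dterm A X m l
| TOpp : dterm A X m l -> dterm A X m l
| TMul : dterm A X m l -> dterm A X m l -> dterm A X m l
| TDel : 'I_m -> dterm A X m l -> dterm A X m l
| TPart : 'I_l -> dterm A X m l -> dterm A X m l.

Fixpoint teval (A X : Type) (m l : nat) (T : Type)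
  (add : T -> T -> T) (opp : T -> T) (mul : T -> T -> T) (par : A -> T)
  (del : 'I_m -> T -> T) (prt : 'I_l -> T -> T) (v : X -> T)
  (t : dterm A X m l) : T :=
  match t with
  | TVar x => v x
  | TPar a => par a
  | TAdd t1 t2 => add (teval add opp mul par del prt v t1) (teval add opp mul par del prt v t2)
  | TOpp t1 => opp (teval add opp mul par del prt v t1)
  | TMul t1 t2 => mul (teval add opp mul par del prt v t1) (teval add opp mul par del prt v t2)
  | TDel i t1 => del i (teval add opp mul par del prt v t1)
  | TPart i t1 => prt i (teval add opp mul par del prt v t1)
  end.

Fixpoint tmap (A A' X : Type) (m l : nat) (f : A -> A') (t : dterm A X m l)
  : dterm A' X m l :=
  match t with
  | TVar x => TVar _ _ _ x
  | TPar a => TPar _ _ _ (f a)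
  | TAdd t1 t2 => TAdd (tmap f t1) (tmap f t2)
  | TOpp t1 => TOpp (tmap f t1)
  | TMul t1 t2 => TMul (tmap f t1) (tmap f t2)
  | TDel i t1 => TDel i (tmap f t1)
  | TPart i t1 => TPart i (tmap f t1)
  end.

Definition reval (A X : Type) (m l : nat) (R : pzRingType) (par : A -> R)
  (del : 'I_m -> R -> R) (prt : 'I_l -> R -> R) (v : X -> R)
  (t : dterm A X m l) : R :=
  teval +%R -%R *%R par del prt v t.

Inductive qf (A X : Type) (m l : nat) : Type :=
| FEq : dterm A X m l -> dterm A X m l -> qf A X m l
| FNot : qf A X m l -> qf A X m l
| FAnd : qf A X m l -> qf A X m l -> qf A X m l
| FOr : qf A X m l -> qf A X m l -> qf A X m l.

Fixpoint qholds (A X : Type) (m l : nat) (R : pzRingType) (par : A -> R)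
  (del : 'I_m -> R -> R) (prt : 'I_l -> R -> R) (v : X -> R)
  (phi : qf A X m l) : Prop :=
  match phi with
  | FEq t1 t2 => reval par del prt v t1 = reval par del prt v t2
  | FNot p => ~ qholds par del prt v p
  | FAnd p q => qholds par del prt v p /\ qholds par del prt v q
  | FOr p q => qholds par del prt v p \/ qholds par del prt v q
  end.

Definition no_ops (T : Type) : 'I_0 -> T -> T := fun _ x => x.

Definition is_domain (R : nzRingType) : Prop :=
  forall x y : R, x * y = 0 -> x = 0 \/ y = 0.

Definition is_field (R : nzRingType) : Prop :=
  forall x : R, x <> 0 -> exists y, x * y = 1.

Definition is_ideal (R : nzRingType) (I : R -> Prop) : Prop :=
  I 0 /\ (forall x y, I x -> I y -> I (x + y)) /\ (forall a x, I x -> I (a * x)).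

Definition is_maximal_ideal (R : nzRingType) (I : R -> Prop) : Prop :=
  is_ideal I /\ ~ I 1 /\
  forall J, is_ideal J -> (forall x, I x -> J x) -> (forall x, J x <-> I x) \/ J 1.

(* B / n = k : the structure map k -> B / n is onto *)
Definition residue_fields_trivial (k : fieldType) (B : falgType k) : Prop :=
  forall I : B -> Prop, is_maximal_ideal I -> forall b : B, exists c : k, I (b - c%:A).

Definition kalg_hom (k : fieldType) (B : falgType k) (p : B -> k) : Prop :=
  (forall x y, p (x + y) = p x + p y) /\ (forall (c : k) x, p (c *: x) = c * p x) /\
  (forall x y, p (x * y) = p x * p y) /\ p 1 = 1.

Definition is_derivation (k : fieldType) (R : comAlgType k) (d : R -> R) : Prop :=
  (forall x y, d (x + y) = d x + d y) /\ (forall x y, d (x * y) = x * d y + d x * y) /\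
  (forall (c : k) x, d (c *: x) = c *: d x).

Section DRings.
Variables (k : fieldType) (B : falgType k) (l : nat) (eps : l.+1.-tuple B) (m : nat).

(* D(R) = B (x)_k R, represented by coordinates in the basis eps *)
Definition Dalg (R : comAlgType k) := 'I_l.+1 -> R.
Definition Dadd (R : comAlgType k) (u v : Dalg R) : Dalg R := fun q => u q + v q.
Definition Dopp (R : comAlgType k) (u : Dalg R) : Dalg R := fun q => - u q.
Definition Dmul (R : comAlgType k) (u v : Dalg R) : Dalg R :=
  fun q => \sum_(i < l.+1) \sum_(j < l.+1) coord eps q (tnth eps i * tnth eps j) *: (u i * v j).
Definition Done (R : comAlgType k) : Dalg R := fun q => coord eps q 1 *: (1 : R).
(* the map e : R -> D(R), e(r) = r eps_0 + sum_i d_i(r) eps_i *)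
Definition emap (R : comAlgType k) (prt : 'I_l -> R -> R) (r : R) : Dalg R :=
  fun q => match unlift ord0 q with None => r | Some i => prt i r end.

Definition is_Dring (R : comAlgType k) (del : 'I_m -> R -> R) (prt : 'I_l -> R -> R) : Prop :=
  (forall j, is_derivation (del j)) /\
  (forall i j x, del i (del j x) = del j (del i x)) /\
  (forall x y, emap prt (x + y) = Dadd (emap prt x) (emap prt y)) /\
  (forall (c : k) x, emap prt (c *: x) = fun q => c *: emap prt x q) /\
  (forall x y, emap prt (x * y) = Dmul (emap prt x) (emap prt y)) /\
  emap prt 1 = Done R /\
  (forall j x, emap prt (del j x) = fun q => del j (emap prt x q)).

(* the associated endomorphism sigma_p = p^R o e, for p : B -> k *)
Definition sigma (R : comAlgType k) (prt : 'I_l -> R -> R) (p : B -> k) (r : R) : R :=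
  \sum_(q < l.+1) p (tnth eps q) *: emap prt r q.

Definition in_classK (R : comAlgType k) (del : 'I_m -> R -> R) (prt : 'I_l -> R -> R) : Prop :=
  is_Dring del prt /\ is_domain R /\
  forall p : B -> k, kalg_hom p -> injective (sigma prt p).

Definition is_Demb (R S : comAlgType k) (delR : 'I_m -> R -> R) (prtR : 'I_l -> R -> R)
  (delS : 'I_m -> S -> S) (prtS : 'I_l -> S -> S) (f : R -> S) : Prop :=
  injective f /\ (forall x y, f (x + y) = f x + f y) /\ (forall x y, f (x * y) = f x * f y) /\
  f 1 = 1 /\ (forall (c : k) x, f (c *: x) = c *: f x) /\
  (forall j x, f (delR j x) = delS j (f x)) /\ (forall i x, f (prtR i x) = prtS i (f x)).

Definition ec_in_classK (K : comAlgType k) (del : 'I_m -> K -> K) (prt : 'I_l -> K -> K) : Prop :=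
  in_classK del prt /\
  forall (L : comAlgType k) (delL : 'I_m -> L -> L) (prtL : 'I_l -> L -> L),
    in_classK delL prtL ->
    forall f : K -> L, is_Demb del prt delL prtL f ->
    forall (n : nat) (phi : qf K 'I_n m l),
      (exists b : 'I_n -> L, qholds f delL prtL b phi) ->
      exists a : 'I_n -> K, qholds id del prt a phi.

Definition diff_closed (K : comAlgType k) (del : 'I_m -> K -> K) : Prop :=
  is_field K /\ [pchar K] =i pred0 /\
  (forall j x y, del j (x + y) = del j x + del j y /\ del j (x * y) = x * del j y + del j x * y) /\
  (forall i j x, del i (del j x) = del j (del i x)) /\
  forall (L : fieldType) (delL : 'I_m -> L -> L),
    [pchar L] =i pred0 ->
    (forall j x y, delL j (x + y) = delL j x + delL j y /\
                   delL j (x * y) = x * delL j y + delL j x * y) ->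
    (forall i j x, delL i (delL j x) = delL j (delL i x)) ->
    forall f : K -> L,
      (forall x y, f (x + y) = f x + f y) -> (forall x y, f (x * y) = f x * f y) -> f 1 = 1 ->
      (forall j x, f (del j x) = delL j (f x)) ->
    forall (n : nat) (phi : qf K 'I_n m 0),
      (exists b : 'I_n -> L, qholds f delL (@no_ops L) b phi) ->
      exists a : 'I_n -> K, qholds id del (@no_ops K) a phi.

Section Kolchin.
Variables (K : comAlgType k) (del : 'I_m -> K -> K) (prt : 'I_l -> K -> K).

Definition dpoly (X : Type) := dterm K X m 0.
Definition peval (X : Type) (f : dpoly X) (a : X -> K) : K :=
  reval id del (@no_ops K) a f.

Definition zero_set (X : Type) (S : dpoly X -> Prop) : (X -> K) -> Prop :=
  fun a => forall f, S f -> peval f a = 0.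

Definition dclosed (X : Type) (V : (X -> K) -> Prop) : Prop :=
  exists S : dpoly X -> Prop, forall a, V a <-> zero_set S a.

Definition dirreducible (X : Type) (V : (X -> K) -> Prop) : Prop :=
  dclosed V /\ (exists a, V a) /\
  forall V1 V2, dclosed V1 -> dclosed V2 -> (forall a, V a <-> V1 a \/ V2 a) ->
    (forall a, V a <-> V1 a) \/ (forall a, V a <-> V2 a).

Definition dclosure (X : Type) (A : (X -> K) -> Prop) : (X -> K) -> Prop :=
  fun b => forall P, dclosed P -> (forall a, A a -> P a) -> P b.

Definition ddense_in (X : Type) (A Y : (X -> K) -> Prop) : Prop :=
  (forall a, A a -> Y a) /\ (forall b, Y b -> dclosure A b).

Definition dideal (X : Type) (V : (X -> K) -> Prop) : dpoly X -> Prop :=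
  fun f => forall a, V a -> peval f a = 0.

Definition conjV (X : Type) (s : K -> K) (V : (X -> K) -> Prop) : (X -> K) -> Prop :=
  fun b => forall f, dideal V f -> peval (tmap s f) b = 0.

(* f^e evaluated at sum_j x^(j) eps_j: coordinate j is f^(j)(xbar) *)
Definition Deval (n : nat) (f : dpoly 'I_n) (abar : ('I_l.+1 * 'I_n) -> K) : Dalg K :=
  teval (@Dadd K) (@Dopp K) (@Dmul K) (emap prt)
        (fun j u => fun q => del j (u q)) (@no_ops (Dalg K))
        (fun x => fun q => abar (q, x)) f.

Definition prolong (n : nat) (V : ('I_n -> K) -> Prop) : (('I_l.+1 * 'I_n) -> K) -> Prop :=
  fun abar => forall f, dideal V f -> forall q, Deval f abar q = 0.

Definition pihat (n : nat) (p : B -> k) (abar : ('I_l.+1 * 'I_n) -> K) : 'I_n -> K :=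
  fun x => \sum_(q < l.+1) p (tnth eps q) *: abar (q, x).

Definition image_pihat (n : nat) (p : B -> k) (W : (('I_l.+1 * 'I_n) -> K) -> Prop)
  : ('I_n -> K) -> Prop :=
  fun b => exists w, W w /\ b = pihat p w.

Definition nabla (n : nat) (a : 'I_n -> K) : ('I_l.+1 * 'I_n) -> K :=
  fun qx => emap prt (a qx.2) qx.1.

Definition geometric_axioms : Prop :=
  forall (n : nat) (V : ('I_n -> K) -> Prop) (W : (('I_l.+1 * 'I_n) -> K) -> Prop),
    dirreducible V -> dirreducible W -> (forall w, W w -> prolong V w) ->
    (forall p : B -> k, kalg_hom p -> ddense_in (image_pihat p W) (conjV (sigma prt p) V)) ->
    exists a, V a /\ W (nabla a).

End Kolchin.
End DRings.

(* Main.v *)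
(* Both implications rest on an extension theorem and a finiteness theorem.

   Extension.  Let F0 -> F be differential fields and e : F0 -> D(F) a
   homomorphism of differential algebras.  The residues of e are extended to F by
   amalgamating differential fields.  As all residue fields of B are k and the
   characteristic is 0, Newton's iteration lifts the extended residues to an
   algebra homomorphism F -> D(S) extending e.  It need not commute with the
   derivations, but it does after replacing S by the fraction field of the Hurwitz
   series over S in m variables, and every map to S by its Taylor expansion.
   Iterating, the limit is a D-differential field whose operators extend e.

   Finiteness.  Let a be a tuple in a differential field extension of K, order the
   derivatives of its entries lexicographically, and call one of them a leader if it
   is algebraic over the lower ones.  By Dickson's lemma all leaders are derivatives
   of finitely many of them.  A proper derivative of a leader satisfies a linear
   relation with the separant as coefficient, so the minimal relations of these
   finitely many leaders, with their initials and separants nonzero, force every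
   differential polynomial vanishing at a to vanish.  Hence the generic point of an
   irreducible set is captured by a single quantifier-free formula.

   If K is existentially closed, (I) and (II) follow from the extension theorem; for
   (III) the generic point of W defines e on the function field of V, where the
   density of the projections makes the residues injective.  Conversely, for a
   formula with a solution in L, let a list the values of all its subterms (and the
   inverses of the nonzero differences) and apply (III) to the loci of a and of
   nabla a. *)
Require Import Defs.
From HB Require Import structures.
From mathcomp Require Import all_boot all_order all_algebra all_field.
From mathcomp Require Import boolp classical_sets ring.
Set Implicit Arguments. Unset Strict Implicit. Unset Printing Implicit Defensive.
Import GRing.Theory.
Local Open Scope ring_scope.

(** * Commutative algebras and their quotients *)

(** The associated endomorphisms are indexed by all [k]-algebra homomorphisms [p : B -> k]; these
    are the [pi_i], as every residue field of [B] is [k]. The obstacle to extension is that a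
    transcendental element may go to any lift of its residues, so nothing makes the lifted
    homomorphism respect the derivations. Taylor expansion repairs this afterwards: a map [h] out of
    a differential ring becomes differential when [x] is sent to the family of all [h (d x)], [d] an
    iterated derivation. A map that was differential already is merely composed with the expansion
    of its target, so the given values on [F0] and the chosen residues survive. Hurwitz series are
    such families, with the shift as derivation, so no factorial is divided out; characteristic 0
    makes them a domain. The finiteness theorem is forced by the definitions: existential and
    differential closedness both speak of one quantifier-free formula, while a generic point is
    described by infinitely many conditions. *)

Record alg_laws (k : fieldType) (T : Type) (E : T -> T -> Prop) (zero one : T)
  (add : T -> T -> T) (opp : T -> T) (mul : T -> T -> T) (scale : k -> T -> T)
  : Prop := AlgLaws {
  law_addA : forall x y z, E (add x (add y z)) (add (add x y) z);
  law_addC : forall x y, E (add x y) (add y x);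
  law_add0 : forall x, E (add zero x) x;
  law_addN : forall x, E (add (opp x) x) zero;
  law_mulA : forall x y z, E (mul x (mul y z)) (mul (mul x y) z);
  law_mulC : forall x y, E (mul x y) (mul y x);
  law_mul1 : forall x, E (mul one x) x;
  law_mulDl : forall x y z, E (mul (add x y) z) (add (mul x z) (mul y z));
  law_scaleA : forall a b x, E (scale a (scale b x)) (scale (a * b) x);
  law_scale1 : forall x, E (scale 1 x) x;
  law_scaleDr : forall a x y, E (scale a (add x y)) (add (scale a x) (scale a y));
  law_scaleDl : forall a b x, E (scale (a + b) x) (add (scale a x) (scale b x));
  law_scaleAl : forall a x y, E (scale a (mul x y)) (mul (scale a x) y) }.

(* The laws hold in [T] as soon as evaluations into genuine algebras detect [E]. *)
Lemma alg_laws_eval (k : fieldType) (T : Type) (E : T -> T -> Prop) zero one add opp mul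
  (scale : k -> T -> T) (I : Type) (R : I -> comAlgType k) (ev : forall i, T -> R i) :
  (forall x y, (forall i, ev i x = ev i y) -> E x y) ->
  (forall i, ev i zero = 0) -> (forall i, ev i one = 1) ->
  (forall i x y, ev i (add x y) = ev i x + ev i y) ->
  (forall i x, ev i (opp x) = - ev i x) ->
  (forall i x y, ev i (mul x y) = ev i x * ev i y) ->
  (forall i c x, ev i (scale c x) = c *: ev i x) ->
  alg_laws E zero one add opp mul scale.
Proof.
move=> hE e0 e1 eD eN eM eZ.
split=> *; apply: hE => i; rewrite ?(eD, eN, eM, eZ, e0, e1).
- exact: addrA. - exact: addrC. - exact: add0r. - exact: addNr.
- exact: mulrA. - exact: mulrC. - exact: mul1r. - exact: mulrDl.
- exact: scalerA. - exact: scale1r. - exact: scalerDr. - exact: scalerDl.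
- exact: scalerAl.
Qed.

(** Plain data, so that algebras depending on local hypotheses (a domain, an ideal, a tower) can be
    built inside sections; [alg_of] attaches the canonical structures once for all. *)
Record rawalg (k : fieldType) := RawAlg {
  ra_sort : Type;
  ra_zero : ra_sort; ra_one : ra_sort;
  ra_add : ra_sort -> ra_sort -> ra_sort;
  ra_opp : ra_sort -> ra_sort;
  ra_mul : ra_sort -> ra_sort -> ra_sort;
  ra_scale : k -> ra_sort -> ra_sort;
  ra_10 : ra_one <> ra_zero;
  ra_laws : alg_laws eq ra_zero ra_one ra_add ra_opp ra_mul ra_scale }.

Section AlgOfRaw.
Variables (k : fieldType) (A : rawalg k).

Definition alg_of : Type := ra_sort A.
Let laws := ra_laws A.

HB.instance Definition _ := gen_eqMixin alg_of.
HB.instance Definition _ := gen_choiceMixin alg_of.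
HB.instance Definition _ := GRing.isZmodule.Build alg_of
  (law_addA laws) (law_addC laws) (law_add0 laws) (law_addN laws).

Fact alg_of_10 : ra_one A != 0 :> alg_of.
Proof. by apply/eqP; exact: ra_10. Qed.

HB.instance Definition _ := GRing.Zmodule_isComNzRing.Build alg_of
  (law_mulA laws) (law_mulC laws) (law_mul1 laws) (law_mulDl laws) alg_of_10.
HB.instance Definition _ := GRing.Zmodule_isLmodule.Build k alg_of
  (law_scaleA laws) (law_scale1 laws) (law_scaleDr laws)
  (fun v a b => law_scaleDl laws a b v).
HB.instance Definition _ := GRing.Lmodule_isLalgebra.Build k alg_of
  (law_scaleAl laws).
HB.instance Definition _ := GRing.Lalgebra_isComAlgebra.Build k alg_of.

End AlgOfRaw.

(** Congruence is asked in the first argument only; the commutativity laws supply the second. *)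
Record setoidalg (k : fieldType) := SetoidAlg {
  sa_sort : Type;
  sa_eqv : sa_sort -> sa_sort -> Prop;
  sa_zero : sa_sort; sa_one : sa_sort;
  sa_add : sa_sort -> sa_sort -> sa_sort;
  sa_opp : sa_sort -> sa_sort;
  sa_mul : sa_sort -> sa_sort -> sa_sort;
  sa_scale : k -> sa_sort -> sa_sort;
  sa_refl : forall x, sa_eqv x x;
  sa_sym : forall x y, sa_eqv x y -> sa_eqv y x;
  sa_trans : forall x y z, sa_eqv x y -> sa_eqv y z -> sa_eqv x z;
  sa_add_congr : forall x x' y, sa_eqv x x' -> sa_eqv (sa_add x y) (sa_add x' y);
  sa_opp_congr : forall x x', sa_eqv x x' -> sa_eqv (sa_opp x) (sa_opp x');
  sa_mul_congr : forall x x' y, sa_eqv x x' -> sa_eqv (sa_mul x y) (sa_mul x' y);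
  sa_scale_congr : forall a x x',
    sa_eqv x x' -> sa_eqv (sa_scale a x) (sa_scale a x');
  sa_10 : ~ sa_eqv sa_one sa_zero;
  sa_laws : alg_laws sa_eqv sa_zero sa_one sa_add sa_opp sa_mul sa_scale }.

Section Quotient.
Variables (k : fieldType) (A : setoidalg k).
Local Notation T := (sa_sort A).

(** Classes are predicates, so extensionality turns equivalence into equality for any relation,
    decidable or not. *)
Definition qclass : Type := {P : T -> Prop | exists t, P = @sa_eqv _ A t}.
Definition qpi (t : T) : qclass := exist _ (@sa_eqv _ A t) (ex_intro _ t erefl).
Definition qrepr (q : qclass) : T := projT1 (cid (proj2_sig q)).

Lemma qpiP t t' : qpi t = qpi t' <-> sa_eqv t t'.
Proof.
split=> [/(congr1 (@proj1_sig _ _)) /= ->|h]; first exact: sa_refl.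
apply: eq_exist; apply/funext => x; apply/propext; split=> hx.
  exact: sa_trans (sa_sym h) hx.
exact: sa_trans h hx.
Qed.

Lemma qreprK q : qpi (qrepr q) = q.
Proof.
rewrite /qrepr; case: (cid _) => t /= ht; case: q ht => P hP /= ht.
by apply: eq_exist; rewrite ht.
Qed.

Lemma qrepr_pi t : sa_eqv (qrepr (qpi t)) t.
Proof. by apply/qpiP; rewrite qreprK. Qed.

Definition qadd x y := qpi (sa_add (qrepr x) (qrepr y)).
Definition qopp x := qpi (sa_opp (qrepr x)).
Definition qmul x y := qpi (sa_mul (qrepr x) (qrepr y)).
Definition qscale a x := qpi (sa_scale a (qrepr x)).

Lemma qaddE x y : qadd (qpi x) (qpi y) = qpi (sa_add x y).
Proof.
apply/qpiP/(sa_trans (sa_add_congr _ (qrepr_pi x)))/(sa_trans (law_addC (sa_laws A) _ _)).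
exact: sa_trans (sa_add_congr _ (qrepr_pi y)) (law_addC (sa_laws A) _ _).
Qed.

Lemma qmulE x y : qmul (qpi x) (qpi y) = qpi (sa_mul x y).
Proof.
apply/qpiP/(sa_trans (sa_mul_congr _ (qrepr_pi x)))/(sa_trans (law_mulC (sa_laws A) _ _)).
exact: sa_trans (sa_mul_congr _ (qrepr_pi y)) (law_mulC (sa_laws A) _ _).
Qed.

Lemma qoppE x : qopp (qpi x) = qpi (sa_opp x).
Proof. exact/qpiP/sa_opp_congr/qrepr_pi. Qed.

Lemma qscaleE a x : qscale a (qpi x) = qpi (sa_scale a x).
Proof. exact/qpiP/sa_scale_congr/qrepr_pi. Qed.

Let qE := (qaddE, qmulE, qoppE, qscaleE).

Definition quot_raw : rawalg k.
Proof.
apply: (@RawAlg k qclass (qpi (sa_zero A)) (qpi (sa_one A)) qadd qopp qmul qscale).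
  by move/qpiP; exact: sa_10.
have h := sa_laws A.
split.
- by move=> x y z; rewrite -(qreprK x) -(qreprK y) -(qreprK z) !qE; apply/qpiP/(law_addA h).
- by move=> x y; rewrite -(qreprK x) -(qreprK y) !qE; apply/qpiP/(law_addC h).
- by move=> x; rewrite -(qreprK x) !qE; apply/qpiP/(law_add0 h).
- by move=> x; rewrite -(qreprK x) !qE; apply/qpiP/(law_addN h).
- by move=> x y z; rewrite -(qreprK x) -(qreprK y) -(qreprK z) !qE; apply/qpiP/(law_mulA h).
- by move=> x y; rewrite -(qreprK x) -(qreprK y) !qE; apply/qpiP/(law_mulC h).
- by move=> x; rewrite -(qreprK x) !qE; apply/qpiP/(law_mul1 h).
- by move=> x y z; rewrite -(qreprK x) -(qreprK y) -(qreprK z) !qE; apply/qpiP/(law_mulDl h).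
- by move=> a b x; rewrite -(qreprK x) !qE; apply/qpiP/(law_scaleA h).
- by move=> x; rewrite -(qreprK x) !qE; apply/qpiP/(law_scale1 h).
- by move=> a x y; rewrite -(qreprK x) -(qreprK y) !qE; apply/qpiP/(law_scaleDr h).
- by move=> a b x; rewrite -(qreprK x) !qE; apply/qpiP/(law_scaleDl h).
- by move=> a x y; rewrite -(qreprK x) -(qreprK y) !qE; apply/qpiP/(law_scaleAl h).
Defined.

Definition quot : comAlgType k := alg_of quot_raw.
Definition qproj (t : T) : quot := qpi t.

Lemma qprojP t t' : qproj t = qproj t' <-> sa_eqv t t'. Proof. exact: qpiP. Qed.
Lemma qproj_surj (q : quot) : exists t, q = qproj t.
Proof. by exists (qrepr q); rewrite /qproj qreprK. Qed.
Lemma qproj0 : qproj (sa_zero A) = 0. Proof. by []. Qed.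
Lemma qproj1 : qproj (sa_one A) = 1. Proof. by []. Qed.
Lemma qprojD x y : qproj (sa_add x y) = qproj x + qproj y.
Proof. by rewrite /qproj -qaddE. Qed.
Lemma qprojN x : qproj (sa_opp x) = - qproj x.
Proof. by rewrite /qproj -qoppE. Qed.
Lemma qprojM x y : qproj (sa_mul x y) = qproj x * qproj y.
Proof. by rewrite /qproj -qmulE. Qed.
Lemma qprojZ a x : qproj (sa_scale a x) = a *: qproj x.
Proof. by rewrite /qproj -qscaleE. Qed.

End Quotient.

(** * Homomorphisms, derivations and fractions *)

Record khom (k : fieldType) (R S : comAlgType k) (f : R -> S) : Prop := KHom {
  khomD : forall x y, f (x + y) = f x + f y;
  khomM : forall x y, f (x * y) = f x * f y;
  khom1 : f 1 = 1;
  khomZ : forall (c : k) x, f (c *: x) = c *: f x }.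

Record dalg (k : fieldType) (m : nat) (R : comAlgType k) (del : 'I_m -> R -> R)
  : Prop := DAlg {
  dalg_der : forall j, is_derivation (del j);
  dalg_comm : forall i j x, del i (del j x) = del j (del i x) }.

Record dhom (k : fieldType) (m : nat) (R S : comAlgType k)
  (delR : 'I_m -> R -> R) (delS : 'I_m -> S -> S) (f : R -> S) : Prop := DHom {
  dhom_k :> khom f;
  dhom_del : forall j x, f (delR j x) = delS j (f x) }.

Section KHom.
Variables (k : fieldType) (R S : comAlgType k) (f : R -> S).
Hypothesis hf : khom f.

Lemma khom0 : f 0 = 0.
Proof. by apply: (addrI (f 0)); rewrite -(khomD hf) !addr0. Qed.

Lemma khomN x : f (- x) = - f x.
Proof. by apply: (addrI (f x)); rewrite -(khomD hf) !subrr khom0. Qed.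

Lemma khomB x y : f (x - y) = f x - f y.
Proof. by rewrite (khomD hf) khomN. Qed.

Lemma khom_sum (I : Type) (r : seq I) (P : pred I) (F : I -> R) :
  f (\sum_(i <- r | P i) F i) = \sum_(i <- r | P i) f (F i).
Proof. exact: (big_morph f (khomD hf) khom0). Qed.

Lemma khomX x n : f (x ^+ n) = f x ^+ n.
Proof. by elim: n => [|n ih]; rewrite ?expr0 ?(khom1 hf) // !exprS (khomM hf) ih. Qed.

Lemma khom_field_neq0 : is_field R -> forall x, x <> 0 -> f x <> 0.
Proof.
move=> hR x /hR[y hxy] fx0; have /negP[] := oner_neq0 S.
by rewrite -(khom1 hf) -hxy (khomM hf) fx0 mul0r.
Qed.

Lemma khom_inj0 : (forall x, f x = 0 -> x = 0) -> injective f.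
Proof. by move=> h x y /eqP; rewrite -subr_eq0 -khomB => /eqP/h/eqP; rewrite subr_eq0 => /eqP. Qed.

Lemma khom_field_inj : is_field R -> injective f.
Proof.
move=> hR; apply: khom_inj0 => x fx0; apply: contrapT => hx.
exact: (khom_field_neq0 hR hx).
Qed.

End KHom.

Lemma khom_comp (k : fieldType) (R S T : comAlgType k) (f : R -> S) (g : S -> T) :
  khom f -> khom g -> khom (g \o f).
Proof.
move=> hf hg; split=> [x y|x y||c x] /=.
- by rewrite (khomD hf) (khomD hg).
- by rewrite (khomM hf) (khomM hg).
- by rewrite (khom1 hf) (khom1 hg).
- by rewrite (khomZ hf) (khomZ hg).
Qed.

Lemma khom_id (k : fieldType) (R : comAlgType k) : khom (@id R).
Proof. by split. Qed.

Lemma dhom_comp (k : fieldType) (m : nat) (R S T : comAlgType k)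
  (dR : 'I_m -> R -> R) (dS : 'I_m -> S -> S) (dT : 'I_m -> T -> T)
  (f : R -> S) (g : S -> T) :
  dhom dR dS f -> dhom dS dT g -> dhom dR dT (g \o f).
Proof.
move=> hf hg; split; first exact: (khom_comp hf hg).
by move=> j x /=; rewrite (dhom_del hf) (dhom_del hg).
Qed.

Lemma dhom_id (k : fieldType) (m : nat) (R : comAlgType k) (dR : 'I_m -> R -> R) :
  dhom dR dR id.
Proof. by split. Qed.

Lemma field_domain (R : comNzRingType) : is_field R -> is_domain R.
Proof.
move=> hR x y hxy; case: (EM (x = 0)) => [|/hR[z hz]]; [by left | right].
by rewrite -[y]mul1r -hz mulrAC hxy mul0r.
Qed.

Lemma domain_cancel (R : comNzRingType) (x y z : R) :
  is_domain R -> z <> 0 -> x * z = y * z -> x = y.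
Proof.
move=> hR hz /eqP; rewrite -subr_eq0 -mulrBl => /eqP /hR[/eqP|//].
by rewrite subr_eq0 => /eqP.
Qed.

Lemma domain_mul_neq0 (R : comNzRingType) (x y : R) :
  is_domain R -> x <> 0 -> y <> 0 -> x * y <> 0.
Proof. by move=> hR hx hy /hR[]. Qed.

Lemma unit_cancel (R : comNzRingType) (x y z u : R) :
  z * u = 1 -> x * z = y * z -> x = y.
Proof. by move=> hz h; rewrite -[x]mulr1 -[y]mulr1 -hz !mulrA h. Qed.

Lemma field_inverse (R : comNzRingType) : is_field R ->
  exists iv : R -> R, forall x, x <> 0 -> x * iv x = 1.
Proof.
move=> hR.
have /choice[iv hiv] : forall x : R, exists y, x <> 0 -> x * y = 1.
  move=> x; case: (EM (x = 0)) => [->|/hR[y hy]]; last by exists y.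
  by exists 0.
by exists iv.
Qed.

Lemma derivation1 (k : fieldType) (R : comAlgType k) (d : R -> R) :
  is_derivation d -> d 1 = 0.
Proof.
case=> _ [dM _]; have /eqP := dM 1 1.
by rewrite !mulr1 mul1r -subr_eq0 opprD addrA subrr sub0r oppr_eq0 => /eqP.
Qed.

Lemma derivation0 (k : fieldType) (R : comAlgType k) (d : R -> R) :
  is_derivation d -> d 0 = 0.
Proof. by case=> _ [_ dZ]; rewrite -(scale0r 0) dZ !scale0r. Qed.

Section FracConstruction.
Variables (k : fieldType) (R : comAlgType k).
Hypothesis hR : is_domain R.

Definition fracT : Type := {p : R * R | p.2 <> 0}.
Definition fnum (p : fracT) := (projT1 p).1.
Definition fden (p : fracT) := (projT1 p).2.
Definition mkfrac a b (hb : b <> 0) : fracT := exist (fun p : R * R => p.2 <> 0) (a, b) hb.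
Definition freqv (p q : fracT) := fnum p * fden q = fnum q * fden p.

Lemma fden_neq0 p : fden p <> 0. Proof. exact: (projT2 p). Qed.
Lemma fdenM p q : fden p * fden q <> 0.
Proof. exact (domain_mul_neq0 hR (@fden_neq0 p) (@fden_neq0 q)). Qed.
Lemma one_neq0 : (1 : R) <> 0. Proof. exact/eqP/oner_neq0. Qed.

Definition fradd p q := mkfrac (fnum p * fden q + fnum q * fden p) (@fdenM p q).
Definition frmul p q := mkfrac (fnum p * fnum q) (@fdenM p q).
Definition fropp p := mkfrac (- fnum p) (@fden_neq0 p).
Definition frscale c p := mkfrac (c *: fnum p) (@fden_neq0 p).
Definition frin x := mkfrac x one_neq0.

Definition frac_setoid : setoidalg k.
Proof.
apply: (@SetoidAlg k fracT freqv (frin 0) (frin 1) fradd fropp frmul frscale); last split;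
  rewrite /freqv /fradd /fropp /frmul /frscale /frin /fnum /fden /=.
- by [].
- by move=> x y ->.
- move=> x y z h1 h2; apply: (domain_cancel hR (@fden_neq0 y)); rewrite /fden.
  by rewrite mulrAC h1 mulrAC h2 mulrAC.
- move=> x x' y h; set a := (sval x).1 in h *; set b := (sval x).2 in h *.
  set a' := (sval x').1 in h *; set b' := (sval x').2 in h *.
  set c := (sval y).1; set d := (sval y).2.
  have -> : (a * d + c * b) * (b' * d) = (a * b') * d * d + c * b * b' * d by ring.
  by rewrite h; ring.
- by move=> x x' h; rewrite !mulNr h.
- move=> x x' y h.
  by rewrite mulrACA h mulrACA.
- by move=> c x x' h; rewrite -!scalerAl h.
- by rewrite !mulr1; exact: one_neq0.
- by move=> x y z; ring.
- by move=> x y; ring.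
- by move=> x; ring.
- by move=> x; ring.
- by move=> x y z; ring.
- by move=> x y; ring.
- by move=> x; ring.
- by move=> x y z; ring.
- by move=> a b v; rewrite scalerA.
- by move=> v; rewrite scale1r.
- by move=> a u v; rewrite scalerDr !scalerAl.
- by move=> a b v; rewrite scalerDl -!mulrDl mulrA.
- by move=> a u v; rewrite scalerAl.
Defined.

End FracConstruction.

Record is_frac (k : fieldType) (R Q : comAlgType k) (i : R -> Q) : Prop := IsFrac {
  frac_khom : khom i;
  frac_inj : injective i;
  frac_field : is_field Q;
  frac_rep : forall q, exists a b, b <> 0 /\ q * i b = i a }.

Lemma frac_exists (k : fieldType) (R : comAlgType k) : is_domain R ->
  exists (Q : comAlgType k) (i : R -> Q), is_frac i.
Proof.
move=> hR; exists (quot (frac_setoid hR)).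
exists (fun x => qproj (frin x : sa_sort (frac_setoid hR))).
split.
- split=> [x y|x y||c x].
  + rewrite -qprojD; apply/qprojP; rewrite /= /freqv /fradd /fnum /fden /=; ring.
  + rewrite -qprojM; apply/qprojP; rewrite /= /freqv /frmul /fnum /fden /=; ring.
  + by rewrite -qproj1; apply/qprojP.
  + by rewrite -qprojZ; apply/qprojP.
- by move=> x y /qprojP; rewrite /= /freqv /frmul /fnum /fden /= !mulr1.
- move=> q; have [x ->] := qproj_surj q => hx.
  have hn : fnum x <> 0.
    move=> h; apply: hx; rewrite -qproj0; apply/qprojP.
    by rewrite /= /freqv h /fnum /= !mul0r.
  exists (qproj (mkfrac (fden x) hn : sa_sort (frac_setoid hR))).
  rewrite -qprojM -qproj1; apply/qprojP; rewrite /= /freqv /frmul /fnum /fden /=; ring.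
- move=> q; have [x ->] := qproj_surj q.
  exists (fnum x), (fden x); split; first exact: fden_neq0.
  rewrite -qprojM; apply/qprojP; rewrite /= /freqv /frmul /fnum /fden /=. ring.
Qed.

Section FracExtend.
Variables (k : fieldType) (R Q : comAlgType k) (i : R -> Q).
Hypothesis hi : is_frac i.

Lemma frac_num_den : exists num den : Q -> R,
  forall q, den q <> 0 /\ q * i (den q) = i (num q).
Proof.
have /choice[nd hnd] : forall q, exists p : R * R, p.2 <> 0 /\ q * i p.2 = i p.1.
  by move=> q; have [a [b h]] := frac_rep hi q; exists (a, b).
by exists (fun q => (nd q).1), (fun q => (nd q).2).
Qed.

Lemma frac_den_unit b : b <> 0 -> exists u, i b * u = 1.
Proof.
move=> hb; apply: (frac_field hi) => h; apply: hb.
by apply: (frac_inj hi); rewrite h (khom0 (frac_khom hi)).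
Qed.

Lemma frac_domain_base : is_domain R.
Proof.
move=> x y hxy; have := field_domain (frac_field hi) (x := i x) (y := i y).
rewrite -(khomM (frac_khom hi)) hxy (khom0 (frac_khom hi)).
by case=> // h; [left | right]; apply: (frac_inj hi); rewrite h (khom0 (frac_khom hi)).
Qed.

Lemma frac_extend (S : comAlgType k) (phi : R -> S) : khom phi ->
  (forall b, b <> 0 -> exists u, phi b * u = 1) ->
  exists psi : Q -> S, khom psi /\ forall x, psi (i x) = phi x.
Proof.
move=> hphi hu; have [num [den hnd]] := frac_num_den.
have /choice[iv hiv] : forall b, exists u, b <> 0 -> phi b * u = 1.
  by move=> b; case: (EM (b = 0)) => [->|/hu[u hb]]; [exists 0 | exists u].
have iK := khomM (frac_khom hi).
pose psi q := phi (num q) * iv (den q).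
have psiE q a b : b <> 0 -> q * i b = i a -> psi q * phi b = phi a.
  move=> hb hq; have [hd hn] := hnd q.
  have e : num q * b = a * den q.
    by apply: (frac_inj hi); rewrite !iK -hn -hq mulrAC.
  have := hiv _ hd => hdu.
  apply: (@unit_cancel _ _ _ (phi (den q)) _ hdu).
  rewrite /psi mulrAC -[_ * iv _ * _]mulrA [iv _ * _]mulrC hdu mulr1.
  by rewrite -!(khomM hphi) e.
(* [psi q] is characterised by any fraction for [q]; each law below only has to name a fraction of
   the result. *)
have psiU q s a b : b <> 0 -> q * i b = i a -> s * phi b = phi a -> psi q = s.
  move=> hb hq hs; apply: (@unit_cancel _ _ _ (phi b) _ (hiv _ hb)).
  by rewrite hs; exact: psiE.
have mul0 x y : x <> 0 -> y <> 0 -> x * y <> 0 := domain_mul_neq0 frac_domain_base.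
have iD := khomD (frac_khom hi).
exists psi; split; first split.
- move=> x y; have [hd hx] := hnd x; have [hd' hy] := hnd y.
  apply: (psiU _ _ (num x * den y + num y * den x) (den x * den y)).
  + exact: mul0.
  + by rewrite iD !iK -hx -hy; ring.
  + by rewrite (khomD hphi) !(khomM hphi) -(psiE _ _ _ hd hx) -(psiE _ _ _ hd' hy); ring.
- move=> x y; have [hd hx] := hnd x; have [hd' hy] := hnd y.
  apply: (psiU _ _ (num x * num y) (den x * den y)).
  + exact: mul0.
  + by rewrite !iK -hx -hy; ring.
  + by rewrite !(khomM hphi) -(psiE _ _ _ hd hx) -(psiE _ _ _ hd' hy); ring.
- apply: (psiU _ _ 1 1); first exact: one_neq0.
  + by rewrite mul1r.
  + by rewrite mul1r.
- move=> c x; have [hd hx] := hnd x.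
  apply: (psiU _ _ (c *: num x) (den x) hd).
  + by rewrite (khomZ (frac_khom hi)) -hx scalerAl.
  + by rewrite (khomZ hphi) -(psiE _ _ _ hd hx) -scalerAl.
- move=> x; apply: (psiU _ _ x 1); first exact: one_neq0.
  + by rewrite (khom1 (frac_khom hi)) mulr1.
  + by rewrite (khom1 hphi) mulr1.
Qed.

(** The Leibniz rule applied to [q * i b = i a] determines the value at [q]. The twist by [psi]
    covers both derivations of [Q] and the two composites of a homomorphism with derivations. *)
Lemma frac_leibniz_uniq (S : comAlgType k) (psi D1 D2 : Q -> S) : khom psi ->
  (forall x y, D1 (x * y) = psi x * D1 y + D1 x * psi y) ->
  (forall x y, D2 (x * y) = psi x * D2 y + D2 x * psi y) ->
  (forall x, D1 (i x) = D2 (i x)) -> forall q, D1 q = D2 q.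
Proof.
move=> hpsi L1 L2 e q; have [a [b [hb hq]]] := frac_rep hi q.
have [u hu] := frac_den_unit hb.
apply: (@unit_cancel _ _ _ (psi (i b)) (psi u)).
  by rewrite -(khomM hpsi) hu (khom1 hpsi).
apply: (addrI (psi q * D1 (i b))); rewrite -L1 hq e.
by rewrite [in RHS]e -L2 hq.
Qed.

Lemma frac_khom_uniq (S : comAlgType k) (f g : Q -> S) : khom f -> khom g ->
  (forall x, f (i x) = g (i x)) -> forall q, f q = g q.
Proof.
move=> hf hg e q; have [a [b [hb hq]]] := frac_rep hi q.
have [u hu] := frac_den_unit hb.
apply: (@unit_cancel _ _ _ (f (i b)) (f u)).
  by rewrite -(khomM hf) hu (khom1 hf).
by rewrite -(khomM hf) hq [in RHS]e -(khomM hg) hq.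
Qed.

Lemma frac_derivation (d : R -> R) : is_derivation d ->
  exists dQ : Q -> Q, is_derivation dQ /\ forall x, dQ (i x) = i (d x).
Proof.
case=> dD [dM dZ]; have [num [den hnd]] := frac_num_den.
have [iv hiv] := field_inverse (frac_field hi).
have iK := khomM (frac_khom hi); have iD := khomD (frac_khom hi).
have i_neq0 b : b <> 0 -> i b <> 0.
  by move=> hb h; apply: hb; apply: (frac_inj hi); rewrite h (khom0 (frac_khom hi)).
(* The quotient rule, solved from the derivative of [q * b = a]. *)
pose dQ q := (i (d (num q)) - q * i (d (den q))) * iv (i (den q)).
have dQU q s a b : b <> 0 -> q * i b = i a ->
    s * i b = i (d a) - q * i (d b) -> dQ q = s.
  move=> hb hq hs; have [hd hn] := hnd q.
  have e : num q * b = a * den q.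
    by apply: (frac_inj hi); rewrite !iK -hn -hq mulrAC.
  apply: (@unit_cancel _ _ _ (i (den q)) _ (hiv _ (i_neq0 _ hd))).
  apply: (@unit_cancel _ _ _ (i b) _ (hiv _ (i_neq0 _ hb))).
  rewrite [s * _ * _]mulrAC hs /dQ -[_ * iv _ * _]mulrA [iv _ * _]mulrC hiv; last exact: i_neq0.
  rewrite mulr1.
  have := congr1 (fun x => i (d x)) e; rewrite /= !dM !iD !iK -hn -hq => e'.
  apply/eqP; rewrite -subr_eq0.
  have -> : (i (d (num q)) - q * i (d (den q))) * i b -
      (i (d a) - q * i (d b)) * i (den q) =
    (q * i (den q) * i (d b) + i (d (num q)) * i b) -
    (q * i b * i (d (den q)) + i (d a) * i (den q)) by ring.
  by rewrite e' subrr.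
have dQE q a b : b <> 0 -> q * i b = i a -> dQ q * i b = i (d a) - q * i (d b).
  move=> hb hq.
  rewrite (dQU q ((i (d a) - q * i (d b)) * iv (i b)) a b hb hq).
    by rewrite -mulrA [iv _ * _]mulrC hiv ?mulr1 //; exact: i_neq0.
  by rewrite -mulrA [iv _ * _]mulrC hiv ?mulr1 //; exact: i_neq0.
have mul0 x y : x <> 0 -> y <> 0 -> x * y <> 0 := domain_mul_neq0 frac_domain_base.
exists dQ; split; first (split; last split).
- move=> x y; have [hd hx] := hnd x; have [hd' hy] := hnd y.
  apply: (dQU _ _ (num x * den y + num y * den x) (den x * den y)).
  + exact: mul0.
  + by rewrite iD !iK -hx -hy; ring.
  + have := dQE _ _ _ hd hx; have := dQE _ _ _ hd' hy.
    move/eqP; rewrite -subr_eq0 => /eqP E1 /eqP; rewrite -subr_eq0 => /eqP E2.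
    rewrite dD !dM !iD !iK -hx -hy; apply/eqP; rewrite -subr_eq0.
    (* The difference of the two sides is the combination of the vanishing expressions [E1] and [E2]
       with coefficients [i (den x)] and [i (den y)]. *)
    apply/eqP; rewrite -[RHS](mulr0 (i (den x))) -E1.
    rewrite -[LHS]addr0 -[X in _ + X = _](mulr0 (- i (den y))) -E2; ring.
- move=> x y; have [hd hx] := hnd x; have [hd' hy] := hnd y.
  apply: (dQU _ _ (num x * num y) (den x * den y)).
  + exact: mul0.
  + by rewrite !iK -hx -hy; ring.
  + have := dQE _ _ _ hd hx; have := dQE _ _ _ hd' hy.
    move/eqP; rewrite -subr_eq0 => /eqP E1 /eqP; rewrite -subr_eq0 => /eqP E2.
    rewrite !dM !iD !iK -hx -hy; apply/eqP; rewrite -subr_eq0.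
    apply/eqP; rewrite -[RHS](mulr0 (i (den x) * x)) -E1.
    rewrite -[LHS]addr0 -[X in _ + X = _](mulr0 (- i (den y) * y)) -E2; ring.
- move=> c x; have [hd hx] := hnd x.
  apply: (dQU _ _ (c *: num x) (den x) hd).
  + by rewrite (khomZ (frac_khom hi)) -hx scalerAl.
  + by rewrite dZ (khomZ (frac_khom hi)) -scalerAl (dQE _ _ _ hd hx) scalerBr scalerAl.
- have d1 := derivation1 (conj dD (conj dM dZ)).
  move=> x; apply: (dQU (i x) (i (d x)) x 1); first exact: one_neq0.
  + by rewrite (khom1 (frac_khom hi)) mulr1.
  + by rewrite d1 (khom1 (frac_khom hi)) (khom0 (frac_khom hi)) mulr0 subr0 mulr1.
Qed.

Lemma frac_dalg (m : nat) (d : 'I_m -> R -> R) : dalg d ->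
  exists dQ : 'I_m -> Q -> Q, dalg dQ /\ dhom d dQ i.
Proof.
move=> hd.
have /choice[dQ hdQ] : forall j, exists dj : Q -> Q,
    is_derivation dj /\ forall x, dj (i x) = i (d j x).
  by move=> j; apply: frac_derivation; exact: dalg_der hd j.
exists dQ; split; last by split=> [|j x]; [exact: (frac_khom hi)|rewrite (hdQ j).2].
split=> [j|p q x]; first by have [] := hdQ j.
have [pD [pM pZ]] := (hdQ p).1; have [qD [qM qZ]] := (hdQ q).1.
apply/eqP; rewrite -subr_eq0; apply/eqP.
(* The commutator of two derivations is again a derivation, and it vanishes on [R]. *)
apply: (@frac_leibniz_uniq Q id (fun x => dQ p (dQ q x) - dQ q (dQ p x)) (fun=> 0)).
- exact: khom_id.
- by move=> a b; rewrite qM pD !pM qD !qM; ring.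
- by move=> a b; rewrite mulr0 mul0r addr0.
- by move=> a; rewrite !(hdQ _).2 (dalg_comm hd) subrr.
Qed.

End FracExtend.

(** * Partial homomorphisms *)

(* A partial homomorphism is a subring of [R * S]; it is a function exactly when
   it contains no [(0, b)] with [b <> 0]. *)
Record subring_graph (R S : comNzRingType) (G : R -> S -> Prop) : Prop := SubringGraph {
  graph1 : G 1 1;
  graphN : forall a b, G a b -> G (- a) (- b);
  graphD : forall a b a' b', G a b -> G a' b' -> G (a + a') (b + b');
  graphM : forall a b a' b', G a b -> G a' b' -> G (a * a') (b * b') }.

Definition functional_graph (R S : comNzRingType) (G : R -> S -> Prop) : Prop :=
  forall b, G 0 b -> b = 0.

Definition graph_poly (R S : comNzRingType) (G : R -> S -> Prop)
  (f : {poly R}) (g : {poly S}) : Prop := forall i, G f`_i g`_i.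

Definition graph_adjoin (R S : comNzRingType) (G : R -> S -> Prop) (x : R) (y : S)
  (a : R) (b : S) : Prop :=
  exists f g, [/\ graph_poly G f g, a = f.[x] & b = g.[y]].

Lemma nat_min (P : nat -> Prop) : (exists n, P n) ->
  exists n, P n /\ forall i, P i -> (n <= i)%N.
Proof.
case=> n; have [N] := ubnP n; elim: N n => // N ih n hn Pn.
case: (EM (exists i, P i /\ (i < n)%N)) => [[i [Pi hi]]|hno].
  exact: (ih i (leq_trans hi hn) Pi).
exists n; split=> // i Pi; rewrite leqNgt; apply/negP => hi.
by apply: hno; exists i.
Qed.

(** Zorn's lemma for partial maps. The union of a chain is handled through its only useful property:
    any two of its pairs lie in a common good subrelation, which suffices for closure under binary
    operations. *)
Lemma relation_zorn (X Y : Type) (good : (X -> Y -> Prop) -> Prop) (base : X -> Y -> Prop) :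
  good base ->
  (forall U, (forall a b, base a b -> U a b) ->
    (forall a b a' b', U a b -> U a' b' ->
      exists G, [/\ good G, G a b, G a' b' & forall x y, G x y -> U x y]) -> good U) ->
  (forall G x, good G -> exists G',
    [/\ good G', (forall a b, G a b -> G' a b) & exists y, G' x y]) ->
  exists G, [/\ good G, (forall a b, base a b -> G a b) & forall x, exists y, G x y].
Proof.
move=> hbase hunion hext.
(* With [base] added throughout, the union of the empty chain is good too. *)
pose ext (A : set (X * Y)) a b := base a b \/ A (a, b).
have [C sC tC|A [PA maxA]] := @Zorn_bigcup (X * Y)%type (fun A => good (ext A)).
  apply: hunion => [a b|]; first by left.
  pose U := ext (\bigcup_(X in C) X)%classic.
  have sub A : C A -> forall x y, ext A x y -> U x y.
    by move=> CA x y [h|h]; [left | right; exists A].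
  move=> a b a' b' [h|[A CA Ah]] [h'|[A' CA' Ah']].
  - by exists base; split=> // x y hxy; left.
  - by exists (ext A'); split=> //; [exact: sC|left|right|exact: sub].
  - by exists (ext A); split=> //; [exact: sC|right|left|exact: sub].
  - have [AA'|A'A] := tC A A' CA CA'.
      by exists (ext A'); split=> //; [exact: sC|right; apply: AA'|right|exact: sub].
    by exists (ext A); split=> //; [exact: sC|right|right; apply: A'A|exact: sub].
exists (ext A); split=> //; first by left.
move=> x; have [G [hG sG [y hy]]] := hext _ x PA.
exists y; apply: contrapT => hxy.
apply: (maxA [set ab | G ab.1 ab.2]%classic).
  split=> [[a b] hab|sGA]; first by apply: sG; right.
  by apply: hxy; right; apply: sGA.
have -> // : ext [set ab | G ab.1 ab.2]%classic = G.
apply/funext => a; apply/funext => b; apply/propext; split=> [[h|//]|h]; last by right.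
by apply: sG; left.
Qed.

Section Graph.
Variables (R S : comNzRingType) (G : R -> S -> Prop).
Hypothesis hG : subring_graph G.

Lemma graph0 : G 0 0.
Proof.
rewrite -(subrr 1) -[X in G _ X](subrr 1).
by apply: (graphD hG); [|apply: (graphN hG)]; exact: graph1 hG.
Qed.

Lemma graphB a b a' b' : G a b -> G a' b' -> G (a - a') (b - b').
Proof. by move=> h h'; apply: (graphD hG) => //; exact: (graphN hG). Qed.

Lemma graphMn a b n : G a b -> G (a *+ n) (b *+ n).
Proof.
move=> h; elim: n => [|n ih]; rewrite ?mulr0n ?mulrS; first exact: graph0.
exact: (graphD hG).
Qed.

Lemma graph_sum n (F : nat -> R) (F' : nat -> S) :
  (forall i, G (F i) (F' i)) -> G (\sum_(i < n) F i) (\sum_(i < n) F' i).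
Proof.
move=> h; elim: n => [|n ih]; first by rewrite !big_ord0; exact: graph0.
by rewrite !big_ord_recr; apply: (graphD hG).
Qed.

Lemma graph_functional : functional_graph G ->
  forall a b b', G a b -> G a b' -> b = b'.
Proof.
move=> hf a b b' h h'; apply/eqP; rewrite -subr_eq0; apply/eqP/hf.
by rewrite -(subrr a); exact: graphB.
Qed.

Lemma graph_polyD f g f' g' : graph_poly G f g -> graph_poly G f' g' ->
  graph_poly G (f + f') (g + g').
Proof. by move=> h h' i; rewrite !coefD; apply: (graphD hG). Qed.

Lemma graph_polyN f g : graph_poly G f g -> graph_poly G (- f) (- g).
Proof. by move=> h i; rewrite !coefN; apply: (graphN hG). Qed.

Lemma graph_polyM f g f' g' : graph_poly G f g -> graph_poly G f' g' ->
  graph_poly G (f * f') (g * g').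
Proof.
move=> h h' i; rewrite !coefM.
by apply: (@graph_sum _ (fun j => f`_j * f'`_(i - j)) (fun j => g`_j * g'`_(i - j))) => j;
   apply: (graphM hG).
Qed.

Lemma graph_polyC a b : G a b -> graph_poly G a%:P b%:P.
Proof. by move=> h i; rewrite !coefC; case: ifP => _ //; exact: graph0. Qed.

Lemma graph_polyXn n : graph_poly G 'X^n 'X^n.
Proof. by move=> i; rewrite !coefXn; case: (_ == _); [exact: graph1 hG|exact: graph0]. Qed.

Lemma graph_poly_deriv f g : graph_poly G f g -> graph_poly G f^`() g^`().
Proof. by move=> h i; rewrite !coef_deriv; exact: graphMn. Qed.

Lemma graph_adjoinP x y : subring_graph (graph_adjoin G x y).
Proof.
split.
- exists 1, 1; split; rewrite ?hornerC //; rewrite -!polyC1; apply: graph_polyC; exact: graph1 hG.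
- move=> a b [f [g [h -> ->]]]; exists (- f), (- g); rewrite !hornerN; split=> //.
  exact: graph_polyN.
- move=> a b a' b' [f [g [h -> ->]]] [f' [g' [h' -> ->]]].
  exists (f + f'), (g + g'); rewrite !hornerD; split=> //; exact: graph_polyD.
- move=> a b a' b' [f [g [h -> ->]]] [f' [g' [h' -> ->]]].
  exists (f * f'), (g * g'); rewrite !hornerM; split=> //; exact: graph_polyM.
Qed.

Lemma graph_adjoin_sub x y a b : G a b -> graph_adjoin G x y a b.
Proof. by move=> h; exists a%:P, b%:P; rewrite !hornerC; split=> //; exact: graph_polyC. Qed.

Lemma graph_adjoin_gen x y : graph_adjoin G x y x y.
Proof. by exists 'X, 'X; rewrite !hornerX; split=> //; exact: (graph_polyXn 1). Qed.

Lemma graph_poly0 g : functional_graph G -> graph_poly G 0 g -> g = 0.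
Proof. by move=> hf h; apply/polyP => i; rewrite coef0; apply: hf; have := h i; rewrite coef0. Qed.

Lemma adjoin_transcendental x y : functional_graph G ->
  (forall f g, graph_poly G f g -> f.[x] = 0 -> f = 0) ->
  functional_graph (graph_adjoin G x y).
Proof.
move=> hf htr b [f [g [h e ->]]]; have f0 := htr f g h (esym e).
by move: h; rewrite f0 => /(graph_poly0 hf) ->; rewrite horner0.
Qed.

(** The coefficients form a ring only, so a relation [f] at [x] is reduced by pseudo-division by the
    minimal one. The same step on the side of [S] multiplies the value by the leading coefficient of
    [g0]; its regularity allows cancelling, although [S] may have zero divisors. *)
Lemma adjoin_algebraic x y f0 g0 : functional_graph G ->
  graph_poly G f0 g0 -> f0 != 0 -> f0.[x] = 0 -> g0.[y] = 0 ->
  (forall b, g0`_(size f0).-1 * b = 0 -> b = 0) ->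
  (forall f g, graph_poly G f g -> f.[x] = 0 -> (size f < size f0)%N -> f = 0) ->
  functional_graph (graph_adjoin G x y).
Proof.
move=> hf h0 nz0 fx0 gy0 hreg hmin b [f [g [h e ->]]].
have [n] := ubnP (size f); elim: n f g h e => // n ih f g h e hn.
have hlt f' g' : graph_poly G f' g' -> 0 = f'.[x] -> (size f' < size f0)%N -> g'.[y] = 0.
  move=> h' e' hs; have f0' := hmin f' g' h' (esym e') hs.
  by move: h'; rewrite f0' => /(graph_poly0 hf) ->; rewrite horner0.
case: (ltnP (size f) (size f0)) => hs; first exact: (hlt f g).
have s0 : (0 < size f0)%N by rewrite size_poly_gt0.
set d := (size f0).-1 in hreg *; set e0 := (size f).-1; set q := (e0 - d)%N.
(* One step of pseudo-division, mirrored by [g1]: the terms of degree [e0] cancel. *)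
pose f1 := f0`_d *: f - f`_e0 *: ('X^q * f0).
pose g1 := g0`_d *: g - g`_e0 *: ('X^q * g0).
have h1 : graph_poly G f1 g1.
  rewrite /f1 /g1 -!mul_polyC; apply: graph_polyD; last apply: graph_polyN.
    by apply: graph_polyM => //; apply: graph_polyC.
  apply: graph_polyM; first exact: graph_polyC.
  by apply: graph_polyM => //; exact: graph_polyXn.
have e1 : 0 = f1.[x].
  by rewrite /f1 hornerD hornerN !hornerZ hornerM fx0 -e !mulr0 subr0.
have sf : size f = e0.+1 by rewrite prednK // (leq_trans s0).
have sf0 : size f0 = d.+1 by rewrite prednK.
have dq : (d <= e0)%N by rewrite -ltnS -sf -sf0.
have s1 : (size f1 <= e0)%N.
  apply/leq_sizeP => j; rewrite leq_eqVlt => /orP[/eqP <-|hj].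
    rewrite /f1 coefB !coefZ coefXnM ltnNge leq_subr /= subKn //.
    by rewrite mulrC subrr.
  rewrite /f1 coefB !coefZ coefXnM [f`_j]nth_default ?sf // mulr0.
  case: ifP => _; first by rewrite mulr0 subrr.
  rewrite [f0`_(j - q)]nth_default ?mulr0 ?subrr // sf0.
  by rewrite ltn_subRL /q subnK.
rewrite sf in hn; have E := ih f1 g1 h1 e1 (leq_ltn_trans s1 hn).
apply: hreg; move: E; rewrite /g1 hornerD hornerN !hornerZ hornerM gy0 !mulr0 subr0.
by [].
Qed.

Lemma minimal_relation x :
  (exists f g, [/\ graph_poly G f g, f.[x] = 0 & f <> 0]) ->
  exists f g, [/\ graph_poly G f g, f.[x] = 0, f != 0 &
    forall f' g', graph_poly G f' g' -> f'.[x] = 0 -> (size f' < size f)%N -> f' = 0].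
Proof.
move=> hex.
have [|n [[f [g [h e nz sz]]] hmin]] := @nat_min (fun n => exists f g,
    [/\ graph_poly G f g, f.[x] = 0, f <> 0 & size f = n]).
  by case: hex => f [g [h e nz]]; exists (size f), f, g.
exists f, g; split=> //; first exact/eqP.
move=> f' g' h' e' hs; apply: contrapT => nz'.
have := hmin (size f'); rewrite -sz leqNgt hs => H.
by have : false by apply: H; exists f', g'.
Qed.

(** The derivative has smaller degree and still has its coefficients in the graph; if it vanished at
    [x] it would be 0 by minimality, which characteristic 0 forbids. *)
Lemma minimal_separable x f g :
  (forall (a : R) n, a *+ n.+1 = 0 -> a = 0) ->
  graph_poly G f g -> f.[x] = 0 -> f != 0 ->
  (forall f' g', graph_poly G f' g' -> f'.[x] = 0 -> (size f' < size f)%N -> f' = 0) ->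
  f^`().[x] <> 0.
Proof.
move=> hchar h e nz hmin e'.
have f'0 := hmin _ _ (graph_poly_deriv h) e' (lt_size_deriv nz).
have s1 : (1 < size f)%N.
  rewrite ltnNge; apply/negP => /size1_polyC fE; move: e nz.
  by rewrite fE hornerC => ->; rewrite polyC0 eqxx.
have := congr1 (fun p : {poly R} => p`_(size f).-2) f'0.
rewrite /= coef_deriv coef0 => /hchar.
have -> : (size f).-2.+1 = (size f).-1 by case: (size f) s1 => [|[]].
by move/eqP; rewrite -lead_coefE lead_coef_eq0 (negbTE nz).
Qed.

End Graph.

(** * Newton's iteration *)

Section Nilpotent.
Variable R : comNzRingType.

Definition nilpotent (x : R) : Prop := exists n, x ^+ n = 0.
Definition invertible (x : R) : Prop := exists y, x * y = 1.

Lemma expr_eq0_le (x : R) n N : x ^+ n = 0 -> (n <= N)%N -> x ^+ N = 0.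
Proof. by move=> h /subnKC <-; rewrite exprD h mul0r. Qed.

Lemma nilpotentD x y : nilpotent x -> nilpotent y -> nilpotent (x + y).
Proof.
move=> [n hn] [p hp]; exists (n + p)%N; rewrite exprDn big1 // => i _.
case: (leqP p i) => hi; first by rewrite (expr_eq0_le hp hi) mulr0 mul0rn.
rewrite (@expr_eq0_le x n) ?mul0r ?mul0rn //.
by rewrite -addnBA ?leq_addr // ltnW.
Qed.

Lemma nilpotent_sum (I : finType) (F : I -> R) :
  (forall i, nilpotent (F i)) -> nilpotent (\sum_i F i).
Proof.
move=> h; elim/big_rec: _ => [|i x _ hx]; first by exists 1%N; rewrite expr1.
exact: nilpotentD.
Qed.

Lemma nilpotentM x y : nilpotent x -> nilpotent (x * y).
Proof. by case=> n hn; exists n; rewrite exprMn hn mul0r. Qed.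

Lemma invertible_1D x : nilpotent x -> invertible (1 + x).
Proof.
case=> n hn; exists (\sum_(i < n) (- x) ^+ i).
by rewrite -[1 + x]opprK opprD addrC -opprB opprK mulrC -[X in _ * X]opprB mulrN mulrC -subrX1
   exprNn hn mulr0 sub0r opprK.
Qed.

Lemma horner_add_first (f : {poly R}) x h : exists r, f.[x + h] = f.[x] + h * r.
Proof.
elim/poly_ind: f => [|f c [r hr]]; first by exists 0; rewrite !horner0; ring.
by exists (f.[x] + r * (x + h)); rewrite !hornerMXaddC hr; ring.
Qed.

Lemma horner_add_second (f : {poly R}) x h :
  exists r, f.[x + h] = f.[x] + f^`().[x] * h + h ^+ 2 * r.
Proof.
elim/poly_ind: f => [|f c [r hr]].
  by exists 0; rewrite deriv0 !horner0; ring.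
exists (f^`().[x] + r * (x + h)).
by rewrite derivD derivM derivX derivC mulr1 !hornerE hr; ring.
Qed.

(** All iterates are kept in the form [y + a * s] with [a = f.[y]]: they differ from [y] by a
    nilpotent, so the derivative stays invertible. Each step raises by one the power of [a] dividing
    the value, and some power of [a] is 0. *)
Lemma newton_root (f : {poly R}) y :
  nilpotent f.[y] -> invertible f^`().[y] -> exists s, f.[y + f.[y] * s] = 0.
Proof.
move=> hnil [u hu]; set a := f.[y] in hnil *.
have hinv s : invertible f^`().[y + a * s].
  have [r ->] := horner_add_first f^`() y (a * s).
  have [|v hv] := @invertible_1D (a * (s * r * u)); first exact: nilpotentM.
  exists (u * v); rewrite -hv -hu; ring.
have step n : exists s c, f.[y + a * s] = a ^+ n.+1 * c.
  elim: n => [|n [s [c hs]]]; first by exists 0, 1; rewrite mulr0 addr0 expr1 mulr1.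
  have [w hw] := hinv s.
  have [r hr] := horner_add_second f (y + a * s) (- (a ^+ n.+1 * c * w)).
  exists (s - a ^+ n * c * w), (a ^+ n * (c * w) ^+ 2 * r).
  have -> : y + a * (s - a ^+ n * c * w) = y + a * s - a ^+ n.+1 * c * w.
    by rewrite exprS; ring.
  rewrite hr hs.
  set F := f^`().[_] in hw *.
  transitivity (a ^+ n.+1 * c * (1 - F * w) + (a ^+ n.+1 * c * w) ^+ 2 * r); first by ring.
  rewrite hw; rewrite !exprS; ring.
have [n hn] := hnil; have [s [c hs]] := step n.
by exists s; rewrite hs exprS hn mulr0 mul0r.
Qed.

End Nilpotent.

(** * The algebra B and its extension of scalars *)

Lemma maximal_ideal_exists (R : nzRingType) (J : R -> Prop) :
  is_ideal J -> ~ J 1 -> exists I, is_maximal_ideal I /\ forall x, J x -> I x.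
Proof.
move=> hJ J1.
pose good (A : set R) := is_ideal A /\ ~ A 1 /\ forall x, J x -> A x.
have [C sC tC|A [PA maxA]] := @Zorn_bigcup R (fun A => (forall x, ~ A x) \/ good A).
  case: (EM (exists2 A, C A & good A)) => [[A0 CA0 gA0]|hno]; last first.
    left=> x [A CA Ax]; case: (sC A CA) => [/(_ x)//|gA].
    by apply: hno; exists A.
  right; split; [split; [|split]|split].
  - by exists A0 => //; have [[]] := gA0.
  - move=> x y [A CA Ax] [A' CA' Ay].
    have [|] := tC A A' CA CA' => sAA.
      exists A' => //; case: (sC A' CA') => [/(_ _ Ay)//|[[_ [D _]] _]].
      by apply: D => //; apply: sAA.
    exists A => //; case: (sC A CA) => [/(_ _ Ax)//|[[_ [D _]] _]].
    by apply: D => //; apply: sAA.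
  - move=> a x [A CA Ax]; exists A => //.
    by case: (sC A CA) => [/(_ _ Ax)//|[[_ [_ M]] _]]; apply: M.
  - by case=> A CA A1; case: (sC A CA) => [/(_ _ A1)//|[_ []]].
  - by move=> x Jx; exists A0 => //; have [_ [_ h]] := gA0; exact: h.
have gA : good A.
  case: PA => // hA; exfalso.
  apply: (maxA J); last by right; split.
  by split=> [x /hA//|/(_ 0)]; have [h _] := hJ; move/(_ h)/hA.
have [hA [A1 sA]] := gA.
exists A; split=> //; split=> //; split=> // I hI sAI.
case: (EM (I 1)) => I1; [by right | left=> x; split; last exact: sAI].
move=> Ix; apply: contrapT => nAx; apply: (maxA I).
  by split=> // sIA; apply: nAx; apply: sIA.
by right; split=> //; split=> // y /sA /sAI.
Qed.

Section AlgebraB.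
Variables (k : fieldType) (B : falgType k).
Hypothesis hBcomm : forall x y : B, x * y = y * x.
Hypothesis hBres : residue_fields_trivial B.
Variables (l : nat) (eps : l.+1.-tuple B).
Hypothesis heps : basis_of fullv eps.

Section Hom.
Variable p : B -> k.
Hypothesis hp : kalg_hom p.
Lemma homD x y : p (x + y) = p x + p y. Proof. by have [h _] := hp. Qed.
Lemma homZ c x : p (c *: x) = c * p x. Proof. by have [_ [h _]] := hp. Qed.
Lemma homM x y : p (x * y) = p x * p y. Proof. by have [_ [_ [h _]]] := hp. Qed.
Lemma hom1 : p 1 = 1. Proof. by have [_ [_ [_ h]]] := hp. Qed.
Lemma hom0 : p 0 = 0. Proof. by rewrite -(scale0r 0) homZ mul0r. Qed.
Lemma homB x y : p (x - y) = p x - p y.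
Proof. by rewrite -scaleN1r homD homZ mulN1r. Qed.
Lemma hom_sum (I : Type) (r : seq I) (P : pred I) (F : I -> B) :
  p (\sum_(i <- r | P i) F i) = \sum_(i <- r | P i) p (F i).
Proof. exact: (big_morph p homD hom0). Qed.
Lemma hom_prod (I : Type) (r : seq I) (P : pred I) (F : I -> B) :
  p (\prod_(i <- r | P i) F i) = \prod_(i <- r | P i) p (F i).
Proof. exact: (big_morph p homM hom1). Qed.
Lemma homX x n : p (x ^+ n) = p x ^+ n.
Proof. by elim: n => [|n ih]; rewrite ?expr0 ?hom1 // !exprS homM ih. Qed.
End Hom.

(** [p b] is the scalar congruent to [b] modulo [I], unique because a proper ideal contains no
    nonzero scalar. *)
Lemma hom_of_maximal (I : B -> Prop) : is_maximal_ideal I ->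
  exists p : B -> k, kalg_hom p /\ forall b, I b -> p b = 0.
Proof.
move=> hI; have [[I0 [ID IM]] [I1 _]] := hI.
have IMr a x : I x -> I (x * a) by rewrite hBcomm; exact: IM.
have IN x : I x -> I (- x) by rewrite -mulN1r; exact: IM.
have [p hp] := choice (hBres hI).
have cst c : I c%:A -> c = 0.
  move=> hc; apply/eqP/negPn/negP => nz; apply: I1.
  have -> : 1 = (c^-1)%:A * c%:A :> B by rewrite -scalerAl mul1r scalerA mulVf ?scale1r.
  exact: IM.
have pU b c : I (b - c%:A) -> p b = c.
  move=> hc; apply/eqP; rewrite -subr_eq0; apply/eqP/cst.
  have -> : (p b - c)%:A = (b - c%:A) - (b - (p b)%:A).
    by rewrite scalerBl opprB [RHS]addrC addrA subrK.
  by apply: ID => //; apply: IN.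
exists p; split; last by move=> b hb; apply: pU; rewrite scale0r subr0.
split; [|split; [|split]].
- move=> x y; apply: pU; rewrite scalerDl opprD addrACA; exact: ID.
- move=> c x; apply: pU; rewrite -scalerA -scalerBr -[_ - _]mul1r scalerAl; exact: IM.
- move=> x y; apply: pU.
  have -> : x * y - (p x * p y)%:A = (x - (p x)%:A) * y + (p x)%:A * (y - (p y)%:A).
    rewrite mulrBl mulrBr addrA subrK -!scalerAl !mul1r scalerA.
    by congr (_ - _).
  by apply: ID; [exact: IMr | exact: IM].
- by apply: pU; rewrite scale1r subrr.
Qed.

(* A linear relation between the powers of [b] reads [b ^+ r * u = 0] with
   [p u <> 0] for every [p]; then [u] lies in no maximal ideal. *)
Lemma hom_nilpotent (b : B) : (forall p, kalg_hom p -> p b = 0) -> exists n, b ^+ n = 0.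
Proof.
move=> hb; pose d := \dim {: B}; pose X := [tuple b ^+ i | i < d.+1].
have : ~~ free X.
  apply/negP => /eqP fX; have := dim_span X; rewrite fX size_tuple => h.
  by have := dimvS (subvf <<X>>%VS); rewrite fX size_tuple ltnn.
move/freeP => hX.
have [c [hc nz]] : exists c : 'I_d.+1 -> k,
    \sum_i c i *: b ^+ i = 0 /\ exists i, c i <> 0.
  apply: contrapT => hno; apply: hX => c hc i; apply: contrapT => nz.
  apply: hno; exists c; split; last by exists i.
  rewrite -[RHS]hc; apply: eq_bigr => j _; congr (_ *: _).
  by rewrite -tnth_nth tnth_mktuple.
have [|r [[hr cr] rmin]] := @nat_min (fun r => exists h : (r < d.+1)%N, c (Ordinal h) <> 0).
  by case: nz => [[i hi] nz]; exists i, hi.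
pose u := \sum_(i < d.+1 | (r <= i)%N) c i *: b ^+ (i - r).
have hu : b ^+ r * u = 0.
  rewrite mulr_sumr -[RHS]hc [RHS](bigID (fun i : 'I__ => (r <= i)%N)) /=.
  rewrite [X in _ = _ + X]big1 ?addr0 => [|i hi].
    by apply: eq_bigr => i hi; rewrite -scalerAr -exprD subnKC.
  have -> : c i = 0; last by rewrite scale0r.
  apply: contrapT => ci; move: hi; rewrite (rmin i) //.
  by case: i ci => i hi ci; exists hi.
have pu p : kalg_hom p -> p u <> 0.
  move=> hp; rewrite hom_sum // (bigD1 (Ordinal hr)) //= big1 => [|i /andP[hi hne]].
    by rewrite addr0 homZ // subnn expr0 hom1 // mulr1.
  rewrite homZ // homX // hb // expr0n subn_eq0 leqNgt ltn_neqAle hi andbT.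
  by rewrite eq_sym -(inj_eq val_inj) /= in hne; rewrite hne mulr0.
pose J x := exists v, x = u * v.
have hJ : is_ideal J.
  split; first by exists 0; rewrite mulr0.
  split=> [x y [v ->] [w ->]|a x [v ->]]; first by exists (v + w); rewrite mulrDr.
  by exists (v * a); rewrite hBcomm mulrA.
case: (EM (J 1)) => [[v hv]|/(maximal_ideal_exists hJ)[I [hI sI]]].
  by exists r; rewrite -[LHS]mulr1 hv mulrA hu mul0r.
have [p [hp pI]] := hom_of_maximal hI.
by case: (pu p hp); apply/pI/sI; exists 1; rewrite mulr1.
Qed.

(** The dual elements [d] witness that the [h i] together map [B] onto the product of [N] copies of
    [k]; modulo the common kernel of the [h i] they are its primitive idempotents. *)
Definition hom_family N (h : 'I_N -> B -> k) (d : 'I_N -> B) : Prop :=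
  (forall i, kalg_hom (h i)) /\ forall i j, h i (d j) = (i == j)%:R.

(** Chinese remainders: an element separating [h i] from [h j] is normalised to the values 1 and 0,
    and [d j] is the product of these over all [i] other than [j]. *)
Lemma hom_family_of_injective N (h : 'I_N -> B -> k) :
  (forall i, kalg_hom (h i)) -> injective h -> exists d, hom_family h d.
Proof.
move=> hh inj.
have /choice[s hs] : forall ij : 'I_N * 'I_N, exists s,
    ij.1 != ij.2 -> h ij.1 s = 1 /\ h ij.2 s = 0.
  case=> i j /=; case: (eqVneq i j) => [_|hij]; first by exists 0.
  have [b hb] : exists b, h i b <> h j b.
    apply: contrapT => hno; case/eqP: hij; apply: inj; apply/funext => b.
    by apply: contrapT => hb; apply: hno; exists b.
  have nz : h i b - h j b != 0 by rewrite subr_eq0; apply/eqP.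
  exists ((h i b - h j b)^-1 *: (b - (h j b)%:A)) => _.
  rewrite !homZ // !homB // !homZ // !hom1 // !mulr1 subrr mulr0 mulVf //.
exists (fun j => \prod_(i | i != j) s (j, i)); split=> // i j.
rewrite hom_prod //; case: (eqVneq i j) => [->|hij].
  by rewrite big1 // => i' hi'; have [] := hs (j, i'); rewrite // eq_sym.
rewrite (bigD1 i) //=; have [|_ ->] := hs (j, i); first by rewrite eq_sym.
by rewrite mul0r.
Qed.

Lemma basis_expand (b : B) : b = \sum_(q < l.+1) coord eps q b *: tnth eps q.
Proof.
rewrite {1}(coord_basis heps (memvf b)).
by apply: eq_bigr => q _; rewrite (tnth_nth 0).
Qed.

(** The values of the [h i] on the basis times the coordinates of the [d j] give the identity matrix
    of size [N], which therefore factors through dimension [l.+1]. *)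
Lemma hom_family_bound N (h : 'I_N -> B -> k) d : hom_family h d -> (N <= l.+1)%N.
Proof.
case=> hh hd; pose P := \matrix_(i, q) h i (tnth eps q).
pose D := \matrix_(q, j) coord eps q (d j).
apply: (@mulmx1_min _ _ _ P D); apply/matrixP => i j; rewrite !mxE -hd.
rewrite [in RHS](basis_expand (d j)) hom_sum //; apply: eq_bigr => q _.
by rewrite !mxE homZ // mulrC.
Qed.

(** A longest family is complete, since a further homomorphism could be put in front of it. Length
    is measured by the defect [n] from the bound [l.+1], so that [nat_min] finds a longest one. *)
Lemma hom_family_complete : exists N (h : 'I_N -> B -> k) d,
  hom_family h d /\ forall p, kalg_hom p -> exists i, p = h i.
Proof.
pose P n := exists (h : 'I_(l.+1 - n) -> B -> k) d, hom_family h d.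
have P_top : P l.+1.
  by rewrite /P subnn; exists (fun=> fun=> 0), (fun=> 0); split=> [[]|[]].
have [|n [[h [d hd]] nmin]] := @nat_min P.
  by exists l.+1.
exists (l.+1 - n)%N, h, d; split=> // p hp; apply: contrapT => hno.
pose h' (i : 'I_(l.+1 - n).+1) := if unlift ord0 i is Some j then h j else p.
have hh' i : kalg_hom (h' i) by rewrite /h'; case: unliftP => [j _|_]; have [] := hd.
have hinj : injective h.
  move=> i j e; apply/eqP; have := hd.2 i i; have := hd.2 j i; rewrite e eqxx => ->.
  by rewrite eq_sym; case: eqP => // _ /eqP; rewrite eq_sym oner_eq0.
have [|d' hd'] := @hom_family_of_injective _ h' hh'.
  move=> i j; rewrite /h'; case: (unliftP ord0 i) => [i' ->|->];
    case: (unliftP ord0 j) => [j' ->|->] //.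
  - by move/hinj ->.
  - by move=> e; case: hno; exists i'.
  - by move=> e; case: hno; exists j'.
have hb := hom_family_bound hd'.
have n0 : (0 < n)%N by rewrite lt0n; apply/eqP => n0; move: hb; rewrite n0 subn0 ltnn.
have hn : (n <= l.+1)%N by exact: nmin.
have : (n <= n.-1)%N; last by rewrite leqNgt prednK // leqnn.
apply: nmin; rewrite /P.
have -> : (l.+1 - n.-1 = (l.+1 - n).+1)%N.
  by rewrite -subSn ?hn // -{2}(prednK n0) subSS.
by exists h', d'.
Qed.

End AlgebraB.

Section DR.
Variables (k : fieldType) (B : falgType k).
Hypothesis hBcomm : forall x y : B, x * y = y * x.
Variables (l : nat) (eps : l.+1.-tuple B).
Hypothesis heps : basis_of fullv eps.
Variable S : comAlgType k.
Implicit Types u v w : Dalg l S.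

Local Notation e := (tnth eps).

Lemma coordZ q c (x : B) : coord eps q (c *: x) = c * coord eps q x.
Proof. exact: linearZ. Qed.

Lemma coord_sum q (I : Type) (r : seq I) (F : I -> B) :
  coord eps q (\sum_(i <- r) F i) = \sum_(i <- r) coord eps q (F i).
Proof. exact: linear_sum. Qed.

Lemma coord_mul q (x y : B) : coord eps q (x * y) =
  \sum_(i < l.+1) \sum_(j < l.+1) coord eps i x * coord eps j y * coord eps q (e i * e j).
Proof.
rewrite {1}(basis_expand heps x) {1}(basis_expand heps y) mulr_suml coord_sum.
apply: eq_bigr => i _; rewrite mulr_sumr coord_sum; apply: eq_bigr => j _.
by rewrite -scalerAl -scalerAr scalerA coordZ.
Qed.

Lemma coord_mull q (x y : B) : coord eps q (x * y) =
  \sum_(i < l.+1) coord eps i x * coord eps q (e i * y).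
Proof.
rewrite {1}(basis_expand heps x) mulr_suml coord_sum.
by apply: eq_bigr => i _; rewrite -scalerAl coordZ.
Qed.

Lemma coord_mulr q (x y : B) : coord eps q (x * y) =
  \sum_(i < l.+1) coord eps i y * coord eps q (x * e i).
Proof.
rewrite {1}(basis_expand heps y) mulr_sumr coord_sum.
by apply: eq_bigr => i _; rewrite -scalerAr coordZ.
Qed.

Lemma coord_eps i j : coord eps i (e j) = (i == j)%:R.
Proof.
by rewrite (tnth_nth 0) coord_free ?(basis_free heps) //; rewrite eq_sym.
Qed.

Lemma hom_expand (p : B -> k) b : kalg_hom p ->
  p b = \sum_(q < l.+1) coord eps q b * p (e q).
Proof.
move=> hp; rewrite [in LHS](basis_expand heps b) (hom_sum hp).
by apply: eq_bigr => q _; rewrite (homZ hp).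
Qed.

Lemma DmulA : associative (@Dmul k B l eps S).
Proof.
move=> u v w; apply/funext => q; rewrite /Dmul.
(* Both sides are brought to a combination of the [u i * v j * w h]; the coefficients agree by
   associativity in [B]. *)
transitivity (\sum_(i < l.+1) \sum_(j < l.+1) \sum_(h < l.+1)
   coord eps q (e i * (e j * e h)) *: (u i * v j * w h)).
  apply: eq_bigr => i _.
  under eq_bigr => r _.
    rewrite mulr_sumr scaler_sumr.
    under eq_bigr => j _.
      rewrite mulr_sumr scaler_sumr.
      under eq_bigr => h _ do rewrite -scalerAr scalerA mulrA.
      over.
    over.
  rewrite exchange_big; apply: eq_bigr => j _; rewrite exchange_big.
  apply: eq_bigr => h _; rewrite -scaler_suml; congr (_ *: _).
  by rewrite coord_mulr; apply: eq_bigr => r _; rewrite mulrC.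
transitivity (\sum_(i < l.+1) \sum_(j < l.+1) \sum_(h < l.+1)
   \sum_(r < l.+1) (coord eps q (e r * e h) * coord eps r (e i * e j)) *: (u i * v j * w h)).
  apply: eq_bigr => i _; apply: eq_bigr => j _; apply: eq_bigr => h _.
  rewrite -scaler_suml mulrA coord_mull; congr (_ *: _).
  by apply: eq_bigr => r _; rewrite mulrC.
symmetry.
under eq_bigr => r _.
  under eq_bigr => h _.
    rewrite mulr_suml scaler_sumr.
    under eq_bigr => i _.
      rewrite mulr_suml scaler_sumr.
      under eq_bigr => j _ do rewrite -scalerAl scalerA.
      over.
    over.
  over.
under eq_bigr => r _ do rewrite exchange_big.
rewrite exchange_big; apply: eq_bigr => i _.
under eq_bigr => r _ do (under eq_bigr => h _ do rewrite /=; rewrite exchange_big /=).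
rewrite exchange_big; apply: eq_bigr => j _.
by rewrite exchange_big.
Qed.

Lemma DmulC : commutative (@Dmul k B l eps S).
Proof.
move=> u v; apply/funext => q; rewrite /Dmul exchange_big.
by apply: eq_bigr => i _; apply: eq_bigr => j _; rewrite hBcomm mulrC.
Qed.

Lemma Dmul1 : left_id (Done eps S) (@Dmul k B l eps S).
Proof.
move=> u; apply/funext => q; rewrite /Dmul /Done exchange_big.
transitivity (\sum_(j < l.+1) coord eps q (e j) *: u j).
  apply: eq_bigr => j _; rewrite -[in RHS](mul1r (e j)) coord_mull scaler_suml.
  by apply: eq_bigr => i _; rewrite -scalerAl mul1r scalerA mulrC.
rewrite (bigD1 q) //= coord_eps eqxx scale1r big1 ?addr0 // => j hj.
by rewrite coord_eps eq_sym (negbTE hj) scale0r.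
Qed.

Lemma DmulDl : left_distributive (@Dmul k B l eps S) (@Dadd k l S).
Proof.
move=> u v w; apply/funext => q; rewrite /Dmul /Dadd -big_split.
apply: eq_bigr => i _; rewrite -big_split; apply: eq_bigr => j _.
by rewrite mulrDl scalerDr.
Qed.

Lemma Done_neq0 : Done eps S <> (fun=> 0).
Proof.
move=> h; have : (1 : B) = 0.
  rewrite (basis_expand heps 1) big1 // => q _.
  have := congr1 (fun f => f q) h; rewrite /Done => /eqP.
  by rewrite scaler_eq0 oner_eq0 orbF => /eqP ->; rewrite scale0r.
by move/eqP; rewrite oner_eq0.
Qed.

Definition DR_raw : rawalg k.
Proof.
apply: (@RawAlg k (Dalg l S) (fun=> 0) (Done eps S) (@Dadd k l S) (@Dopp k l S)
  (@Dmul k B l eps S) (fun c u q => c *: u q)); last split.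
- exact: Done_neq0.
- by move=> u v w; apply/funext => q; exact: addrA.
- by move=> u v; apply/funext => q; exact: addrC.
- by move=> u; apply/funext => q; exact: add0r.
- by move=> u; apply/funext => q; exact: addNr.
- exact: DmulA.
- exact: DmulC.
- exact: Dmul1.
- exact: DmulDl.
- by move=> a b u; apply/funext => q; exact: scalerA.
- by move=> u; apply/funext => q; exact: scale1r.
- by move=> a u v; apply/funext => q; exact: scalerDr.
- by move=> a b u; apply/funext => q; exact: scalerDl.
- move=> a u v; apply/funext => q; rewrite /Dmul scaler_sumr.
  apply: eq_bigr => i _; rewrite scaler_sumr; apply: eq_bigr => j _.
  by rewrite -scalerAl !scalerA mulrC.
Defined.

Definition DR : comAlgType k := alg_of DR_raw.

Lemma DR_addE (u v : DR) q : (u + v) q = u q + v q. Proof. by []. Qed.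
Lemma DR_oppE (u : DR) q : (- u) q = - u q. Proof. by []. Qed.
Lemma DR_scaleE c (u : DR) q : (c *: u) q = c *: u q. Proof. by []. Qed.
Lemma DR_mulE (u v : DR) q : (u * v) q =
  \sum_(i < l.+1) \sum_(j < l.+1) coord eps q (e i * e j) *: (u i * v j).
Proof. by []. Qed.
Lemma DR_oneE q : (1 : DR) q = coord eps q 1 *: 1. Proof. by []. Qed.
Lemma DR_sumE (I : Type) (r : seq I) (P : pred I) (F : I -> DR) q :
  (\sum_(i <- r | P i) F i) q = \sum_(i <- r | P i) F i q.
Proof. by apply: (big_morph (fun u : DR => u q)). Qed.

Definition DRproj (p : B -> k) (u : DR) : S := \sum_(q < l.+1) p (e q) *: u q.

Lemma DRproj_khom p : kalg_hom p -> khom (DRproj p).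
Proof.
move=> hp; split.
- by move=> u v; rewrite /DRproj -big_split; apply: eq_bigr => q _; rewrite DR_addE scalerDr.
- move=> u v; rewrite /DRproj.
  transitivity (\sum_(i < l.+1) \sum_(j < l.+1) p (e i * e j) *: (u i * v j)).
    under eq_bigr => q _.
      rewrite DR_mulE scaler_sumr.
      under eq_bigr => i _.
        rewrite scaler_sumr; under eq_bigr => j _ do rewrite scalerA mulrC.
        over.
      over.
    rewrite exchange_big; apply: eq_bigr => i _; rewrite exchange_big.
    apply: eq_bigr => j _; rewrite -scaler_suml; congr (_ *: _).
    by rewrite (hom_expand (e i * e j) hp); apply: eq_bigr => q _; rewrite mulrC.
  rewrite mulr_suml; apply: eq_bigr => i _; rewrite mulr_sumr; apply: eq_bigr => j _.
  by rewrite (homM hp) -scalerAl -scalerAr scalerA.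
- rewrite /DRproj -[RHS]scale1r -(hom1 hp) (hom_expand 1 hp) scaler_suml.
  by apply: eq_bigr => q _; rewrite DR_oneE scalerA mulrC.
- move=> c u; rewrite /DRproj scaler_sumr; apply: eq_bigr => q _.
  by rewrite DR_scaleE !scalerA mulrC.
Qed.

(** The pure tensor of [b] and [s]. *)
Definition DRmon (s : S) (b : B) : DR := fun q => coord eps q b *: s.

Lemma DRmonM s t a b : DRmon s a * DRmon t b = DRmon (s * t) (a * b).
Proof.
apply/funext => q; rewrite DR_mulE /DRmon coord_mul scaler_suml.
apply: eq_bigr => i _; rewrite scaler_suml; apply: eq_bigr => j _.
rewrite -scalerAl -scalerAr !scalerA; congr (_ *: _); ring.
Qed.

Lemma DRmonX s b n : DRmon s b ^+ n = DRmon (s ^+ n) (b ^+ n).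
Proof. by elim: n => [|n ih]; rewrite ?expr0 // !exprS ih DRmonM. Qed.

Lemma DRproj_mon p s b : kalg_hom p -> DRproj p (DRmon s b) = p b *: s.
Proof.
move=> hp; rewrite /DRproj (hom_expand b hp) scaler_suml.
by apply: eq_bigr => q _; rewrite scalerA mulrC.
Qed.

Lemma DR_expand (u : DR) : u = \sum_(j < l.+1) DRmon (u j) (e j).
Proof.
apply/funext => q; rewrite DR_sumE (bigD1 q) //= /DRmon coord_eps eqxx scale1r.
by rewrite big1 ?addr0 // => j hj; rewrite coord_eps eq_sym (negbTE hj) scale0r.
Qed.

Hypothesis hBres : residue_fields_trivial B.

(** Each [nl j] is a basis vector minus the combination of the [d i] with the same residues, so it
    is killed by every [p] and nilpotent in [B]. As the residues of [u] vanish, replacing the basis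
    by the [nl j] in the expansion of [u] does not change [u]. *)
Lemma DR_nilpotent (u : DR) : (forall p, kalg_hom p -> DRproj p u = 0) -> nilpotent u.
Proof.
move=> hu; have [N [h [d [[hh hd] hall]]]] := hom_family_complete heps.
pose nl j := e j - \sum_(i < N) h i (e j) *: d i.
have -> : u = \sum_(j < l.+1) DRmon (u j) (nl j).
  rewrite [LHS]DR_expand; apply/eqP; rewrite -subr_eq0 -sumrB; apply/eqP.
  apply/funext => q; rewrite DR_sumE.
  transitivity (\sum_(j < l.+1) \sum_(i < N) (coord eps q (d i) * h i (e j)) *: u j).
    apply: eq_bigr => j _; rewrite DR_addE DR_oppE /DRmon /nl -scalerBl -linearB /=.
    rewrite opprB addrC subrK coord_sum scaler_suml; apply: eq_bigr => i _.
    by rewrite coordZ mulrC.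
  rewrite exchange_big big1 // => i _.
  under eq_bigr => j _ do rewrite -scalerA.
  by rewrite -scaler_sumr -/(DRproj (h i) u) hu // scaler0.
apply: nilpotent_sum => j.
have [|n hn] := @hom_nilpotent _ _ hBcomm hBres (nl j).
  move=> p hp; have [i ->] := hall p hp.
  rewrite /nl (homB (hh i)) (hom_sum (hh i)) (bigD1 i) //= big1 => [|i' hi'].
    by rewrite (homZ (hh i)) hd eqxx mulr1 addr0 subrr.
  by rewrite (homZ (hh i)) hd eq_sym (negbTE hi') mulr0.
exists n; rewrite DRmonX hn; apply/funext => q.
by rewrite /DRmon linear0 scale0r.
Qed.

Lemma DR_lift_residues (t : (B -> k) -> S) :
  exists u : DR, forall p, kalg_hom p -> DRproj p u = t p.
Proof.
have [N [h [d [[hh hd] hall]]]] := hom_family_complete heps.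
exists (\sum_(i < N) DRmon (t (h i)) (d i)) => p hp; have [i ->] := hall p hp.
rewrite (khom_sum (DRproj_khom (hh i))) (bigD1 i) //= big1 => [|j hj].
  by rewrite DRproj_mon // hd eqxx scale1r addr0.
by rewrite DRproj_mon // hd eq_sym (negbTE hj) scale0r.
Qed.

(** A common lift [z] of the inverses of the residues makes [u * z - 1] nilpotent. *)
Lemma DR_invertible (u : DR) : (forall p, kalg_hom p -> invertible (DRproj p u)) ->
  invertible u.
Proof.
move=> hu.
have /choice[iv hiv] : forall p : B -> k, exists y, kalg_hom p -> DRproj p u * y = 1.
  by move=> p; case: (EM (kalg_hom p)) => [/hu[y hy]|]; [exists y | exists 0].
have [z hz] := DR_lift_residues iv.
have [|v hv] := @invertible_1D _ (u * z - 1).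
  apply: DR_nilpotent => p hp; have ph := DRproj_khom hp.
  by rewrite (khomB ph) (khomM ph) (khom1 ph) hz // hiv // subrr.
by exists (z * v); rewrite mulrA -hv addrC subrK.
Qed.

(** The correction is a multiple of [f.[y]], whose residues are 0; hence the root has the residues
    of [y]. *)
Lemma DR_newton (f : {poly DR}) (y : DR) :
  (forall p, kalg_hom p -> DRproj p f.[y] = 0) ->
  (forall p, kalg_hom p -> invertible (DRproj p f^`().[y])) ->
  exists z, f.[z] = 0 /\ forall p, kalg_hom p -> DRproj p z = DRproj p y.
Proof.
move=> h0 h1; have [s hs] := newton_root (DR_nilpotent h0) (DR_invertible h1).
exists (y + f.[y] * s); split=> // p hp; have ph := DRproj_khom hp.
by rewrite (khomD ph) (khomM ph) h0 // mul0r addr0.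
Qed.

End DR.

(** * Lifting residues to a homomorphism *)

Lemma char0_mulrn_eq0 (k : fieldType) (V : lmodType k) : [pchar k] =i pred0 ->
  forall (a : V) n, a *+ n.+1 = 0 -> a = 0.
Proof.
move=> /pcharf0P hk a n; rewrite -scaler_nat => /eqP.
by rewrite scaler_eq0 hk /= => /eqP.
Qed.

Section Lifting.
Variables (k : fieldType) (hk : [pchar k] =i pred0) (B : falgType k).
Hypothesis hBcomm : forall x y : B, x * y = y * x.
Hypothesis hBres : residue_fields_trivial B.
Variables (l : nat) (eps : l.+1.-tuple B).
Hypothesis heps : basis_of fullv eps.
Local Notation D S := (DR hBcomm heps S).
Variables (F0 F S : comAlgType k) (j : F0 -> F) (e : F0 -> D S) (t : (B -> k) -> F -> S).
Hypothesis hF : is_field F.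
Hypothesis hS : is_field S.
Hypothesis hj : khom j.
Hypothesis jinj : injective j.
Hypothesis he : khom e.
Hypothesis ht : forall p, kalg_hom p -> khom (t p).
Hypothesis hte : forall p, kalg_hom p -> forall x, t p (j x) = DRproj p (e x).

Definition compatible (G : F -> D S -> Prop) : Prop :=
  forall p, kalg_hom p -> forall a b, G a b -> DRproj p b = t p a.

Definition good_lift (G : F -> D S -> Prop) : Prop :=
  [/\ subring_graph G, functional_graph G & compatible G].

Lemma compatible_horner G p f g x y : compatible G -> kalg_hom p ->
  graph_poly G f g -> DRproj p y = t p x -> DRproj p g.[y] = t p f.[x].
Proof.
move=> hG hp hfg hxy.
pose N := maxn (size f) (size g).
rewrite (@horner_coef_wide _ N g) ?leq_maxr // (@horner_coef_wide _ N f) ?leq_maxl //.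
have ph := DRproj_khom hBcomm heps S hp.
rewrite (khom_sum ph) (khom_sum (ht hp)); apply: eq_bigr => i _.
by rewrite (khomM ph) (khomM (ht hp)) (khomX ph) (khomX (ht hp)) hxy (hG p hp _ _ (hfg i)).
Qed.

Lemma field_invertible (R : comNzRingType) (x : R) : is_field R -> x <> 0 -> invertible x.
Proof. by move=> hR /hR. Qed.

(* A transcendental element may be sent to any lift of its residues, an algebraic
   one to the root that Newton's iteration finds from such a lift. *)
Lemma good_lift_adjoin G x : good_lift G -> exists y, good_lift (graph_adjoin G x y).
Proof.
case=> hG hfun hcomp.
have [y0 hy0] := DR_lift_residues hBcomm heps (fun p => t p x).
suff [y [hy hadj]] : exists y, (forall p, kalg_hom p -> DRproj p y = t p x) /\
    functional_graph (graph_adjoin G x y).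
  exists y; split=> //; first exact: graph_adjoinP.
  move=> p hp a b [f [g [hfg -> ->]]].
  exact: (compatible_horner hcomp hp hfg (hy p hp)).
case: (EM (exists f g, [/\ graph_poly G f g, f.[x] = 0 & f <> 0])); last first.
  move=> hno; exists y0; split=> //; apply: adjoin_transcendental => // f g hfg e0.
  by apply: contrapT => nz; apply: hno; exists f, g.
case/minimal_relation => f [g [hfg e0 nz hmin]].
have hsep := minimal_separable hG (char0_mulrn_eq0 hk (V := F)) hfg e0 nz hmin.
have [||y [gy hy]] := @DR_newton _ _ hBcomm _ _ heps S hBres g y0.
- move=> p hp; rewrite (compatible_horner hcomp hp hfg (hy0 p hp)) e0.
  exact: khom0 (ht hp).
- move=> p hp; rewrite (compatible_horner hcomp hp (graph_poly_deriv hG hfg) (hy0 p hp)).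
  exact: field_invertible hS (khom_field_neq0 (ht hp) hF hsep).
exists y; split; first by move=> p hp; rewrite hy // hy0.
apply: (adjoin_algebraic hG hfun hfg) => // b.
(* The algebra over [S] may have zero divisors, but this coefficient is a unit: its residues are the
   images of the nonzero leading coefficient of [f] in the field [S]. *)
have [v hv] : invertible g`_(size f).-1.
  apply: (@DR_invertible _ _ hBcomm _ _ heps S hBres) => p hp.
  rewrite (hcomp p hp _ _ (hfg _)).
  apply: (field_invertible hS (khom_field_neq0 (ht hp) hF _)).
  by apply/eqP; rewrite -lead_coefE lead_coef_eq0.
by move=> hb; rewrite -[b]mul1r -hv mulrAC hb mul0r.
Qed.

Lemma residue_lifting : exists e' : F -> D S,
  [/\ khom e', (forall x, e' (j x) = e x) &
      forall p, kalg_hom p -> forall x, DRproj p (e' x) = t p x].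
Proof.
pose base (a : F) (b : D S) := exists x, a = j x /\ b = e x.
have hbase : good_lift base.
  split; [split| |].
  - by exists 1; rewrite (khom1 hj) (khom1 he).
  - by move=> a b [x [-> ->]]; exists (- x); rewrite (khomN hj) (khomN he).
  - by move=> a b a' b' [x [-> ->]] [y [-> ->]]; exists (x + y); rewrite (khomD hj) (khomD he).
  - by move=> a b a' b' [x [-> ->]] [y [-> ->]]; exists (x * y); rewrite (khomM hj) (khomM he).
  - by move=> b [x [h ->]]; rewrite (jinj (x1 := x) (x2 := 0)) ?(khom0 he) // -h (khom0 hj).
  - by move=> p hp a b [x [-> ->]]; rewrite hte.
have [|G x hG|G [[hG hfun hcomp] sG tot]] := relation_zorn hbase.
- move=> U sU two; split; [split| |].
  + by apply: sU; case: hbase => [[]].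
  + move=> a b h; have [G [[hG _ _] h1 _ sG]] := two _ _ _ _ h h.
    by apply/sG/(graphN hG).
  + move=> a b a' b' h h'; have [G [[hG _ _] h1 h2 sG]] := two _ _ _ _ h h'.
    by apply/sG/(graphD hG).
  + move=> a b a' b' h h'; have [G [[hG _ _] h1 h2 sG]] := two _ _ _ _ h h'.
    by apply/sG/(graphM hG).
  + by move=> b h; have [G [[_ hG _] h1 _ sG]] := two _ _ _ _ h h; apply: hG.
  + by move=> p hp a b h; have [G [[_ _ hG] h1 _ sG]] := two _ _ _ _ h h; apply: hG.
- have [y hy] := good_lift_adjoin x hG; exists (graph_adjoin G x y); have [h _ _] := hG.
  split=> //; first by move=> a b; exact: graph_adjoin_sub.
  by exists y; exact: graph_adjoin_gen.
have [e' he'] := choice tot.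
have eU a b : G a b -> e' a = b by exact: graph_functional (he' a).
have e'j x : e' (j x) = e x by apply/eU/sG; exists x.
have e'M x y : e' (x * y) = e' x * e' y by apply/eU/(graphM hG).
exists e'; split=> //; last by move=> p hp x; exact: hcomp.
split=> //.
- by move=> x y; apply/eU/(graphD hG).
- by apply/eU/(graph1 hG).
(* Linearity is inherited from [e], because the scalars of [F] come from [F0]. *)
- move=> c x; rewrite -mulr_algl e'M -[in RHS]mulr_algl; congr (_ * _).
  by rewrite -(khom1 he) -(khomZ he) -e'j (khomZ hj) (khom1 hj).
Qed.

End Lifting.

(** * Hurwitz series and Taylor expansions *)

Section Hurwitz.
Variables (k : fieldType) (R : comAlgType k).
Implicit Types f g h : nat -> R.

Definition hshift f : nat -> R := fun n => f n.+1.

(* The Hurwitz product [\sum_(i <= n) 'C(n, i) * f i * g (n - i)], defined through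
   the Leibniz rule for the shift so that the ring laws are plain inductions. *)
Fixpoint hmul_rec (n : nat) f g : R :=
  if n is n'.+1 then hmul_rec n' (hshift f) g + hmul_rec n' f (hshift g)
  else f 0%N * g 0%N.
Definition hmul f g : nat -> R := fun n => hmul_rec n f g.
Definition hone : nat -> R := fun n => (n == 0)%:R.
Definition hadd f g : nat -> R := fun n => f n + g n.

Lemma hmulS f g n : hmul f g n.+1 = hmul (hshift f) g n + hmul f (hshift g) n.
Proof. by []. Qed.

Lemma hmul_recC n f g : hmul_rec n f g = hmul_rec n g f.
Proof.
elim: n f g => [|n ih] f g /=; first exact: mulrC.
by rewrite addrC (ih f) (ih (hshift f)).
Qed.

Lemma hmul_recDl n f g h : hmul_rec n (hadd f g) h = hmul_rec n f h + hmul_rec n g h.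
Proof.
elim: n f g h => [|n ih] f g h /=; first exact: mulrDl.
by rewrite -[hshift (hadd f g)]/(hadd (hshift f) (hshift g)) !ih addrACA.
Qed.

Lemma hmul_recDr n f g h : hmul_rec n f (hadd g h) = hmul_rec n f g + hmul_rec n f h.
Proof. by rewrite hmul_recC hmul_recDl !(hmul_recC n f). Qed.

Lemma hmul_recZl n c f g : hmul_rec n (fun i => c *: f i) g = c *: hmul_rec n f g.
Proof.
elim: n f g => [|n ih] f g /=; first by rewrite scalerAl.
by rewrite -[hshift (fun i => _)]/(fun i => c *: hshift f i) !ih scalerDr.
Qed.

Lemma hmul_rec0 n f g : (forall i, f i = 0) -> hmul_rec n f g = 0.
Proof.
elim: n f g => [|n ih] f g hf /=; first by rewrite hf mul0r.
by rewrite !ih ?addr0 // => i; exact: hf.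
Qed.

Lemma hmul_rec1 n f : hmul_rec n hone f = f n.
Proof.
elim: n f => [|n ih] f /=; first by rewrite mul1r.
by rewrite hmul_rec0 // add0r ih.
Qed.

Lemma hmul_recA n f g h : hmul_rec n f (hmul g h) = hmul_rec n (hmul f g) h.
Proof.
elim: n f g h => [|n ih] f g h /=; first exact: mulrA.
rewrite -[hshift (hmul g h)]/(hadd (hmul (hshift g) h) (hmul g (hshift h))).
rewrite -[hshift (hmul f g)]/(hadd (hmul (hshift f) g) (hmul f (hshift g))).
by rewrite hmul_recDr hmul_recDl !ih addrA.
Qed.

Definition hurwitz_raw : rawalg k.
Proof.
apply: (@RawAlg k (nat -> R) (fun=> 0) hone hadd (fun f n => - f n) hmul
  (fun c f n => c *: f n)); last split.
- by move/(congr1 (fun f => f 0%N)) => /eqP; rewrite /= oner_eq0.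
- by move=> u v w; apply/funext => q; exact: addrA.
- by move=> u v; apply/funext => q; exact: addrC.
- by move=> u; apply/funext => q; exact: add0r.
- by move=> u; apply/funext => q; exact: addNr.
- by move=> u v w; apply/funext => q; exact: hmul_recA.
- by move=> u v; apply/funext => q; exact: hmul_recC.
- by move=> u; apply/funext => q; exact: hmul_rec1.
- by move=> u v w; apply/funext => q; exact: hmul_recDl.
- by move=> a b u; apply/funext => q; exact: scalerA.
- by move=> u; apply/funext => q; exact: scale1r.
- by move=> a u v; apply/funext => q; exact: scalerDr.
- by move=> a b u; apply/funext => q; exact: scalerDl.
- by move=> a u v; apply/funext => q; rewrite [RHS]hmul_recZl.
Defined.

Definition hurwitz : comAlgType k := alg_of hurwitz_raw.

Lemma hurwitz_addE (f g : hurwitz) n : (f + g) n = f n + g n. Proof. by []. Qed.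
Lemma hurwitz_scaleE c (f : hurwitz) n : (c *: f) n = c *: f n. Proof. by []. Qed.
Lemma hurwitz_mulE (f g : hurwitz) n : (f * g) n = hmul f g n. Proof. by []. Qed.
Lemma hurwitz_sumE (I : Type) (r : seq I) (P : pred I) (F : I -> hurwitz) n :
  (\sum_(i <- r | P i) F i) n = \sum_(i <- r | P i) F i n.
Proof. exact: (big_morph (fun u : hurwitz => u n)). Qed.

Lemma hmul_below n a b f g : (n < a + b)%N ->
  (forall i, (i < a)%N -> f i = 0) -> (forall i, (i < b)%N -> g i = 0) ->
  hmul_rec n f g = 0.
Proof.
elim: n a b f g => [|n ih] a b f g hn hf hg /=.
  by case: a hn hf => [|a] hn hf; [rewrite hg ?mulr0 | rewrite hf ?mul0r].
rewrite (ih a.-1 b) //; first rewrite (ih a b.-1) ?addr0 //.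
- by case: b hn hg => [|b] //=; rewrite ?addn0 ?addnS // => /ltnW.
- by move=> i hi; apply: hg; case: b hi {hn}.
- by case: a hn hf => [|a] //= /ltnW.
- by move=> i hi; apply: hf; case: a hi {hn}.
Qed.

(** The factor is the binomial coefficient of [a + b] over [a]; only its positivity is recorded,
    which in characteristic 0 makes the lowest coefficient of a product nonzero. *)
Lemma hmul_lowest a b f g :
  (forall i, (i < a)%N -> f i = 0) -> (forall i, (i < b)%N -> g i = 0) ->
  exists N, hmul_rec (a + b) f g = (f a * g b) *+ N.+1.
Proof.
have [n] := ubnP (a + b); elim: n a b f g => // n ih [|a] [|b] f g hn hf hg.
- by exists 0%N; rewrite mulr1n.
- have hg' i : (i < b)%N -> hshift g i = 0 by exact: (hg i.+1).
  have hn' : (0 + b < n)%N by rewrite addnS in hn.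
  rewrite addnS /= (@hmul_below _ 0 b.+1) ?add0r //.
  by have [N hN] := ih 0%N b f (hshift g) hn' hf hg'; exists N; rewrite hN.
- have hf' i : (i < a)%N -> hshift f i = 0 by exact: (hf i.+1).
  have hn' : (a + 0 < n)%N by rewrite addSn in hn.
  rewrite addSn /= [X in _ + X](@hmul_below _ a.+1 0) ?addr0 // ?addn0 //.
  by have [N hN] := ih a 0%N (hshift f) g hn' hf' hg; exists N; rewrite -[X in hmul_rec X]addn0 hN.
- have hf' i : (i < a)%N -> hshift f i = 0 by exact: (hf i.+1).
  have hg' i : (i < b)%N -> hshift g i = 0 by exact: (hg i.+1).
  have hn1 : (a + b.+1 < n)%N by rewrite addSn in hn.
  have hn2 : (a.+1 + b < n)%N by rewrite addSnnS.
  have [N hN] := ih a b.+1 (hshift f) g hn1 hf' hg.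
  have [N' hN'] := ih a.+1 b f (hshift g) hn2 hf hg'.
  exists (N + N'.+1)%N; rewrite addSn /= hN -addSnnS hN' -mulrnDr.
  by rewrite addSn.
Qed.

Lemma hurwitz_domain : [pchar k] =i pred0 -> is_domain R -> is_domain hurwitz.
Proof.
move=> hk hR f g hfg; case: (EM (f = 0)) => [|hf]; first by left.
case: (EM (g = 0)) => [|hg]; [by right | exfalso].
have low (u : hurwitz) : u <> 0 -> exists a, u a <> 0 /\ forall i, (i < a)%N -> u i = 0.
  move=> hu; have [|a [ha amin]] := @nat_min (fun n => u n <> 0).
    by apply: contrapT => hno; apply: hu; apply/funext => n; apply: contrapT => hn;
       apply: hno; exists n.
  exists a; split=> // i hi; apply: contrapT => /amin.
  by rewrite leqNgt hi.
have [a [fa flow]] := low f hf; have [b [gb glow]] := low g hg.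
have [N hN] := hmul_lowest flow glow.
have := congr1 (fun u : hurwitz => u (a + b)%N) hfg.
rewrite /= hurwitz_mulE /hmul hN => /(char0_mulrn_eq0 hk).
exact: domain_mul_neq0.
Qed.

End Hurwitz.

Section IteratedHurwitz.
Variables (k : fieldType) (S : comAlgType k).

Fixpoint hurwitz_iter (r : nat) : comAlgType k :=
  if r is r'.+1 then hurwitz (hurwitz_iter r') else S.

Fixpoint hder (r : nat) : 'I_r -> hurwitz_iter r -> hurwitz_iter r :=
  match r return 'I_r -> hurwitz_iter r -> hurwitz_iter r with
  | 0%N => fun _ x => x
  | r'.+1 => fun i f =>
      if unlift ord0 i is Some i' then fun n => hder i' (f n) else fun n => f n.+1
  end.

(** The coefficient at a multi-index is [h] of the corresponding iterated derivative of [x]. [X] is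
    any set with operators and [h] any map, so that the coordinates of a homomorphism can be
    expanded one by one. *)
Fixpoint taylor (r : nat) (X : Type) :
  ('I_r -> X -> X) -> (X -> S) -> X -> hurwitz_iter r :=
  match r return ('I_r -> X -> X) -> (X -> S) -> X -> hurwitz_iter r with
  | 0%N => fun _ h => h
  | r'.+1 => fun d h x n => taylor (fun i => d (lift ord0 i)) h (iter n (d ord0) x)
  end.

Lemma hurwitz_iter_domain r : [pchar k] =i pred0 -> is_domain S ->
  is_domain (hurwitz_iter r).
Proof. by move=> hk hS; elim: r => //= r ih; apply: hurwitz_domain. Qed.

Lemma hder_dalg r : dalg (@hder r).
Proof.
elim: r => [|r ih]; first by split=> [[]|[]].
split=> [i|i i' f] /=; last first.
  case: (unliftP ord0 i) => [a _|_]; case: (unliftP ord0 i') => [b _|_] //.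
  by apply/funext => n; rewrite (dalg_comm ih).
case: (unliftP ord0 i) => [a _|_]; last first.
  split=> //; split=> // f g; apply/funext => n.
  by rewrite hurwitz_addE !hurwitz_mulE hmulS addrC.
have [dD [dM dZ]] := dalg_der ih a.
split; first by move=> f g; apply/funext => n; rewrite hurwitz_addE dD.
split; last by move=> c f; apply/funext => n; rewrite hurwitz_scaleE dZ.
move=> f g; apply/funext => n; rewrite hurwitz_addE !hurwitz_mulE /hmul.
elim: n f g => [|n ihn] f g /=; first exact: dM.
by rewrite dD !ihn addrACA.
Qed.

Lemma taylor_der r (X : Type) (d : 'I_r -> X -> X) (h : X -> S) :
  (forall i j x, d i (d j x) = d j (d i x)) ->
  forall i x, taylor d h (d i x) = hder i (taylor d h x).
Proof.
elim: r X d h => [|r ih] X d h hd; first by case.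
move=> i x /=; case: (unliftP ord0 i) => [a ->|->]; apply/funext => n.
  rewrite -ih; last by move=> *; exact: hd.
  by congr taylor; elim: n => //= n ->; rewrite hd.
by rewrite -iterSr.
Qed.

(** Phrased with a relation [E] rather than a map: it compares expansions in two rings along the
    images of a common subring. *)
Lemma taylor_natural r (X Y : Type) (d : 'I_r -> X -> X) (d' : 'I_r -> Y -> Y)
  (h : X -> S) (h' : Y -> S) (E : X -> Y -> Prop) :
  (forall x y, E x y -> h x = h' y) ->
  (forall i x y, E x y -> E (d i x) (d' i y)) ->
  forall x y, E x y -> taylor d h x = taylor d' h' y.
Proof.
elim: r d d' => [|r ih] d d' hh hd x y hxy /=; first exact: hh.
apply/funext => n; apply: ih => //; first by move=> i; exact: hd.
by elim: n => //= n; exact: hd.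
Qed.

Lemma taylor_linear r (X : Type) (d : 'I_r -> X -> X) (A : finType) (c : A -> k)
  (h : X -> S) (h_ : A -> X -> S) :
  (forall x, h x = \sum_a c a *: h_ a x) ->
  forall x, taylor d h x = \sum_a c a *: taylor d (h_ a) x.
Proof.
move=> hh; elim: r d => [|r ih] d x //=.
by apply/funext => n; rewrite hurwitz_sumE ih.
Qed.

Section TaylorAlg.
Variable X : comAlgType k.

Lemma dalg_iterD m (d : 'I_m -> X -> X) i n x y : dalg d ->
  iter n (d i) (x + y) = iter n (d i) x + iter n (d i) y.
Proof. by move=> hd; have [dD _] := dalg_der hd i; elim: n => //= n ->; rewrite dD. Qed.

Lemma dalg_iterZ m (d : 'I_m -> X -> X) i n c x : dalg d ->
  iter n (d i) (c *: x) = c *: iter n (d i) x.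
Proof. by move=> hd; have [_ [_ dZ]] := dalg_der hd i; elim: n => //= n ->; rewrite dZ. Qed.

Lemma dalg_sub r (d : 'I_r.+1 -> X -> X) : dalg d -> dalg (fun i => d (lift ord0 i)).
Proof. by move=> hd; split=> *; [exact: dalg_der hd _|exact: dalg_comm hd _ _ _]. Qed.

Lemma taylorD r (d : 'I_r -> X -> X) (h : X -> S) : dalg d ->
  (forall x y, h (x + y) = h x + h y) ->
  forall x y, taylor d h (x + y) = taylor d h x + taylor d h y.
Proof.
move=> hd hh; elim: r d hd => [|r ih] d hd x y //=.
apply/funext => n; rewrite hurwitz_addE dalg_iterD //; apply: ih; exact: dalg_sub.
Qed.

Lemma taylorZ r (d : 'I_r -> X -> X) (h : X -> S) : dalg d ->
  (forall c x, h (c *: x) = c *: h x) ->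
  forall c x, taylor d h (c *: x) = c *: taylor d h x.
Proof.
move=> hd hh; elim: r d hd => [|r ih] d hd c x //=.
apply/funext => n; rewrite hurwitz_scaleE dalg_iterZ //; apply: ih; exact: dalg_sub.
Qed.

(** The scalar [c] stands for a coordinate of 1 in the basis [eps]. All higher coefficients vanish
    because the derivatives of 1 do. *)
Lemma taylor1 r (d : 'I_r -> X -> X) (h : X -> S) c : dalg d ->
  (forall x y, h (x + y) = h x + h y) -> h 1 = c *: 1 ->
  taylor d h 1 = c *: 1.
Proof.
move=> hd hD h1; elim: r d hd => [|r ih] d hd //=.
apply/funext => -[|n] /=; first exact: (ih _ (dalg_sub hd)).
have -> : d ord0 (iter n (d ord0) 1) = 0.
  rewrite -iterS iterSr (derivation1 (dalg_der hd ord0)); elim: n => //= n ->.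
  exact: derivation0 (dalg_der hd _).
rewrite hurwitz_scaleE [X in _ = c *: X]/(0 : hurwitz_iter r) scaler0.
by apply: (addrI (taylor (fun i => d (lift ord0 i)) h 0));
   rewrite -taylorD ?addr0 //; exact: dalg_sub.
Qed.

(** The constants [c a b] are the structure constants of an algebra in which the [h_ a] are
    coordinates; with one index and constant 1 this is the case of an ordinary homomorphism. The
    recursion of the Hurwitz product is the Leibniz rule, so induction on the coefficient works. *)
Lemma taylorM r (d : 'I_r -> X -> X) (A : finType) (c : A -> A -> k)
  (h : X -> S) (h_ : A -> X -> S) : dalg d ->
  (forall x y, h (x + y) = h x + h y) ->
  (forall x y, h (x * y) = \sum_a \sum_b c a b *: (h_ a x * h_ b y)) ->
  forall x y, taylor d h (x * y) =
    \sum_a \sum_b c a b *: (taylor d (h_ a) x * taylor d (h_ b) y).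
Proof.
move=> hd hD hM; elim: r d hd => [|r ih] d hd x y //=.
apply/funext => n; rewrite hurwitz_sumE.
under eq_bigr => a _ do (rewrite hurwitz_sumE; under eq_bigr => b _ do
  rewrite hurwitz_scaleE hurwitz_mulE).
have hd' := dalg_sub hd; have [_ [dM _]] := dalg_der hd ord0.
elim: n x y => [|n ihn] x y; first exact: ih.
rewrite iterSr dM dalg_iterD // taylorD // !ihn -big_split.
apply: eq_bigr => a _; rewrite -big_split; apply: eq_bigr => b _ /=.
rewrite -scalerDr addrC /hmul /=; congr (_ *: (hmul_rec _ _ _ + hmul_rec _ _ _)).
- by apply/funext => p; rewrite /hshift -iterSr.
- by apply/funext => p; rewrite /hshift -iterSr.
Qed.

Lemma taylor_khom r (d : 'I_r -> X -> X) (h : X -> S) : dalg d -> khom h ->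
  khom (taylor d h).
Proof.
move=> hd hh; split.
- by apply: taylorD => //; exact: khomD.
- move=> x y.
  rewrite (@taylorM r d 'I_1 (fun _ _ => 1) h (fun=> h) hd (khomD hh)) => [|u v].
    by rewrite !big_ord1 scale1r.
  by rewrite !big_ord1 scale1r (khomM hh).
- by rewrite (@taylor1 _ _ _ 1) ?scale1r ?(khom1 hh) //; exact: khomD.
- by apply: taylorZ => //; exact: khomZ.
Qed.

End TaylorAlg.
End IteratedHurwitz.

(** * Amalgamation of differential fields *)

Section FieldQuotient.
Variables (k : fieldType) (R : comAlgType k) (I : R -> Prop).
Hypothesis hI : is_maximal_ideal I.

Lemma maximal_ideal0 : I 0. Proof. by have [[h _] _] := hI. Qed.
Lemma maximal_idealD x y : I x -> I y -> I (x + y).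
Proof. by have [[_ [h _]] _] := hI; exact: h. Qed.
Lemma maximal_idealM a x : I x -> I (a * x).
Proof. by have [[_ [_ h]] _] := hI; exact: h. Qed.
Lemma maximal_idealN x : I x -> I (- x).
Proof. by rewrite -mulN1r; exact: maximal_idealM. Qed.

Definition ideal_setoid : setoidalg k.
Proof.
apply: (@SetoidAlg k R (fun x y => I (x - y)) 0 1 +%R -%R *%R *:%R).
- by move=> x; rewrite subrr; exact: maximal_ideal0.
- by move=> x y /maximal_idealN; rewrite opprB.
- by move=> x y z h h'; rewrite -(subrK y x) -addrA; exact: maximal_idealD.
- by move=> x x' y; rewrite opprD addrACA subrr addr0.
- by move=> x x' /maximal_idealN; rewrite opprD.
- by move=> x x' y h; rewrite -mulrBl mulrC; exact: maximal_idealM.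
- by move=> a x x' h; rewrite -scalerBr -mulr_algl; exact: maximal_idealM.
- by rewrite subr0; have [_ []] := hI.
- apply: (@alg_laws_eval _ _ _ _ _ _ _ _ _ unit (fun=> R) (fun=> id)) => // x y /(_ tt) ->.
  by rewrite subrr; exact: maximal_ideal0.
Defined.

Lemma ideal_quotient_field : is_field (quot ideal_setoid).
Proof.
move=> q; have [x ->] := qproj_surj q => hx.
have nIx : ~ I x by move=> h; apply: hx; rewrite -qproj0; apply/qprojP; rewrite /= subr0.
have [_ [_ /(_ (fun y => exists a b, I b /\ y = b + a * x))]] := hI.
case.
- split; first by exists 0, 0; rewrite mul0r addr0; split=> //; exact: maximal_ideal0.
  split=> [y z [a [b [hb ->]]] [a' [b' [hb' ->]]]|c y [a [b [hb ->]]]].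
    by exists (a + a'), (b + b'); split; [exact: maximal_idealD|ring].
  by exists (c * a), (c * b); split; [exact: maximal_idealM|ring].
- by move=> y hy; exists 0, y; rewrite mul0r addr0.
- move=> /(_ x)[h _]; case: nIx; apply: h.
  by exists 1, 0; rewrite mul1r add0r; split=> //; exact: maximal_ideal0.
- case=> a [b [hb e]]; exists (qproj (a : sa_sort ideal_setoid)).
  rewrite -qprojM -qproj1; apply/qprojP; rewrite /= e.
  have -> : x * a - (b + a * x) = - b by ring.
  exact: maximal_idealN.
Qed.

Lemma ideal_quotient_khom : khom (fun x : R => qproj (x : sa_sort ideal_setoid)).
Proof.
split=> [x y|x y||c x].
- by rewrite -qprojD. - by rewrite -qprojM. - by [].
- by rewrite -qprojZ.
Qed.

End FieldQuotient.

Lemma field_quotient (k : fieldType) (R : comAlgType k) :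
  exists (E : comAlgType k) (q : R -> E), is_field E /\ khom q.
Proof.
have [||I [hI _]] := @maximal_ideal_exists R (fun x => x = 0).
- by split=> //; split=> [x y -> ->|a x ->]; rewrite ?addr0 ?mulr0.
- by apply/eqP; rewrite oner_eq0.
exists (quot (ideal_setoid hI)), (fun x => qproj (x : sa_sort (ideal_setoid hI))).
by split; [exact: ideal_quotient_field | exact: ideal_quotient_khom].
Qed.

Section Amalgam.
Variables (k : fieldType) (F0 F G : comAlgType k) (j : F0 -> F) (g : F0 -> G).
Hypothesis hF0 : is_field F0.
Hypothesis hj : khom j.
Hypothesis hg : khom g.

(** Both fields are vector spaces over [F0], and 1 is part of a basis of [F]. *)
Lemma linear_retraction : exists lam : F -> G,
  [/\ forall x y, lam (x + y) = lam x + lam y,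
      forall c x, lam (j c * x) = g c * lam x & lam 1 = 1].
Proof.
pose good (A : F -> G -> Prop) :=
  [/\ A 0 0, forall a b a' b', A a b -> A a' b' -> A (a + a') (b + b'),
      forall c a b, A a b -> A (j c * a) (g c * b) & forall b, A 0 b -> b = 0].
pose base (a : F) (b : G) := exists c, a = j c /\ b = g c.
have hbase : good base.
  split.
  - by exists 0; rewrite (khom0 hj) (khom0 hg).
  - by move=> a b a' b' [c [-> ->]] [d [-> ->]]; exists (c + d); rewrite (khomD hj) (khomD hg).
  - by move=> d a b [c [-> ->]]; exists (d * c); rewrite (khomM hj) (khomM hg).
  - move=> b [c [h ->]]; rewrite (khom_field_inj hj hF0 (x1 := c) (x2 := 0)) ?(khom0 hg) //.
    by rewrite -h (khom0 hj).
have [|A x hA|A [[_ AD AZ A0] sA tot]] := relation_zorn hbase.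
- move=> U sU two; split.
  + by apply: sU; case: hbase.
  + move=> a b a' b' h h'; have [A [[_ hA _ _] h1 h2 sA]] := two _ _ _ _ h h'.
    by apply/sA/hA.
  + move=> c a b h; have [A [[_ _ hA _] h1 _ sA]] := two _ _ _ _ h h.
    by apply/sA/hA.
  + by move=> b h; have [A [[_ _ _ hA] h1 _ sA]] := two _ _ _ _ h h; apply: hA.
- case: (EM (exists y, A x y)) => [[y hy]|hx]; first by exists A; split=> //; exists y.
  have [A00 AD AZ A0] := hA.
  (* The new vector [x] is sent to 0. This is consistent: a relation with [c <> 0] would put [x]
     into the domain of [A]. *)
  exists (fun a b => exists z c, A z b /\ a = z + j c * x); split; first split.
  + by exists 0, 0; rewrite (khom0 hj) mul0r addr0.
  + move=> a b a' b' [z [c [h ->]]] [z' [c' [h' ->]]]; exists (z + z'), (c + c').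
    by split; [exact: AD | rewrite (khomD hj); ring].
  + move=> d a b [z [c [h ->]]]; exists (j d * z), (d * c).
    by split; [exact: AZ | rewrite (khomM hj); ring].
  + move=> b [z [c [h e]]]; case: (EM (c = 0)) => [c0|/hF0[c' hc]].
      by apply: A0; move: e; rewrite c0 (khom0 hj) mul0r addr0 => ->.
    case: hx; exists (g (- c') * b).
    have -> : x = j (- c') * z; last exact: AZ.
    rewrite (khomN hj) mulNr; have -> : z = - (j c * x).
      by apply/eqP; rewrite -addr_eq0 -e.
    by rewrite mulrN opprK mulrA -(khomM hj) mulrC -(mulrC c) hc (khom1 hj) mulr1.
  + by move=> a b h; exists a, 0; rewrite (khom0 hj) mul0r addr0.
  + by exists 0, 0, 1; rewrite (khom1 hj) mul1r add0r.
have [lam hlam] := choice tot.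
have lamU a b : A a b -> lam a = b.
  move=> h; have : A (a + j (-1) * a) (lam a + g (-1) * b) by apply/AD/AZ.
  rewrite (khomN hj) (khomN hg) (khom1 hj) (khom1 hg) !mulN1r subrr => /A0/eqP.
  by rewrite subr_eq0 => /eqP.
exists lam; split=> [x y|c x|]; apply: lamU; [exact: AD|exact: AZ|].
by apply: sA; exists 1; rewrite (khom1 hj) (khom1 hg).
Qed.

End Amalgam.

Section Tensor.
Variables (k : fieldType) (F0 F G : comAlgType k) (j : F0 -> F) (g : F0 -> G).
Hypothesis hj : khom j.
Hypothesis hg : khom g.
Variable lam : F -> G.
Hypothesis lamD : forall x y, lam (x + y) = lam x + lam y.
Hypothesis lamj : forall c x, lam (j c * x) = g c * lam x.
Hypothesis lam1 : lam 1 = 1.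

(* Formal sums of elements [x (x) z] are identified when all the functionals
   [x (x) z |-> lam (x * y) * z] agree on them: then [lam 1 = 1] separates 1 from 0. *)
Definition tpair (y : F) (u : seq (F * G)) : G := \sum_(p <- u) lam (p.1 * y) * p.2.
Definition tmul (u v : seq (F * G)) : seq (F * G) :=
  [seq (p.1 * q.1, p.2 * q.2) | p <- u, q <- v].
Definition tscale (c : k) (u : seq (F * G)) := [seq (p.1, c *: p.2) | p <- u].
Definition topp (u : seq (F * G)) := [seq (p.1, - p.2) | p <- u].
Definition teqv u v := forall y, tpair y u = tpair y v.

Lemma lamZ c x : lam (c *: x) = c *: lam x.
Proof. by rewrite -mulr_algl -(khom1 hj) -(khomZ hj) lamj (khomZ hg) (khom1 hg) mulr_algl. Qed.

Lemma tpair_cat y u v : tpair y (u ++ v) = tpair y u + tpair y v.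
Proof. by rewrite /tpair big_cat. Qed.

Lemma tpair_opp y u : tpair y (topp u) = - tpair y u.
Proof. by rewrite /tpair big_map -sumrN; apply: eq_bigr => p _; rewrite mulrN. Qed.

Lemma tpair_scale y c u : tpair y (tscale c u) = c *: tpair y u.
Proof. by rewrite /tpair big_map scaler_sumr; apply: eq_bigr => p _; rewrite scalerAr. Qed.

Lemma tpair_mul y u v :
  tpair y (tmul u v) = \sum_(p <- u) \sum_(q <- v) lam (p.1 * q.1 * y) * (p.2 * q.2).
Proof. by rewrite /tpair big_allpairs_dep. Qed.

(** A functional of a product depends on [u] through the functionals of [u] alone, so the
    equivalence is a congruence; this is why every [y] enters it. *)
Lemma tpair_mulr y u v : tpair y (tmul u v) = \sum_(q <- v) tpair (q.1 * y) u * q.2.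
Proof.
rewrite tpair_mul exchange_big; apply: eq_bigr => q _.
by rewrite /tpair mulr_suml; apply: eq_bigr => p _; rewrite !mulrA.
Qed.

Lemma tpair1 y x : tpair y [:: (x, 1)] = lam (x * y).
Proof. by rewrite /tpair big_seq1 mulr1. Qed.

Lemma tmulC u v : teqv (tmul u v) (tmul v u).
Proof.
move=> y; rewrite !tpair_mul exchange_big; apply: eq_bigr => q _; apply: eq_bigr => p _.
by rewrite (mulrC p.1) (mulrC p.2).
Qed.

Definition tensor_setoid : setoidalg k.
Proof.
apply: (@SetoidAlg k (seq (F * G)) teqv [::] [:: (1, 1)] cat topp tmul tscale); last split.
- by [].
- by move=> u v h y; rewrite h.
- by move=> u v w h h' y; rewrite h.
- by move=> u u' v h y; rewrite !tpair_cat h.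
- by move=> u u' h y; rewrite !tpair_opp h.
- by move=> u u' v h y; rewrite !tpair_mulr; apply: eq_bigr => q _; rewrite h.
- by move=> a u u' h y; rewrite !tpair_scale h.
- by move/(_ 1); rewrite tpair1 mul1r lam1 /tpair big_nil => /eqP; rewrite oner_eq0.
- by move=> u v w y; rewrite catA.
- by move=> u v y; rewrite !tpair_cat addrC.
- by [].
- by move=> u y; rewrite tpair_cat tpair_opp addNr /tpair big_nil.
- move=> u v w y; rewrite [RHS]tpair_mulr tpair_mul exchange_big /tmul big_allpairs_dep.
  rewrite exchange_big; apply: eq_bigr => q _; rewrite /= tpair_mul exchange_big mulr_suml.
  apply: eq_bigr => q' _; rewrite mulr_suml; apply: eq_bigr => p _ /=.
  by rewrite !mulrA.
- exact: tmulC.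
- move=> u y; rewrite tpair_mul big_seq1 /=; apply: eq_bigr => q _.
  by rewrite !mul1r.
- by move=> u v w y; rewrite tpair_cat !tpair_mul big_cat.
- by move=> a b v y; rewrite !tpair_scale scalerA.
- by move=> v y; rewrite tpair_scale scale1r.
- by move=> a u v y; rewrite !(tpair_scale, tpair_cat) scalerDr.
- by move=> a b v y; rewrite tpair_cat !tpair_scale scalerDl.
- move=> a u v y; rewrite tpair_scale !tpair_mul big_map scaler_sumr; apply: eq_bigr => p _.
  rewrite scaler_sumr; apply: eq_bigr => q _ /=.
  by rewrite scalerAr scalerAl.
Defined.

Local Notation T := (quot tensor_setoid).
Definition tensor_inl (x : F) : T := qproj ([:: (x, 1)] : sa_sort tensor_setoid).
Definition tensor_inr (z : G) : T := qproj ([:: (1, z)] : sa_sort tensor_setoid).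

Lemma tensor_inl_khom : khom tensor_inl.
Proof.
split=> [x y|x y||c x]; rewrite /tensor_inl.
- by rewrite -qprojD; apply/qprojP => y'; rewrite tpair_cat !tpair1 mulrDl lamD.
- rewrite -qprojM; apply/qprojP => y'.
  by rewrite tpair_mulr big_seq1 !tpair1 mulr1 mulrA.
- by [].
- rewrite -qprojZ; apply/qprojP => y'.
  by rewrite tpair_scale !tpair1 -scalerAl lamZ.
Qed.

Lemma tensor_inr_khom : khom tensor_inr.
Proof.
have E y z : tpair y [:: (1, z)] = lam y * z by rewrite /tpair big_seq1 mul1r.
split=> [x y|x y||c x]; rewrite /tensor_inr.
- by rewrite -qprojD; apply/qprojP => y'; rewrite tpair_cat !E mulrDr.
- rewrite -qprojM; apply/qprojP => y'.
  by rewrite tpair_mulr big_seq1 !E mul1r mulrA.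
- by [].
- rewrite -qprojZ; apply/qprojP => y'.
  by rewrite tpair_scale !E scalerAr.
Qed.

Lemma tensor_commutes c : tensor_inl (j c) = tensor_inr (g c).
Proof.
apply/qprojP => y; rewrite tpair1 /tpair big_seq1 lamj mul1r mulrC.
by [].
Qed.

End Tensor.

Lemma field_amalgam (k : fieldType) (F0 F G : comAlgType k) (j : F0 -> F) (g : F0 -> G) :
  is_field F0 -> khom j -> khom g ->
  exists (E : comAlgType k) (hF : F -> E) (hG : G -> E),
    [/\ is_field E, khom hF, khom hG & forall c, hF (j c) = hG (g c)].
Proof.
move=> hF0 hj hg; have [lam [lamD lamj lam1]] := linear_retraction hF0 hj hg.
have [E [q [hE hq]]] := field_quotient (quot (tensor_setoid lam1)).
exists E, (q \o tensor_inl lam1), (q \o tensor_inr lam1); split=> //.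
- exact: khom_comp (tensor_inl_khom hj hg lamD lamj lam1) hq.
- exact: khom_comp (tensor_inr_khom lam1) hq.
- by move=> c /=; rewrite (tensor_commutes lamj lam1).
Qed.

Section DiffField.
Variables (k : fieldType) (hk : [pchar k] =i pred0) (m : nat).

Record dfield (F : comAlgType k) (d : 'I_m -> F -> F) : Prop := DField {
  dfield_field : is_field F;
  dfield_dalg : dalg d }.

Lemma hurwitz_frac (E : comAlgType k) : is_field E ->
  exists (S : comAlgType k) (dS : 'I_m -> S -> S) (i : hurwitz_iter E m -> S),
    [/\ dfield dS, is_frac i & dhom (@hder k E m) dS i].
Proof.
move=> hE; have hd := hurwitz_iter_domain (r := m) hk (field_domain hE).
have [S [i hi]] := frac_exists hd.
have [dS [hdS hdi]] := frac_dalg hi (hder_dalg E m).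
by exists S, dS, i; split=> //; split=> //; exact: frac_field hi.
Qed.

Lemma taylor_dhom (E F : comAlgType k) (d : 'I_m -> F -> F) (h : F -> E) : dalg d -> khom h ->
  dhom d (@hder k E m) (taylor d h).
Proof.
by move=> hd hh; split; [exact: taylor_khom | apply: taylor_der; exact: dalg_comm].
Qed.

(** An amalgam [E] of the bare fields carries no derivations, but the Taylor expansions of its two
    embeddings are differential. They agree on [F0] because [j] and [g] are. *)
Lemma diff_amalgam (F0 F G : comAlgType k) (d0 : 'I_m -> F0 -> F0)
  (dF : 'I_m -> F -> F) (dG : 'I_m -> G -> G) (j : F0 -> F) (g : F0 -> G) :
  dfield d0 -> dfield dF -> dfield dG -> dhom d0 dF j -> dhom d0 dG g ->
  exists (S : comAlgType k) (dS : 'I_m -> S -> S) (hF : F -> S) (hG : G -> S),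
    [/\ dfield dS, dhom dF dS hF, dhom dG dS hG & forall c, hF (j c) = hG (g c)].
Proof.
move=> h0 hF hG hj hg.
have [E [eF [eG [hE heF heG hc]]]] := field_amalgam (dfield_field h0) hj hg.
have [S [dS [i [hS _ hi]]]] := hurwitz_frac hE.
exists S, dS, (i \o taylor dF eF), (i \o taylor dG eG); split=> //.
- exact: dhom_comp (taylor_dhom (dfield_dalg hF) heF) hi.
- exact: dhom_comp (taylor_dhom (dfield_dalg hG) heG) hi.
- move=> c /=; congr i.
  apply: (@taylor_natural _ _ _ _ _ _ _ _ _ (fun x y => exists c, x = j c /\ y = g c)).
  + by move=> x y [c' [-> ->]].
  + by move=> i' x y [c' [-> ->]]; exists (d0 i' c'); rewrite (dhom_del hj) (dhom_del hg).
  + by exists c.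
Qed.

End DiffField.

(** * Extending D-structures *)

Section DRMaps.
Variables (k : fieldType) (B : falgType k).
Hypothesis hBcomm : forall x y : B, x * y = y * x.
Variables (l : nat) (eps : l.+1.-tuple B).
Hypothesis heps : basis_of fullv eps.
Local Notation D S := (DR hBcomm heps S).

Definition DRmap (R S : comAlgType k) (f : R -> S) (u : D R) : D S := fun q => f (u q).

Lemma DRmap_khom (R S : comAlgType k) (f : R -> S) : khom f -> khom (DRmap f).
Proof.
move=> hf; split=> [u v|u v||c u]; apply/funext => q; rewrite /DRmap.
- exact: khomD.
- rewrite !DR_mulE (khom_sum hf); apply: eq_bigr => i _; rewrite (khom_sum hf).
  by apply: eq_bigr => j _; rewrite (khomZ hf) (khomM hf).
- by rewrite !DR_oneE (khomZ hf) (khom1 hf).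
- exact: khomZ.
Qed.

Lemma DRproj_map (R S : comAlgType k) (f : R -> S) p (u : D R) : khom f ->
  DRproj p (DRmap f u) = f (DRproj p u).
Proof. by move=> hf; rewrite /DRproj (khom_sum hf); apply: eq_bigr => q _; rewrite (khomZ hf). Qed.

Lemma derivation_DRproj (S : comAlgType k) (d : S -> S) p (u : D S) : is_derivation d ->
  DRproj p ((fun q => d (u q)) : D S) = d (DRproj p u).
Proof.
move=> hd; rewrite /DRproj (big_morph d hd.1 (derivation0 hd)).
by apply: eq_bigr => q _; rewrite hd.2.2.
Qed.

Lemma derivation_DRmul (S : comAlgType k) (d : S -> S) (u v : D S) q : is_derivation d ->
  d ((u * v) q) = (u * ((fun q => d (v q)) : D S) + ((fun q => d (u q)) : D S) * v) q.
Proof.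
move=> hd; rewrite DR_addE !DR_mulE (big_morph d hd.1 (derivation0 hd)) -big_split.
apply: eq_bigr => i _; rewrite (big_morph d hd.1 (derivation0 hd)) -big_split.
by apply: eq_bigr => j _; rewrite hd.2.2 hd.2.1 scalerDr.
Qed.

Lemma DRproj_pi (S : comAlgType k) (pi : B -> k) (u : D S) : pi (tnth eps ord0) = 1 ->
  (forall i : 'I_l.+1, i != ord0 -> pi (tnth eps i) = 0) -> DRproj pi u = u ord0.
Proof.
move=> h0 h; rewrite /DRproj (bigD1 ord0) //= h0 scale1r big1 ?addr0 // => i /h ->.
by rewrite scale0r.
Qed.

End DRMaps.

Section ExtStep.
Variables (k : fieldType) (hk : [pchar k] =i pred0) (B : falgType k).
Hypothesis hBcomm : forall x y : B, x * y = y * x.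
Hypothesis hBres : residue_fields_trivial B.
Variables (l : nat) (eps : l.+1.-tuple B).
Hypothesis heps : basis_of fullv eps.
Variable pi : B -> k.
Hypothesis hpi : kalg_hom pi.
Hypothesis hpi0 : pi (tnth eps ord0) = 1.
Hypothesis hpii : forall i : 'I_l.+1, i != ord0 -> pi (tnth eps i) = 0.
Variable m : nat.
Local Notation D S := (DR hBcomm heps S).

(** A structure map whose values lie over a larger field. By [DRproj_pi] the coordinate [ord0] is
    the residue at [pi], so the last field says that this residue is the inclusion [i]. *)
Record Dlift (F S : comAlgType k) (dF : 'I_m -> F -> F) (dS : 'I_m -> S -> S)
  (i : F -> S) (e : F -> D S) : Prop := DLift {
  Dlift_base : dhom dF dS i;
  Dlift_khom : khom e;
  Dlift_del : forall j x q, e (dF j x) q = dS j (e x q);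
  Dlift_pi : forall x, e x ord0 = i x }.

Lemma Dlift_proj (F S : comAlgType k) (dF : 'I_m -> F -> F) (dS : 'I_m -> S -> S) i e p :
  kalg_hom p -> dalg dS -> @Dlift F S dF dS i e -> dhom dF dS (fun x => DRproj p (e x)).
Proof.
move=> hp hS he; split.
  exact: (khom_comp (Dlift_khom he) (DRproj_khom hBcomm heps S hp)).
move=> j x; rewrite -(derivation_DRproj p (e x) (dalg_der hS j)); congr DRproj.
by apply/funext => q; exact: Dlift_del he _ _ _.
Qed.

Section Step.
Variables (F0 F : comAlgType k) (d0 : 'I_m -> F0 -> F0) (dF : 'I_m -> F -> F).
Variables (j : F0 -> F) (e : F0 -> D F).
Hypothesis h0 : dfield d0.
Hypothesis hF : dfield dF.
Hypothesis he : Dlift d0 dF j e.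
Variables (Q : (B -> k) -> Prop) (t0 : (B -> k) -> F -> F).
Hypothesis ht0 : forall p, Q p -> dhom dF dF (t0 p).
Hypothesis ht0j : forall p, Q p -> forall x, t0 p (j x) = DRproj p (e x).

(** For [p] in [Q] the residue on [F] is prescribed in advance by [t0 p]; the others are left to
    amalgamation. [Q] always contains [pi], whose residue must be the inclusion. *)
Definition residue_extension (S : comAlgType k) (dS : 'I_m -> S -> S) (i : F -> S)
  (p : B -> k) (t : F -> S) : Prop :=
  [/\ dhom dF dS t, forall x, t (j x) = i (DRproj p (e x)) &
      Q p -> forall x, t x = i (t0 p x)].

Lemma extend_residues_family N (h : 'I_N -> B -> k) : (forall a, kalg_hom (h a)) ->
  forall n, exists (S : comAlgType k) (dS : 'I_m -> S -> S) (i : F -> S) (t : 'I_N -> F -> S),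
    [/\ dfield dS, dhom dF dS i &
        forall a : 'I_N, (a < n)%N -> residue_extension dS i (h a) (t a)].
Proof.
move=> hh; elim=> [|n [S [dS [i [t [hS hi ht]]]]]].
  by exists F, dF, id, (fun=> id); split=> //; exact: dhom_id.
case: (ltnP n N) => hn; last first.
  by exists S, dS, i, t; split=> // a _; apply: ht; exact: leq_trans (ltn_ord a) hn.
pose a0 := Ordinal hn.
have lt_a (a : 'I_N) : (a < n.+1)%N -> a != a0 -> (a < n)%N.
  by move=> ha hne; rewrite ltn_neqAle -ltnS ha andbT.
case: (EM (Q (h a0))) => hQ.
  exists S, dS, i, (fun a => if a == a0 then i \o t0 (h a0) else t a); split=> // a ha.
  case: eqVneq => [->|hne]; last by apply: ht; exact: lt_a.
  split=> [|x|_ x] //=; first exact: dhom_comp (ht0 hQ) hi.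
  by rewrite ht0j.
have hg := dhom_comp (Dlift_proj (hh a0) (dfield_dalg hF) he) hi.
(* [F] and [S] are amalgamated over [F0], embedded by [j] on one side and by the residue of [e] on
   the other; the image of [F] is the extended residue. *)
have [S' [dS' [hF' [hS' [h1 h2 h3 h4]]]]] := diff_amalgam hk h0 hF hS (Dlift_base he) hg.
exists S', dS', (hS' \o i), (fun a => if a == a0 then hF' else hS' \o t a).
split=> //; first exact: dhom_comp hi h3.
move=> a ha; case: eqVneq => [->|hne].
  by split=> // x; rewrite h4.
have [ta1 ta2 ta3] := ht a (lt_a a ha hne).
split=> [|x|hQa x] /=; first exact: dhom_comp ta1 h3.
  by rewrite ta2.
by rewrite ta3.
Qed.

Lemma extend_residues : exists (S : comAlgType k) (dS : 'I_m -> S -> S) (i : F -> S)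
  (t : (B -> k) -> F -> S),
  [/\ dfield dS, dhom dF dS i & forall p, kalg_hom p -> residue_extension dS i p (t p)].
Proof.
have [N [h [d [[hh hd] hall]]]] := hom_family_complete heps.
have [S [dS [i [t [hS hi ht]]]]] := extend_residues_family hh N.
have /choice[t' ht'] : forall p, exists t', kalg_hom p -> residue_extension dS i p t'.
  move=> p; case: (EM (kalg_hom p)) => [hp|]; last by exists (fun=> 0).
  by have [a ->] := hall p hp; exists (t a) => _; apply: ht.
by exists S, dS, i, t'.
Qed.

Hypothesis hQpi : Q pi.
Hypothesis ht0pi : forall x, t0 pi x = x.

Lemma extension_step : exists (S : comAlgType k) (dS : 'I_m -> S -> S) (i : F -> S)
  (e' : F -> D S),
  [/\ dfield dS, Dlift dF dS i e', (forall x q, e' (j x) q = i (e x q)) &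
      forall p, kalg_hom p -> Q p -> forall x, DRproj p (e' x) = i (t0 p x)].
Proof.
have [S [dS [i [t [hS hi ht]]]]] := extend_residues.
have [|||e1 [he1 e1j e1t]] := @residue_lifting _ hk _ hBcomm hBres _ _ heps F0 F S j
  (DRmap i \o e) t (dfield_field hF) (dfield_field hS) (Dlift_base he)
  (khom_field_inj (Dlift_base he) (dfield_field h0)).
- exact: khom_comp (Dlift_khom he) (DRmap_khom _ _ hi).
- by move=> p hp; have [[]] := ht p hp.
- by move=> p hp x; have [_ tj _] := ht p hp; rewrite tj /= (DRproj_map p (e x) hi).
have [S1 [dS1 [f [hS1 _ hf]]]] := hurwitz_frac hk m (dfield_field hS).
(* The new field contains [S] through Taylor expansion, not as constant series: only [T] is
   differential. *)
pose T := f \o taylor dS id.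
have hT : dhom dS dS1 T.
  exact: dhom_comp (taylor_dhom (dfield_dalg hS) (khom_id S)) hf.
pose e' x : D S1 := fun q => f (taylor dF (fun y => e1 y q) x).
have e1D q x y : e1 (x + y) q = e1 x q + e1 y q by rewrite (khomD he1).
have hdF := dfield_dalg hF.
(* The residues of the expansion of [e1] are the expansions of the [t p]; these are differential
   already, so they are just composed with [T]. *)
have hproj p x : kalg_hom p -> DRproj p (e' x) = T (t p x).
  move=> hp; rewrite /DRproj /e' /T /=.
  transitivity (f (taylor dF (t p) x)).
    rewrite (taylor_linear dF (c := fun q => p (tnth eps q)) (h_ := fun q y => e1 y q)).
      by rewrite (khom_sum hf); apply: eq_bigr => q _; rewrite (khomZ hf).
    by move=> y; rewrite -e1t.
  have [htp _ _] := ht p hp.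
  congr f; apply: (taylor_natural (E := fun y s => s = t p y)) => //.
  by move=> a y s ->; rewrite (dhom_del htp).
exists S1, dS1, (T \o i), e'; split=> //.
- split; first exact: dhom_comp hi hT.
  + split=> [x y|x y||c x]; apply/funext => q; rewrite /e'.
    * by rewrite taylorD // (khomD hf).
    * rewrite (@taylorM _ _ _ _ _ _ (fun a b => coord eps q (tnth eps a * tnth eps b)) _
        (fun q y => e1 y q)) //; last by move=> u v; rewrite (khomM he1) DR_mulE.
      rewrite (khom_sum hf) DR_mulE; apply: eq_bigr => a _; rewrite (khom_sum hf).
      by apply: eq_bigr => b _; rewrite (khomZ hf) (khomM hf).
    * rewrite (taylor1 (c := coord eps q 1)) //; last by rewrite (khom1 he1) DR_oneE.
      by rewrite (khomZ hf) (khom1 hf) DR_oneE.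
    * rewrite taylorZ ?(khomZ hf) // => c' y; by rewrite (khomZ he1).
  + by move=> a x q; rewrite /e' taylor_der ?(dhom_del hf) //; exact: dalg_comm.
  + move=> x; rewrite -(DRproj_pi (e' x) hpi0 hpii) hproj //=.
    by have [_ _ ->] := ht pi hpi; rewrite // ht0pi.
(* On [F0] the map [e] commutes with the derivations, so expanding before or after it gives the same
   series. *)
- move=> x q; rewrite /e' /T /=; congr f.
  apply: (taylor_natural (E := fun y s => exists x, y = j x /\ s = i (e x q))).
  + by move=> y s [z [-> ->]]; rewrite e1j.
  + move=> a y s [z [-> ->]]; exists (d0 a z).
    by rewrite (dhom_del (Dlift_base he)) (Dlift_del he) (dhom_del hi).
  + by exists x.
- move=> p hp hQ x; rewrite hproj //=.
  by have [_ _ ->] := ht p hp.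
Qed.

End Step.
End ExtStep.

(** * The limit of a tower of lifts as a ring with operators *)

Section Limit.
Variables (k : fieldType) (B : falgType k).
Hypothesis hBcomm : forall x y : B, x * y = y * x.
Variables (l : nat) (eps : l.+1.-tuple B).
Hypothesis heps : basis_of fullv eps.
Variable m : nat.
Local Notation D S := (DR hBcomm heps S).
Variables (F : nat -> comAlgType k) (d : forall n, 'I_m -> F n -> F n).
Variables (u : forall n, F n -> F n.+1) (e : forall n, F n -> D (F n.+1)).
Arguments d : clear implicits.
Hypothesis hF : forall n, dfield (d n).
Hypothesis he : forall n, Dlift (d n) (d n.+1) (u (n := n)) (e (n := n)).
Hypothesis hue : forall n x q, e (u x) q = u (e x q) :> F n.+2.

Lemma step_khom n : khom (@u n). Proof. exact: Dlift_base (he n). Qed.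
Let hu := step_khom.

(* Elements of the direct limit are represented by eventually coherent
   sequences, so that all operations are pointwise and no transport between the
   stages is needed. *)
Definition coherent (s : forall n, F n) : Prop :=
  exists N, forall n, (N <= n)%N -> s n.+1 = u (s n).
Definition cseq : Type := {s : forall n, F n | coherent s}.

Lemma coherent_op2 (op : forall n, F n -> F n -> F n) (s t : cseq) :
  (forall n x y, u (op n x y) = op n.+1 (u x) (u y)) ->
  coherent (fun n => op n (sval s n) (sval t n)).
Proof.
case: s t => [s [N hN]] [t [M hM]] hop /=; exists (maxn N M) => n.
by rewrite geq_max => /andP[h1 h2]; rewrite hN // hM // hop.
Qed.

Lemma coherent_op1 (op : forall n, F n -> F n) (s : cseq) :
  (forall n x, u (op n x) = op n.+1 (u x)) -> coherent (fun n => op n (sval s n)).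
Proof. by case: s => [s [N hN]] hop /=; exists N => n h; rewrite hN // hop. Qed.

Lemma coherent_const (c : forall n, F n) : (forall n, u (c n) = c n.+1) -> coherent c.
Proof. by move=> h; exists 0%N => n _; rewrite h. Qed.

Definition cadd (s t : cseq) : cseq :=
  exist _ _ (coherent_op2 s t (op := fun n => +%R) (fun n => khomD (hu n))).
Definition cmul (s t : cseq) : cseq :=
  exist _ _ (coherent_op2 s t (op := fun n => *%R) (fun n => khomM (hu n))).
Definition copp (s : cseq) : cseq :=
  exist _ _ (coherent_op1 s (op := fun n => -%R) (fun n => khomN (hu n))).
Definition cscale (c : k) (s : cseq) : cseq :=
  exist _ _ (coherent_op1 s (op := fun n => *:%R c) (fun n => khomZ (hu n) c)).
Definition czero : cseq := exist _ _ (coherent_const (fun n => khom0 (hu n))).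
Definition cone : cseq := exist _ _ (coherent_const (fun n => khom1 (hu n))).
Definition cdel (a : 'I_m) (s : cseq) : cseq :=
  exist _ _ (coherent_op1 s (op := fun n => d n a) (fun n => dhom_del (Dlift_base (he n)) a)).

(** The operators raise the stage by one, hence the shift. The entry 0 at the bottom is a dummy,
    invisible to eventual equality. *)
Definition cshift (f : forall n, F n -> F n.+1) (s : forall n, F n) : forall n, F n :=
  fun n => if n is n'.+1 then f n' (s n') else 0.

Lemma coherent_shift (f : forall n, F n -> F n.+1) (s : cseq) :
  (forall n x, u (f n x) = f n.+1 (u x)) -> coherent (cshift f (sval s)).
Proof.
case: s => [s [N hN]] hf /=; exists N.+1 => -[|n] //= hn.
by rewrite hN // hf.
Qed.

Definition cE (q : 'I_l.+1) (s : cseq) : cseq :=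
  exist _ _ (coherent_shift s (f := fun n x => e x q) (fun n x => esym (hue x q))).

Definition ceqv (s t : cseq) : Prop :=
  exists N, forall n, (N <= n)%N -> sval s n = sval t n.

Definition limit_setoid : setoidalg k.
Proof.
apply: (@SetoidAlg k cseq ceqv czero cone cadd copp cmul cscale).
- by move=> s; exists 0%N.
- by move=> s t [N h]; exists N => n hn; rewrite h.
- move=> s t r [N h] [M h']; exists (maxn N M) => n; rewrite geq_max => /andP[h1 h2].
  by rewrite h // h'.
- by move=> s s' t [N h]; exists N => n hn /=; rewrite h.
- by move=> s s' [N h]; exists N => n hn /=; rewrite h.
- by move=> s s' t [N h]; exists N => n hn /=; rewrite h.
- by move=> c s s' [N h]; exists N => n hn /=; rewrite h.
- by case=> N /(_ N (leqnn N)) /= /eqP; rewrite oner_eq0.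
- apply: (alg_laws_eval (ev := fun n s => sval s n)) => // s t h.
  by exists 0%N => n _; exact: h.
Defined.

Definition limit : comAlgType k := quot limit_setoid.
Definition lproj (s : cseq) : limit := qproj (s : sa_sort limit_setoid).

Lemma lprojP s t : lproj s = lproj t <-> ceqv s t. Proof. exact: qprojP. Qed.
Lemma lproj_surj (x : limit) : exists s, x = lproj s. Proof. exact (@qproj_surj _ limit_setoid x). Qed.
Lemma lprojD s t : lproj (cadd s t) = lproj s + lproj t. Proof. exact (@qprojD _ limit_setoid s t). Qed.
Lemma lprojM s t : lproj (cmul s t) = lproj s * lproj t. Proof. exact (@qprojM _ limit_setoid s t). Qed.
Lemma lprojZ c s : lproj (cscale c s) = c *: lproj s. Proof. exact (@qprojZ _ limit_setoid c s). Qed.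
Lemma lproj0 : lproj czero = 0. Proof. by []. Qed.
Lemma lproj1 : lproj cone = 1. Proof. by []. Qed.

Lemma lproj_sum (I : Type) (r : seq I) (f : I -> cseq) :
  lproj (\big[cadd/czero]_(i <- r) f i) = \sum_(i <- r) lproj (f i).
Proof. exact: (big_morph lproj lprojD lproj0). Qed.

Lemma csumE (I : Type) (r : seq I) (f : I -> cseq) n :
  sval (\big[cadd/czero]_(i <- r) f i) n = \sum_(i <- r) sval (f i) n.
Proof. exact: (big_morph (fun s : cseq => sval s n)). Qed.

Definition ldel (a : 'I_m) (x : limit) : limit := lproj (cdel a (qrepr x)).
Definition lprt (a : 'I_l) (x : limit) : limit := lproj (cE (lift ord0 a) (qrepr x)).

Lemma ceqv_repr s : ceqv (qrepr (lproj s)) s.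
Proof. exact (@qrepr_pi _ limit_setoid s). Qed.

Lemma ldelE a s : ldel a (lproj s) = lproj (cdel a s).
Proof. by apply/lprojP; have [N h] := ceqv_repr s; exists N => n hn /=; rewrite h. Qed.

Lemma lprtE a s : lprt a (lproj s) = lproj (cE (lift ord0 a) s).
Proof.
apply/lprojP; have [N h] := ceqv_repr s; exists N.+1 => -[|n] //= hn.
by rewrite h.
Qed.

Lemma lemapE s q : emap lprt (lproj s) q = lproj (cE q s).
Proof.
rewrite /emap; case: unliftP => [a ->|->]; first exact: lprtE.
apply/lprojP; case: s => s [N hN] /=; exists N.+1 => -[|n] //= hn.
by rewrite (Dlift_pi (he n)) hN.
Qed.

Lemma limit_Dring : is_Dring eps ldel lprt.
Proof.
split; [|split; [|split; [|split; [|split; [|split]]]]].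
- move=> a; split; [|split].
  + move=> x y; have [s ->] := lproj_surj x; have [t ->] := lproj_surj y.
    rewrite -lprojD !ldelE -lprojD; apply/lprojP; exists 0%N => n _ /=.
    by rewrite (dalg_der (dfield_dalg (hF n)) a).1.
  + move=> x y; have [s ->] := lproj_surj x; have [t ->] := lproj_surj y.
    rewrite -lprojM !ldelE -!lprojM -lprojD; apply/lprojP; exists 0%N => n _ /=.
    by rewrite (dalg_der (dfield_dalg (hF n)) a).2.1.
  + move=> c x; have [s ->] := lproj_surj x.
    rewrite -lprojZ !ldelE -lprojZ; apply/lprojP; exists 0%N => n _ /=.
    by rewrite (dalg_der (dfield_dalg (hF n)) a).2.2.
- move=> a b x; have [s ->] := lproj_surj x; rewrite !ldelE.
  by apply/lprojP; exists 0%N => n _ /=; rewrite (dalg_comm (dfield_dalg (hF n))).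
- move=> x y; have [s ->] := lproj_surj x; have [t ->] := lproj_surj y.
  apply/funext => q; rewrite /Dadd -lprojD !lemapE -lprojD.
  by apply/lprojP; exists 1%N => -[|n] //= _; rewrite (khomD (Dlift_khom (he n))).
- move=> c x; have [s ->] := lproj_surj x.
  apply/funext => q; rewrite -lprojZ !lemapE -lprojZ.
  by apply/lprojP; exists 1%N => -[|n] //= _; rewrite (khomZ (Dlift_khom (he n))).
- move=> x y; have [s ->] := lproj_surj x; have [t ->] := lproj_surj y.
  apply/funext => q; rewrite -lprojM !lemapE /Dmul.
  under eq_bigr => i _ do under eq_bigr => a _ do rewrite !lemapE -lprojM -lprojZ.
  under eq_bigr => i _ do rewrite -lproj_sum.
  rewrite -lproj_sum; apply/lprojP; exists 1%N => -[|n] //= _.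
  rewrite csumE (khomM (Dlift_khom (he n))) DR_mulE.
  by apply: eq_bigr => i _; rewrite csumE.
- apply/funext => q; rewrite -lproj1 lemapE /Done -lproj1 -lprojZ.
  apply/lprojP; exists 1%N => -[|n] //= _.
  by rewrite (khom1 (Dlift_khom (he n))) DR_oneE.
- move=> a x; have [s ->] := lproj_surj x; apply/funext => q.
  rewrite ldelE !lemapE ldelE; apply/lprojP; exists 1%N => -[|n] //= _.
  by rewrite (Dlift_del (he n)).
Qed.

Lemma coherent_zero (s : forall n, F n) N : (forall n, (N <= n)%N -> s n.+1 = u (s n)) ->
  s N = 0 -> forall n, (N <= n)%N -> s n = 0.
Proof.
move=> hs sN n /subnKC <-; elim: (n - N)%N => [|i ih]; first by rewrite addn0.
by rewrite addnS hs ?leq_addr // ih (khom0 (hu _)).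
Qed.

Lemma limit_domain : is_domain limit.
Proof.
move=> x y; have [s ->] := lproj_surj x; have [t ->] := lproj_surj y.
rewrite -lprojM -lproj0 => /lprojP [N hN].
have [[N1 h1] [N2 h2]] := (svalP s, svalP t).
pose M := maxn N (maxn N1 N2).
have hM1 n : (M <= n)%N -> (N1 <= n)%N.
  by apply: leq_trans; rewrite /M (leq_trans (leq_maxl N1 N2)) ?leq_maxr.
have hM2 n : (M <= n)%N -> (N2 <= n)%N.
  by apply: leq_trans; rewrite /M (leq_trans (leq_maxr N1 N2)) ?leq_maxr.
have /(field_domain (dfield_field (hF M)))[z|z] := hN M (leq_maxl _ _); [left|right];
  apply/lprojP; exists M => n hn.
- by apply: coherent_zero z n hn => i /hM1; exact: h1.
- by apply: coherent_zero z n hn => i /hM2; exact: h2.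
Qed.

Lemma limit_sigma p s : sigma eps lprt p (lproj s) =
  lproj (\big[cadd/czero]_(q < l.+1) cscale (p (tnth eps q)) (cE q s)).
Proof.
by rewrite lproj_sum; apply: eq_bigr => q _; rewrite lemapE lprojZ.
Qed.

(** At each stage the residue of [e] at [p] is a homomorphism out of a field, hence injective. *)
Lemma limit_sigma_inj p : kalg_hom p -> injective (sigma eps lprt p).
Proof.
move=> hp; have [_ [_ [hD [hZ _]]]] := limit_Dring.
have sD x y : sigma eps lprt p (x - y) = sigma eps lprt p x - sigma eps lprt p y.
  rewrite -scaleN1r /sigma -sumrB; apply: eq_bigr => q _.
  by rewrite hD /Dadd hZ scaleN1r scalerBr.
move=> x y /eqP; rewrite -subr_eq0 -sD => /eqP; rewrite -[RHS]lproj0.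
have [s hs] := lproj_surj (x - y); rewrite hs limit_sigma => /lprojP[N hN].
apply/eqP; rewrite -subr_eq0; apply/eqP; rewrite hs -lproj0; apply/lprojP.
exists N => n hn; have := hN n.+1 (leqW hn); rewrite csumE /=.
move=> h; apply: contrapT.
have hphi := khom_comp (Dlift_khom (he n)) (DRproj_khom hBcomm heps (F n.+1) hp).
move/(khom_field_neq0 hphi (dfield_field (hF n))); apply.
by rewrite -[RHS]h.
Qed.

Lemma limit_in_classK : in_classK eps ldel lprt.
Proof.
split; first exact: limit_Dring.
by split; [exact: limit_domain | exact: limit_sigma_inj].
Qed.

Fixpoint climb (x : F 1) (n : nat) : F n.+1 :=
  if n is n'.+1 then u (climb x n') else x.
(** The limit is entered at stage 1, where the first structure map takes its values; the entry at 0
    is a dummy. *)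
Definition climb_fun (x : F 1) (n : nat) : F n := if n is n'.+1 then climb x n' else 0.

Lemma climb_coherent x : coherent (climb_fun x).
Proof. by exists 1%N => -[|n]. Qed.

Definition limit_in (x : F 1) : limit := lproj (exist _ _ (climb_coherent x)).

Lemma limit_in_dhom : dhom (d 1) ldel limit_in.
Proof.
rewrite /limit_in; split; first split.
- move=> x y; rewrite -lprojD; apply/lprojP; exists 1%N => -[|n] //= _.
  by elim: n => //= n ->; rewrite (khomD (hu _)).
- move=> x y; rewrite -lprojM; apply/lprojP; exists 1%N => -[|n] //= _.
  by elim: n => //= n ->; rewrite (khomM (hu _)).
- rewrite -lproj1; apply/lprojP; exists 1%N => -[|n] //= _.
  by elim: n => //= n ->; rewrite (khom1 (hu _)).
- move=> c x; rewrite -lprojZ; apply/lprojP; exists 1%N => -[|n] //= _.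
  by elim: n => //= n ->; rewrite (khomZ (hu _)).
- move=> a x; rewrite ldelE; apply/lprojP; exists 1%N => -[|n] //= _.
  by elim: n => //= n ->; rewrite (dhom_del (Dlift_base (he _))).
Qed.

Lemma limit_in_emap x q : emap lprt (limit_in (u x)) q = limit_in (e x q).
Proof.
rewrite lemapE; apply/lprojP; exists 2%N => -[|[|n]] //= _.
by elim: n => /= [|n ih]; rewrite hue ?ih.
Qed.

End Limit.

Section Extension.
Variables (k : fieldType) (hk : [pchar k] =i pred0) (B : falgType k).
Hypothesis hBcomm : forall x y : B, x * y = y * x.
Hypothesis hBres : residue_fields_trivial B.
Variables (l : nat) (eps : l.+1.-tuple B).
Hypothesis heps : basis_of fullv eps.
Variable pi : B -> k.
Hypothesis hpi : kalg_hom pi.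
Hypothesis hpi0 : pi (tnth eps ord0) = 1.
Hypothesis hpii : forall i : 'I_l.+1, i != ord0 -> pi (tnth eps i) = 0.
Variable m : nat.
Local Notation D S := (DR hBcomm heps S).

(** One link of the tower. The target of a stage is by definition the source of the next, so
    iterating [stage_next] yields the tower without transports. *)
Record stage : Type := Stage {
  st_src : comAlgType k; st_tgt : comAlgType k;
  st_dsrc : 'I_m -> st_src -> st_src; st_dtgt : 'I_m -> st_tgt -> st_tgt;
  st_in : st_src -> st_tgt; st_e : st_src -> D st_tgt;
  st_hsrc : dfield st_dsrc; st_htgt : dfield st_dtgt;
  st_lift : Dlift st_dsrc st_dtgt st_in st_e }.

Record stage_extension (s : stage) : Type := StageExtension {
  se_tgt : comAlgType k; se_dtgt : 'I_m -> se_tgt -> se_tgt;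
  se_in : st_tgt s -> se_tgt; se_e : st_tgt s -> D se_tgt;
  se_htgt : dfield se_dtgt;
  se_lift : Dlift (@st_dtgt s) se_dtgt se_in se_e;
  se_compat : forall x q, se_e (st_in x) q = se_in (st_e x q) }.

Lemma stage_extension_exists s : exists _ : stage_extension s, True.
Proof.
have [|S [dS [i [e' [hS hl hc _]]]]] := @extension_step _ hk _ hBcomm hBres _ _ heps pi hpi
  hpi0 hpii m _ _ _ _ _ _ (st_hsrc s) (st_htgt s) (st_lift s) (fun p => p = pi) (fun _ => id)
  (fun _ _ => dhom_id (@st_dtgt s)) _ erefl (fun=> erefl).
  move=> p -> x; rewrite (DRproj_pi _ hpi0 hpii).
  by rewrite (Dlift_pi (st_lift s)).
by exists (StageExtension hS hl hc).
Qed.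

Definition stage_next (s : stage) : stage :=
  let x := projT1 (cid (stage_extension_exists s)) in
  Stage (st_htgt s) (se_htgt x) (se_lift x).

Lemma stage_limit (s : stage) : exists (L : comAlgType k) (dL : 'I_m -> L -> L)
  (prtL : 'I_l -> L -> L) (i : st_tgt s -> L),
  [/\ in_classK eps dL prtL, dhom (@st_dtgt s) dL i &
      forall x q, emap prtL (i (st_in x)) q = i (st_e x q)].
Proof.
pose st n := iter n stage_next s.
pose F n := st_src (st n); pose d n := @st_dsrc (st n).
pose u n : F n -> F n.+1 := @st_in (st n).
pose e n : F n -> D (F n.+1) := @st_e (st n).
have hF n : dfield (d n) := st_hsrc (st n).
have he n : Dlift (d n) (d n.+1) (@u n) (@e n) := st_lift (st n).
have hue n x q : e n.+1 (u n x) q = u n.+1 (e n x q).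
  exact: (se_compat (projT1 (cid (stage_extension_exists (st n)))) x q).
exists (limit he), (ldel (he := he)), (lprt (he := he) hue), (limit_in he); split.
- exact: limit_in_classK.
- exact: limit_in_dhom.
- by move=> x q; exact: limit_in_emap.
Qed.

(** The prescribed residues matter in the first step only: it fixes the operators on [F], and every
    later step extends them with no prescription besides [pi]. *)
Lemma Dring_extension (F0 F : comAlgType k) (d0 : 'I_m -> F0 -> F0) (dF : 'I_m -> F -> F)
  (j : F0 -> F) (e : F0 -> D F) (Q : (B -> k) -> Prop) (t0 : (B -> k) -> F -> F) :
  dfield d0 -> dfield dF -> Dlift d0 dF j e ->
  (forall p, Q p -> dhom dF dF (t0 p)) ->
  (forall p, Q p -> forall x, t0 p (j x) = DRproj p (e x)) ->
  Q pi -> (forall x, t0 pi x = x) ->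
  exists (L : comAlgType k) (dL : 'I_m -> L -> L) (prtL : 'I_l -> L -> L) (i : F -> L),
  [/\ in_classK eps dL prtL, dhom dF dL i,
      forall x q, emap prtL (i (j x)) q = i (e x q) &
      forall p, kalg_hom p -> Q p -> forall x, sigma eps prtL p (i x) = i (t0 p x)].
Proof.
move=> h0 hF he ht0 ht0j hQ ht0pi.
have [S [dS [i [e' [hS hl hc hp]]]]] := extension_step hk hBres hpi hpi0 hpii
  h0 hF he ht0 ht0j hQ ht0pi.
have [L [dL [prtL [i' [hL hi' hLe]]]]] := stage_limit (Stage hF hS hl).
exists L, dL, prtL, (i' \o i); split=> //.
- exact: dhom_comp (Dlift_base hl) hi'.
- by move=> x q; rewrite /= hLe /= hc.
- move=> p php Qp x; rewrite /= -hp // /DRproj (khom_sum hi') /sigma.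
  by apply: eq_bigr => q _; rewrite hLe (khomZ hi').
Qed.

End Extension.

(** * Leaders and generic points *)

Section Lex.

Fixpoint lexlt (n : nat) (f g : nat -> nat) : Prop :=
  if n is n'.+1 then (f n' < g n')%N \/ (f n' = g n' /\ lexlt n' f g) else False.

Lemma lexlt_trans n f g h : lexlt n f g -> lexlt n g h -> lexlt n f h.
Proof.
elim: n => //= n ih [a|[a b]] [c|[c d]].
- by left; apply: ltn_trans a c.
- by left; rewrite -c.
- by left; rewrite a.
- by right; split; [rewrite a | apply: ih].
Qed.

Lemma lexlt_irr n f : ~ lexlt n f f.
Proof. by elim: n => //= n ih [|[_ /ih]] //; rewrite ltnn. Qed.

Lemma lexlt_total n f g : [\/ lexlt n f g, forall i, (i < n)%N -> f i = g i | lexlt n g f].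
Proof.
elim: n => [|n ih]; first by apply: Or32.
rewrite /=; case: (ltngtP (f n) (g n)) => h.
- by apply: Or31; left.
- by apply: Or33; left.
case: ih => ih; [by apply: Or31; right | apply: Or32 | by apply: Or33; right].
by move=> i; rewrite ltnS leq_eqVlt => /orP[/eqP -> //|]; exact: ih.
Qed.

Lemma lexlt_ext n f f' g g' : (forall i, (i < n)%N -> f i = f' i) ->
  (forall i, (i < n)%N -> g i = g' i) -> lexlt n f g -> lexlt n f' g'.
Proof.
elim: n => //= n ih hf hg; rewrite (hf n) // (hg n) // => -[h|[h h']]; [by left|right].
by split=> //; apply: ih h' => i hi; [apply: hf | apply: hg]; exact: ltnW.
Qed.

Lemma lexlt_add n f g h : lexlt n f g ->
  lexlt n (fun i => h i + f i)%N (fun i => h i + g i)%N.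
Proof.
elim: n => //= n ih [a|[a b]]; first by left; rewrite ltn_add2l.
by right; split; [rewrite a | exact: ih].
Qed.

Lemma lexlt_incr n f i : (i < n)%N -> lexlt n f (fun p => (i == p) + f p)%N.
Proof.
elim: n => //= n ih; rewrite ltnS leq_eqVlt => /orP[/eqP ->|hi].
  by left; rewrite eqxx.
by right; split; [rewrite (ltn_eqF hi) | exact: ih].
Qed.

Lemma lexlt_min (T : Type) n (key : T -> nat -> nat) (P : T -> Prop) : (exists x, P x) ->
  exists x, P x /\ forall y, P y -> ~ lexlt n (key y) (key x).
Proof.
elim: n P => [|n ih] P hP; first by case: hP => x Px; exists x; split=> // y _ [].
have [|a [[x [Px hx]] amin]] := @nat_min (fun a => exists x, P x /\ key x n = a).
  by case: hP => x Px; exists (key x n), x.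
have [|y [[Py hy] ymin]] := ih (fun x => P x /\ key x n = a); first by exists x.
exists y; split=> // z Pz /= [h|[h1 h2]].
  have : (a <= key z n)%N by apply: amin; exists z.
  by rewrite leqNgt -hy h.
by apply: (ymin z) => //; split=> //; rewrite h1.
Qed.

(** Let [s] work for the first [n] entries and let [N] bound its last entries. It serves all [u]
    whose last entry is at least [N]; each of the finitely many smaller values [a] gets its own set
    [t a]. *)
Lemma dickson (T : eqType) n (vec : T -> nat -> nat) (P : T -> Prop) :
  exists s : seq T, (forall v, v \in s -> P v) /\
    forall u, P u -> exists2 v, v \in s & forall i, (i < n)%N -> (vec v i <= vec u i)%N.
Proof.
elim: n P => [|n ih] P.
  case: (EM (exists v, P v)) => [[v Pv]|hno].
    exists [:: v]; split=> [w|u _]; first by rewrite inE => /eqP ->.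
    by exists v; rewrite ?inE.
  by exists [::]; split=> // u Pu; case: hno; exists u.
have [s [sP hs]] := ih P.
pose N := (\max_(v <- s) vec v n)%N.
have /choice[t ht] : forall a, exists t : seq T, (forall v, v \in t -> P v) /\
    forall u, P u -> vec u n = a ->
    exists2 v, v \in t & forall i, (i < n.+1)%N -> (vec v i <= vec u i)%N.
  move=> a; have [t [tP ht]] := ih (fun u => P u /\ vec u n = a).
  exists t; split=> [v /tP[]//|u Pu hu]; have [v vt hv] := ht u (conj Pu hu).
  exists v => // i; rewrite ltnS leq_eqVlt => /orP[/eqP ->|]; last exact: hv.
  by have [_ ->] := tP v vt; rewrite hu.
exists (s ++ flatten [seq t a | a <- iota 0 N]); split=> [v|u Pu].
  rewrite mem_cat => /orP[/sP //|/flattenP[x /mapP[a _ ->]]].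
  by have [h _] := ht a; exact: h.
case: (ltnP (vec u n) N) => hN.
  have [_ /(_ u Pu erefl)[v vt hv]] := ht (vec u n).
  exists v => //; rewrite mem_cat; apply/orP; right; apply/flattenP.
  by exists (t (vec u n)) => //; apply/mapP; exists (vec u n); rewrite ?mem_iota.
have [v vs hv] := hs u Pu; exists v; first by rewrite mem_cat vs.
move=> i; rewrite ltnS leq_eqVlt => /orP[/eqP ->|]; last exact: hv.
by apply: leq_trans hN; rewrite /N (big_rem v) //= leq_maxl.
Qed.

End Lex.

Section DiffTerms.
Variables (k : fieldType) (hk : [pchar k] =i pred0) (m : nat).
Variables (K : comAlgType k) (dK : 'I_m -> K -> K) (X : finType).
Hypothesis hdK : dalg dK.

Local Notation var := (seq 'I_m * X)%type.

(** Differential polynomials with the derivations pushed down to the variables, so that they become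
    polynomials in the derivatives of the indeterminates. *)
Inductive pterm : Type :=
| PV : var -> pterm
| PC : K -> pterm
| PAdd : pterm -> pterm -> pterm
| POpp : pterm -> pterm
| PMul : pterm -> pterm -> pterm.

Fixpoint pderiv (i : 'I_m) (t : pterm) : pterm :=
  match t with
  | PV v => PV (i :: v.1, v.2)
  | PC c => PC (dK i c)
  | PAdd t1 t2 => PAdd (pderiv i t1) (pderiv i t2)
  | POpp t1 => POpp (pderiv i t1)
  | PMul t1 t2 => PAdd (PMul t1 (pderiv i t2)) (PMul (pderiv i t1) t2)
  end.

Fixpoint pvars (P : var -> Prop) (t : pterm) : Prop :=
  match t with
  | PV v => P v
  | PC _ => True
  | PAdd t1 t2 => pvars P t1 /\ pvars P t2
  | POpp t1 => pvars P t1
  | PMul t1 t2 => pvars P t1 /\ pvars P t2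
  end.

Fixpoint pnorm (t : dterm K X m 0) : pterm :=
  match t with
  | TVar x => PV ([::], x)
  | TPar c => PC c
  | TAdd t1 t2 => PAdd (pnorm t1) (pnorm t2)
  | TOpp t1 => POpp (pnorm t1)
  | TMul t1 t2 => PMul (pnorm t1) (pnorm t2)
  | TDel i t1 => pderiv i (pnorm t1)
  | TPart i t1 => pnorm t1
  end.

Fixpoint dterm_of (t : pterm) : dterm K X m 0 :=
  match t with
  | PV v => foldr (fun i s => TDel i s) (TVar _ _ _ v.2) v.1
  | PC c => TPar _ _ _ c
  | PAdd t1 t2 => TAdd (dterm_of t1) (dterm_of t2)
  | POpp t1 => TOpp (dterm_of t1)
  | PMul t1 t2 => TMul (dterm_of t1) (dterm_of t2)
  end.

Lemma pvars_mono (P Q : var -> Prop) t : (forall v, P v -> Q v) -> pvars P t -> pvars Q t.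
Proof. by move=> h; elim: t => /= [v|//|t1 h1 t2 h2 []|//|t1 h1 t2 h2 []]; auto. Qed.

(* The derivative of [x] along a word [w] is represented by [(w, x)]; its key
   lists the multiplicities in [w] and, as most significant entry, the rank of [x]. *)
Definition vkey (v : var) (i : nat) : nat :=
  if (i < m)%N then count (fun j : 'I_m => val j == i) v.1 else enum_rank v.2.

Definition vlt (v w : var) : Prop := lexlt m.+1 (vkey v) (vkey w).

Lemma vkey_cons i w x p : (p < m.+1)%N ->
  vkey (i :: w, x) p = ((i == p :> nat) + vkey (w, x) p)%N.
Proof.
rewrite ltnS leq_eqVlt /vkey => /orP[/eqP ->|->] //=.
by rewrite ltnn (ltn_eqF (ltn_ord i)).
Qed.

Lemma vlt_trans v w u : vlt v w -> vlt w u -> vlt v u.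
Proof. exact: lexlt_trans. Qed.

Lemma vlt_cons i v : vlt v (i :: v.1, v.2).
Proof.
apply: (@lexlt_ext _ (vkey v) _ (fun p => (val i == p) + vkey v p)%N) => // [p hp|].
  by rewrite vkey_cons //; case: v.
by apply: lexlt_incr; exact: ltnW (ltn_ord i).
Qed.

Lemma vlt_cons2 i v w : vlt v w -> vlt (i :: v.1, v.2) (i :: w.1, w.2).
Proof.
move=> h; have h' := @lexlt_add _ _ _ (fun p => val i == p : nat) h.
by apply: lexlt_ext h' => p hp; rewrite vkey_cons.
Qed.

Lemma vkey_eq v w : (forall i, (i < m.+1)%N -> vkey v i = vkey w i) ->
  v.2 = w.2 /\ perm_eq v.1 w.1.
Proof.
move=> h; split.
  by have := h m (leqnn _); rewrite /vkey ltnn => /val_inj /enum_rank_inj.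
apply/allP => j _ /=; have := h j (ltnW (ltn_ord j)).
rewrite /vkey ltn_ord => e; apply/eqP.
by rewrite -[LHS]/(count _ _) (eq_count (a2 := fun i : 'I_m => val i == val j)) // e
  (eq_count (a2 := fun i : 'I_m => val i == val j)).
Qed.

Definition low v (t : pterm) : Prop := pvars (fun w => vlt w v) t.
(** Not above [v], instead of below or equal: words that differ by a permutation denote the same
    derivative and have the same key. *)
Definition lowe v (t : pterm) : Prop := pvars (fun w => ~ vlt v w) t.

Lemma low_mono v w t : vlt v w -> low v t -> low w t.
Proof. by move=> h; apply: pvars_mono => u hu; apply: vlt_trans hu h. Qed.

Lemma low_deriv i v t : low v t -> low (i :: v.1, v.2) (pderiv i t).
Proof.
rewrite /low; elim: t => /= [w|c|t1 h1 t2 h2|t1 h1|t1 h1 t2 h2].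
- exact: vlt_cons2.
- by [].
- by case; auto.
- exact: h1.
- have mono t : low v t -> low (i :: v.1, v.2) t by apply: low_mono; exact: vlt_cons.
  by case=> a b; split; split; auto; apply: mono.
Qed.

Lemma lowe_max (P : var -> Prop) t : pvars P t ->
  (exists w, P w /\ lowe w t) \/ pvars (fun=> False) t.
Proof.
have mono v' w t' : ~ vlt w v' -> lowe v' t' -> lowe w t'.
  move=> h; apply: pvars_mono => u hu wu; case: (lexlt_total m.+1 (vkey v') (vkey u)) => //.
    by move=> e; apply: h; apply: lexlt_ext wu => // i hi; rewrite e.
  by move=> uv; apply: h; apply: vlt_trans wu uv.
have none w t' : pvars (fun=> False) t' -> lowe w t' by exact: pvars_mono.
have two t1 t2 : (exists w, P w /\ lowe w t1) \/ pvars (fun=> False) t1 ->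
    (exists w, P w /\ lowe w t2) \/ pvars (fun=> False) t2 ->
    (exists w, P w /\ (lowe w t1 /\ lowe w t2)) \/
    (pvars (fun=> False) t1 /\ pvars (fun=> False) t2).
  case=> [[u [hu h1]]|h1] [[w [hw h2]]|h2]; [left|left|left|by right].
  - case: (EM (vlt u w)) => h; [exists w|exists u]; split=> //; split=> //.
      by apply: mono h1 => h'; apply: (@lexlt_irr m.+1 (vkey u)); apply: lexlt_trans h h'.
    exact: mono h h2.
  - by exists u; split=> //; split=> //; exact: none.
  - by exists w; split=> //; split=> //; exact: none.
elim: t => /= [w hw|c|t1 h1 t2 h2 [/h1 a /h2 b]|//|t1 h1 t2 h2 [/h1 a /h2 b]].
- by left; exists w; split=> //; exact: lexlt_irr.
- by right.
- exact: two.
- exact: two.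
Qed.

End DiffTerms.

Section DiffValues.
Variables (k : fieldType) (m : nat).
Variables (K : comAlgType k) (dK : 'I_m -> K -> K) (X : finType).
Local Notation var := (seq 'I_m * X)%type.
Local Notation pterm := (pterm m K X).

Section Value.
Variables (R : comAlgType k) (f : K -> R) (d : 'I_m -> R -> R) (a : X -> R).

Definition dword (w : seq 'I_m) (y : R) : R := foldr (fun i z => d i z) y w.
Definition vval (v : var) : R := dword v.1 (a v.2).

Fixpoint pval (t : pterm) : R :=
  match t with
  | PV v => vval v
  | PC c => f c
  | PAdd t1 t2 => pval t1 + pval t2
  | POpp t1 => - pval t1
  | PMul t1 t2 => pval t1 * pval t2
  end.

Hypothesis hd : dalg d.
Hypothesis hf : dhom dK d f.

Lemma derivationN (e : R -> R) x : is_derivation e -> e (- x) = - e x.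
Proof. by case=> _ [_ eZ]; rewrite -scaleN1r eZ scaleN1r. Qed.

Lemma pval_deriv i t : pval (pderiv dK i t) = d i (pval t).
Proof.
have [dD [dM _]] := dalg_der hd i.
elim: t => /= [v|c|t1 -> t2 ->|t1 ->|t1 -> t2 ->].
- by [].
- exact: dhom_del hf _ _.
- by rewrite dD.
- by rewrite derivationN //; exact: dalg_der.
- by rewrite dM.
Qed.

Lemma pval_norm t : pval (pnorm dK t) = reval f d (@no_ops R) a t.
Proof.
rewrite /reval; elim: t => /= [x|c|t1 -> t2 ->|t1 ->|t1 -> t2 ->|i t1 h|[]] //.
by rewrite pval_deriv h.
Qed.

Lemma pval_dterm t : reval f d (@no_ops R) a (dterm_of t) = pval t.
Proof.
rewrite /reval; elim: t => /= [[w x]|c|t1 -> t2 ->|t1 ->|t1 -> t2 ->] //.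
by rewrite /vval /=; elim: w => //= i w ->.
Qed.

Lemma dword0 w : dword w 0 = 0.
Proof. by elim: w => //= i w ->; rewrite (derivation0 (dalg_der hd i)). Qed.

Lemma dword_rem i w y : i \in w -> dword w y = d i (dword (rem i w) y).
Proof.
elim: w => //= j w ih; rewrite inE; case: eqVneq => [->|hij] /=; first by [].
by move=> /ih -> /=; rewrite (dalg_comm hd).
Qed.

Lemma dword_perm w w' y : perm_eq w w' -> dword w y = dword w' y.
Proof.
elim: w w' => [|i w ih] w' h.
  by have /eqP := perm_size h; rewrite eq_sym size_eq0 => /eqP ->.
have hi : i \in w' by rewrite -(perm_mem h) inE eqxx.
rewrite (dword_rem _ hi) /= (ih (rem i w')) // -(perm_cons i).
exact: perm_trans h (perm_to_rem hi).
Qed.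

Lemma vval_perm v w : v.2 = w.2 -> perm_eq v.1 w.1 -> vval v = vval w.
Proof. by rewrite /vval => -> h; apply: dword_perm. Qed.

End Value.

Fixpoint phorner (cs : seq pterm) (v : var) : pterm :=
  if cs is c :: cs' then PAdd (PMul (phorner cs' v) (PV K v)) c else PC m X 0.

Fixpoint pseparant (cs : seq pterm) (v : var) : pterm :=
  if cs is c :: cs' then PAdd (PMul (pseparant cs' v) (PV K v)) (phorner cs' v)
  else PC m X 0.

Local Notation "cs `- i" := (nth (PC m X 0) cs i) (at level 3, i at level 2).
Definition low_coefs (v : var) (cs : seq pterm) : Prop := forall i, low v (cs`-i).

Section HornerValue.
Variables (R : comAlgType k) (f : K -> R) (d : 'I_m -> R -> R) (a : X -> R).
Hypothesis hd : dalg d.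
Hypothesis hf : dhom dK d f.
Local Notation pv := (pval f d a).

Definition cpoly (cs : seq pterm) : {poly R} := Poly (map pv cs).

Lemma coef_cpoly cs i : (cpoly cs)`_i = pv (cs`-i).
Proof.
rewrite /cpoly coef_Poly; case: (ltnP i (size cs)) => hi; first by rewrite (nth_map (PC m X 0)).
by rewrite !nth_default ?size_map //= (khom0 hf).
Qed.

Lemma pval_phorner cs v : pv (phorner cs v) = (cpoly cs).[vval d a v].
Proof.
elim: cs => [|c cs ih] /=; first by rewrite /cpoly /= horner0 (khom0 hf).
by rewrite ih /cpoly /= cons_poly_def hornerMXaddC.
Qed.

Lemma pval_pseparant cs v : pv (pseparant cs v) = (cpoly cs)^`().[vval d a v].
Proof.
elim: cs => [|c cs ih] /=; first by rewrite /cpoly /= deriv0 horner0 (khom0 hf).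
rewrite ih pval_phorner /cpoly /= cons_poly_def derivD derivM derivX derivC mulr1 addr0.
by rewrite hornerD hornerM hornerX.
Qed.

Lemma pval_pderiv_phorner i cs v : pv (pderiv dK i (phorner cs v)) =
  pv (pseparant cs v) * vval d a (i :: v.1, v.2) +
  pv (phorner (map (pderiv dK i) cs) v).
Proof.
elim: cs => [|c cs ih] /=.
  by rewrite (dhom_del hf) (khom0 hf) (derivation0 (dalg_der hd i)) mul0r addr0.
rewrite ih; ring.
Qed.

End HornerValue.

Lemma low_coefs_cons v c cs : low_coefs v (c :: cs) -> low v c /\ low_coefs v cs.
Proof. by move=> h; split; [exact: (h 0%N) | move=> i; exact: (h i.+1)]. Qed.

Lemma low_phorner v cs w : low_coefs v cs -> vlt v w -> low w (phorner cs v).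
Proof.
elim: cs => [|c cs ih] //= /low_coefs_cons[hc hcs] hvw.
by split; [split=> //; exact: ih | exact: low_mono hc].
Qed.

Lemma low_pseparant v cs w : low_coefs v cs -> vlt v w -> low w (pseparant cs v).
Proof.
elim: cs => [|c cs ih] //= /low_coefs_cons[hc hcs] hvw.
by split; [split=> //; exact: ih | exact: low_phorner].
Qed.

Lemma low_phorner_deriv v cs i : low_coefs v cs ->
  low (i :: v.1, v.2) (phorner (map (pderiv dK i) cs) v).
Proof.
elim: cs => [|c cs ih] //= /low_coefs_cons[hc hcs].
split; last exact: low_deriv.
by split; [exact: ih | exact: vlt_cons].
Qed.

(* Every proper derivative of a polynomial relation is linear in the
   corresponding derivative of the leader, with the separant as coefficient. *)
Lemma derived_relation v cs w i : low_coefs v cs ->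
  exists r, low (w ++ i :: v.1, v.2) r /\
    forall (R : comAlgType k) (f : K -> R) (d : 'I_m -> R -> R) (b : X -> R),
      dalg d -> dhom dK d f ->
      dword d (rcons w i) (pval f d b (phorner cs v)) =
      pval f d b (pseparant cs v) * vval d b (w ++ i :: v.1, v.2) + pval f d b r.
Proof.
move=> hcs; elim: w => [|i' w [r [hr E]]].
  exists (phorner (map (pderiv dK i) cs) v); split; first exact: low_phorner_deriv.
  by move=> R f d b hd hf /=; rewrite -(pval_deriv b hd hf) pval_pderiv_phorner.
exists (PAdd (PMul (pderiv dK i' (pseparant cs v)) (PV K (w ++ i :: v.1, v.2))) (pderiv dK i' r)).
have step (u : var) t : low u t -> low (i' :: u.1, u.2) (pderiv dK i' t) by exact: low_deriv.
have hv u : vlt v (u ++ i :: v.1, v.2).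
  elim: u => [|a u ih] /=; first exact: vlt_cons.
  exact: vlt_trans ih (vlt_cons a (u ++ i :: v.1, v.2)).
split.
  split; last exact: (step (w ++ i :: v.1, v.2) r hr).
  split; last exact: (vlt_cons i' (w ++ i :: v.1, v.2)).
  by apply: (step (w ++ i :: v.1, v.2)); exact: low_pseparant.
move=> R f d b hd hf /=; rewrite (E R f d b hd hf).
have [dD [dM _]] := dalg_der hd i'.
by rewrite dD dM !(pval_deriv b hd hf) addrA.
Qed.

End DiffValues.

(** * Specialization of a generic point *)

Section Generic.
Variables (k : fieldType) (hk : [pchar k] =i pred0) (m : nat).
Variables (K : comAlgType k) (dK : 'I_m -> K -> K) (X : finType).
Hypothesis hK : dfield dK.
Variables (L : comAlgType k) (dL : 'I_m -> L -> L) (f : K -> L) (a : X -> L).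
Hypothesis hdL : dalg dL.
Hypothesis hf : dhom dK dL f.
Local Notation var := (seq 'I_m * X)%type.
Local Notation pterm := (pterm m K X).
Local Notation pva := (pval f dL a).
Local Notation pvb b := (pval id dK b).
Local Notation "cs `- i" := (nth (PC m X 0) cs i) (at level 3, i at level 2).
Let hdK := dfield_dalg hK.
Let hid := dhom_id dK.

(** Pairs the values of one term at [a] and at [b]. It is functional exactly when the terms in [P]
    that vanish at [a] vanish at [b], so specialization becomes an extension problem for partial
    homomorphisms, solved one derivative at a time. *)
Definition low_graph (R : comAlgType k) (g : K -> R) (d : 'I_m -> R -> R) (b : X -> R)
  (P : pterm -> Prop) (x : L) (y : R) : Prop :=
  exists t, [/\ P t, x = pva t & y = pval g d b t].

Lemma low_graphP (R : comAlgType k) (g : K -> R) (d : 'I_m -> R -> R) (b : X -> R)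
  (P : var -> Prop) : khom g -> subring_graph (low_graph g d b (pvars P)).
Proof.
move=> hg; split.
- by exists (PC m X 1); rewrite /= (khom1 hf) (khom1 hg).
- by move=> _ _ [t [h -> ->]]; exists (POpp t).
- by move=> _ _ _ _ [t [h -> ->]] [t' [h' -> ->]]; exists (PAdd t t').
- by move=> _ _ _ _ [t [h -> ->]] [t' [h' -> ->]]; exists (PMul t t').
Qed.

Definition self_graph (v : var) := low_graph f dL a (low v).

(* [v] is a leader when its value at [a] is algebraic over the lower derivatives. *)
Definition leader (v : var) : Prop :=
  exists p q, [/\ graph_poly (self_graph v) p q, p.[vval dL a v] = 0 & p <> 0].

(** The coefficients are terms, so that the relation can also be evaluated at other points.
    [md_size] and [md_pos] say that the last of them, the initial, does not vanish at [a]. *)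
Record minimal_data (v : var) (cs : seq pterm) : Prop := MinimalData {
  md_low : low_coefs v cs;
  md_size : size (cpoly f dL a cs) = size cs;
  md_pos : (0 < size cs)%N;
  md_root : (cpoly f dL a cs).[vval dL a v] = 0;
  md_sep : (cpoly f dL a cs)^`().[vval dL a v] <> 0;
  md_min : forall p q, graph_poly (self_graph v) p q -> p.[vval dL a v] = 0 ->
    (size p < size cs)%N -> p = 0 }.

Lemma leader_minimal v : leader v -> exists cs, minimal_data v cs.
Proof.
move=> /minimal_relation[p [q [hpq e nz hmin]]].
have hG : subring_graph (self_graph v) := low_graphP dL a _ hf.
have hsep := minimal_separable hG (char0_mulrn_eq0 hk (V := L)) hpq e nz hmin.
have /choice[c hc] : forall i, exists t, low v t /\ p`_i = pva t.
  by move=> i; have [t [h1 h2 _]] := hpq i; exists t.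
pose cs := mkseq c (size p).
have E : cpoly f dL a cs = p.
  apply/polyP => i; rewrite (coef_cpoly _ hf).
  case: (ltnP i (size p)) => hi; first by rewrite nth_mkseq // (hc i).2.
  by rewrite !nth_default ?size_mkseq //= (khom0 hf).
exists cs; split; rewrite ?E ?size_mkseq ?size_poly_gt0 // => i.
case: (ltnP i (size p)) => hi; first by rewrite nth_mkseq //; exact: (hc i).1.
by rewrite nth_default ?size_mkseq.
Qed.

Section Point.
Variable b : X -> K.
Local Notation G P := (low_graph id dK b P).

Lemma graph_poly_self v p q : graph_poly (G (low v)) p q -> graph_poly (self_graph v) p p.
Proof. by move=> h i; have [t [h1 h2 _]] := h i; exists t. Qed.

Lemma graph_poly_cpoly v cs : low_coefs v cs ->
  graph_poly (G (low v)) (cpoly f dL a cs) (cpoly id dK b cs).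
Proof.
by move=> h i; rewrite (coef_cpoly _ hf) (coef_cpoly _ hid); exists (cs`-i).
Qed.

Variables (vs : seq var) (cs_ : var -> seq pterm).
Hypothesis vs_min : forall v, v \in vs -> minimal_data v (cs_ v).
Hypothesis vs_all : forall u, leader u ->
  exists v w, [/\ v \in vs, u.2 = v.2 & perm_eq u.1 (w ++ v.1)].
Hypothesis b_root : forall v, v \in vs -> pvb b (phorner (cs_ v) v) = 0.
Hypothesis b_sep : forall v, v \in vs -> pvb b (pseparant (cs_ v) v) <> 0.
Hypothesis b_init : forall v, v \in vs -> pvb b ((cs_ v)`-(size (cs_ v)).-1) <> 0.

Lemma K_regular (x y : K) : x <> 0 -> x * y = 0 -> y = 0.
Proof. by move=> hx /(field_domain (dfield_field hK))[]. Qed.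

Lemma vkey_perm (v w : var) : v.2 = w.2 -> perm_eq v.1 w.1 -> forall i, vkey v i = vkey w i.
Proof. by move=> h2 h1 i; rewrite /vkey h2; case: ifP => // _; move/permP: h1 => ->. Qed.

Lemma low_perm (v w : var) (t : pterm) : v.2 = w.2 -> perm_eq v.1 w.1 -> low v t -> low w t.
Proof.
move=> h2 h1; apply: pvars_mono => u; apply: lexlt_ext => // i _.
exact: vkey_perm.
Qed.

(** If [v] is no leader, its value at [a] is transcendental over the lower ones and any value at [b]
    will do. If [v] is in [vs] up to permutation, its minimal relation applies. Otherwise [v] is a
    proper derivative of some [v0] in [vs] and satisfies a linear relation whose leading coefficient
    is the separant, nonzero at both points. *)
Lemma adjoin_next v : functional_graph (G (low v)) ->
  functional_graph (graph_adjoin (G (low v)) (vval dL a v) (vval dK b v)).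
Proof.
move=> hfun; have hG : subring_graph (G (low v)) := low_graphP dK b _ (khom_id K).
case: (EM (leader v)) => hlead; last first.
  apply: (adjoin_transcendental hfun) => p q hpq e; apply: contrapT => nz.
  by apply: hlead; exists p, p; split=> //; exact: graph_poly_self hpq.
have [v0 [w [v0s e2 e1]]] := vs_all hlead; have hm := vs_min v0s; set cs := cs_ v0 in hm *.
(* The last letter of [w] is the derivation applied first to [v0]; it is the [i] of
   [derived_relation]. *)
elim/last_ind: w e1 => [|w i _] e1.
  have Ea : vval dL a v = vval dL a v0 by apply: vval_perm.
  have Eb : vval dK b v = vval dK b v0 by apply: vval_perm.
  have hlow (t : pterm) : low v0 t -> low v t by apply: low_perm => //; rewrite perm_sym.
  apply: (adjoin_algebraic hG hfun (f0 := cpoly f dL a cs) (g0 := cpoly id dK b cs)).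
  - by apply: graph_poly_cpoly => j; apply/hlow/(md_low hm).
  - by rewrite -size_poly_gt0 (md_size hm) (md_pos hm).
  - by rewrite Ea (md_root hm).
  - by rewrite Eb -(pval_phorner _ hid) b_root.
  - rewrite (md_size hm) (coef_cpoly _ hid) => y; apply: K_regular; exact: b_init.
  - move=> p q hpq; rewrite (md_size hm) Ea => e hs.
    apply: (md_min hm (q := p)) e hs => j; have [t [h1 h2 _]] := hpq j; exists t; split=> //.
    exact: low_perm h1.
have {}e1 : perm_eq v.1 (w ++ i :: v0.1) by rewrite -cat_rcons.
set u : var := (w ++ i :: v0.1, v0.2).
have Ea : vval dL a v = vval dL a u by apply: vval_perm.
have Eb : vval dK b v = vval dK b u by apply: vval_perm.
have hlow (t : pterm) : low u t -> low v t by apply: low_perm => //=; rewrite perm_sym.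
have [r [hr E]] := derived_relation dK w i (md_low hm).
have hvu : vlt v0 u.
  rewrite /u; elim: (w) => [|c s ih] /=; first exact: vlt_cons.
  exact: vlt_trans ih (vlt_cons c (s ++ i :: v0.1, v0.2)).
have hS := hlow _ (low_pseparant (md_low hm) hvu).
have Sa : pva (pseparant cs v0) <> 0 by rewrite (pval_pseparant _ hf); exact: md_sep hm.
(* The derived relation as a polynomial of degree 1; its minimality is clear, since a constant
   vanishing somewhere is 0. *)
pose rel (R : comAlgType k) (g : K -> R) (d : 'I_m -> R -> R) (c : X -> R) : {poly R} :=
  (pval g d c (pseparant cs v0)) *: 'X + (pval g d c r)%:P.
have size_rel : size (rel L f dL a) = 2%N.
  apply/eqP; rewrite eqn_leq; apply/andP; split.
    apply/leq_sizeP => -[|[|p]] // _.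
    by rewrite /rel coefD coefZ coefX coefC /= mulr0 addr0.
  rewrite ltnNge; apply/negP => /leq_sizeP/(_ 1%N isT).
  by rewrite /rel coefD coefZ coefX coefC /= mulr1 addr0.
have rel_root (R : comAlgType k) (g : K -> R) (d : 'I_m -> R -> R) (c : X -> R) :
    dalg d -> dhom dK d g -> pval g d c (phorner cs v0) = 0 -> (rel R g d c).[vval d c u] = 0.
  move=> hd hg h; rewrite /rel hornerD hornerZ hornerX hornerC -E // h.
  exact: dword0.
apply: (adjoin_algebraic hG hfun (f0 := rel L f dL a) (g0 := rel K id dK b)).
- move=> j; rewrite /rel !coefD !coefZ !coefX !coefC.
  exists (PAdd (PMul (pseparant cs v0) (PC m X (j == 1%N)%:R)) (if j == 0%N then r else PC m X 0)).
  split=> /=.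
  + by split=> //; case: (j == 0%N) => //; exact: hlow.
  + case: (j == 1%N); case: (j == 0%N); rewrite /= ?(khom1 hf) ?(khom0 hf) //.
  + by case: (j == 1%N); case: (j == 0%N).
- by rewrite -size_poly_gt0 size_rel.
- rewrite Ea rel_root // (pval_phorner _ hf); exact: md_root hm.
- by rewrite Eb rel_root // b_root.
- move=> y; rewrite size_rel /rel coefD coefZ coefX coefC /= mulr1 addr0.
  by apply: K_regular; exact: b_sep.
- move=> p q hpq e; rewrite size_rel ltnS => /size1_polyC hp.
  by move: e; rewrite hp hornerC => ->; rewrite polyC0.
Qed.

Lemma lowe_functional v : functional_graph (G (low v)) -> functional_graph (G (lowe v)).
Proof.
move=> /adjoin_next hadj y [t [ht e ->]]; apply: hadj.
have hG : subring_graph (G (low v)) := low_graphP dK b _ (khom_id K).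
have hA := graph_adjoinP hG (vval dL a v) (vval dK b v).
rewrite e; elim: t ht {e} => /= [w hw|c _|t1 h1 t2 h2 [/h1 a1 /h2 a2]|t1 h1 /h1 a1|
  t1 h1 t2 h2 [/h1 a1 /h2 a2]].
- case: (lexlt_total m.+1 (vkey w) (vkey v)) => h //.
    by apply: (graph_adjoin_sub hG); exists (PV K w).
  have [h2 h1] := vkey_eq h.
  by rewrite (vval_perm a hdL h2 h1) (vval_perm b hdK h2 h1); exact: (graph_adjoin_gen hG).
- by apply: (graph_adjoin_sub hG); exists (PC m X c).
- exact: (graphD hA).
- exact: (graphN hA).
- exact: (graphM hA).
Qed.

Lemma const_functional t : pvars (fun=> False) t -> pva t = 0 -> pvb b t = 0.
Proof.
move=> ht; have [c [-> ->]] : exists c, pva t = f c /\ pvb b t = c.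
  elim: t ht => /= [//|c|t1 h1 t2 h2 [/h1[c [-> ->]] /h2[c' [-> ->]]]|t1 h1 /h1[c [-> ->]]|
    t1 h1 t2 h2 [/h1[c [-> ->]] /h2[c' [-> ->]]]].
  - by exists c.
  - by exists (c + c'); rewrite (khomD hf).
  - by exists (- c); rewrite (khomN hf).
  - by exists (c * c'); rewrite (khomM hf).
by rewrite -(khom0 hf); apply: (khom_field_inj hf (dfield_field hK)).
Qed.

(** At a minimal counterexample [u], a term below [u] has a largest variable [w] below [u], for
    which the claim holds; hence [lowe_functional] applies to [u]. *)
Lemma all_functional v : functional_graph (G (lowe v)).
Proof.
apply: contrapT => hv.
have [|u [hu umin]] := @lexlt_min _ m.+1 (@vkey m X) (fun v => ~ functional_graph (G (lowe v))).
  by exists v.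
apply: hu; apply: lowe_functional => y [t [ht e ->]].
case: (lowe_max ht) => [[w [hwu hw]]|hno]; last exact: const_functional.
have : functional_graph (G (lowe w)) by apply: contrapT => /umin.
by apply; exists t.
Qed.

Lemma specialization (g : dterm K X m 0) :
  reval f dL (@no_ops L) a g = 0 -> reval id dK (@no_ops K) b g = 0.
Proof.
rewrite -(pval_norm a hdL hf) -(pval_norm b hdK hid) => e.
case: (@lowe_max _ _ _ _ (fun=> True) (pnorm dK g)) => [|[w [_ hw]]|].
- by elim: (pnorm dK g).
- by apply: (@all_functional w); exists (pnorm dK g).
- by move=> hno; exact: const_functional.
Qed.

End Point.

Definition tzero : dterm K X m 0 := TPar X m 0 0.

(* A quantifier-free form of the Ritt-Raudenbush theorem: finitely many equations
   and inequations at [b] force the whole ideal of [a] to vanish at [b]. *)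
Lemma generic_formula : exists phi : qf K X m 0,
  qholds f dL (@no_ops L) a phi /\
  forall b : X -> K, qholds id dK (@no_ops K) b phi ->
    forall g : dterm K X m 0, reval f dL (@no_ops L) a g = 0 -> reval id dK (@no_ops K) b g = 0.
Proof.
(* Entry [m] is the rank of the indeterminate and entry [m.+1] its complement in the size of [X]:
   comparison of both forces equal indeterminates, while the first [m] entries express divisibility
   of the derivatives. *)
pose vec (v : var) (i : nat) : nat :=
  if (i < m.+1)%N then vkey v i else (#|X| - enum_rank v.2)%N.
have [vs [vsl hvs]] := dickson m.+2 vec leader.
have /choice[cs_ hcs] : forall v, exists cs, leader v -> minimal_data v cs.
  by move=> v; case: (EM (leader v)) => [/leader_minimal[cs h]|]; [exists cs | exists [::]].
pose A v := dterm_of (phorner (cs_ v) v).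
pose S v := dterm_of (pseparant (cs_ v) v).
pose J v := dterm_of ((cs_ v)`-(size (cs_ v)).-1).
pose phi_ v := FAnd (FEq (A v) tzero) (FAnd (FNot (FEq (S v) tzero)) (FNot (FEq (J v) tzero))).
pose phi := foldr (fun v q => FAnd (phi_ v) q) (FEq tzero tzero) vs.
have phiP (R : comAlgType k) (g : K -> R) (d : 'I_m -> R -> R) (c : X -> R) : dhom dK d g ->
    qholds g d (@no_ops R) c phi <-> forall v, v \in vs ->
      [/\ pval g d c (phorner (cs_ v) v) = 0, pval g d c (pseparant (cs_ v) v) <> 0 &
          pval g d c ((cs_ v)`-(size (cs_ v)).-1) <> 0].
  move=> hg; have z : reval g d (@no_ops R) c tzero = 0 by exact: khom0 hg.
  rewrite /phi; elim: vs {vsl hvs phi} => [|v vs ih] /=; first by split.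
  rewrite z !(pval_dterm g d c) ih; split=> [[[h1 [h2 h3]] h] w|h].
    by rewrite inE => /orP[/eqP ->|/h].
  by split=> [|w hw]; [have [] := h v (mem_head _ _) | apply: h; rewrite inE hw orbT].
exists phi; split.
  apply/(phiP L f dL a hf) => v hv; have hm := hcs v (vsl v hv).
  split; first by rewrite (pval_phorner _ hf) (md_root hm).
    by rewrite (pval_pseparant _ hf); exact: md_sep hm.
  rewrite -(coef_cpoly _ hf) -(md_size hm) -lead_coefE; apply/eqP.
  by rewrite lead_coef_eq0 -size_poly_gt0 (md_size hm) (md_pos hm).
move=> b /(phiP K id dK b hid) hb g.
apply: (@specialization b vs cs_) => [v hv|u hu|v hv|v hv|v hv].
- by apply: hcs; exact: vsl.
- have [v hv hle] := hvs u hu.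
  have rk : u.2 = v.2.
    apply/enum_rank_inj/val_inj/eqP; rewrite eqn_leq.
    have := hle m (leqnSn _); have := hle m.+1 (leqnn _).
    rewrite /vec /vkey !ltnn leqnn => h1 ->; rewrite andbT.
    by move: h1; rewrite leq_sub2lE //; exact: ltnW (ltn_ord (enum_rank u.2)).
  have [s sub ps] : exists2 s, subseq s u.1 & perm_eq v.1 s.
    apply/count_subseqP => j; have := hle j (ltnW (leqW (ltn_ord j))).
    rewrite /vec /vkey (leqW (ltn_ord j)) ltn_ord; apply: leq_trans.
    by [].
  have [w pw] := perm_to_subseq sub.
  exists v, w; split=> //; apply: (perm_trans pw); rewrite perm_catC perm_cat2l.
  by rewrite perm_sym.
- by have [] := hb v hv.
- by have [] := hb v hv.
- by have [] := hb v hv.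
Qed.

End Generic.

(** * The axioms hold in existentially closed rings *)

Section RevalUnfold.
Variables (A X : Type) (m l : nat) (R : pzRingType).
Variables (par : A -> R) (d : 'I_m -> R -> R) (p : 'I_l -> R -> R) (v : X -> R).
Local Notation ev := (reval par d p v).
Lemma revalD t1 t2 : ev (TAdd t1 t2) = ev t1 + ev t2. Proof. by []. Qed.
Lemma revalN t : ev (TOpp t) = - ev t. Proof. by []. Qed.
Lemma revalM t1 t2 : ev (TMul t1 t2) = ev t1 * ev t2. Proof. by []. Qed.
Lemma revalDel i t : ev (TDel i t) = d i (ev t). Proof. by []. Qed.
End RevalUnfold.

Section TermHom.
Variables (A X : Type) (m l : nat) (R S : pzRingType) (f : R -> S).
Variables (par : A -> R) (dR : 'I_m -> R -> R) (dS : 'I_m -> S -> S).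
Variables (pR : 'I_l -> R -> R) (pS : 'I_l -> S -> S).
Hypothesis fD : forall x y, f (x + y) = f x + f y.
Hypothesis fM : forall x y, f (x * y) = f x * f y.
Hypothesis fd : forall j x, f (dR j x) = dS j (f x).
Hypothesis fp : forall i x, f (pR i x) = pS i (f x).

Lemma reval_hom (v : X -> R) (t : dterm A X m l) :
  reval (f \o par) dS pS (f \o v) t = f (reval par dR pR v t).
Proof.
have f0 : f 0 = 0 by apply: (addrI (f 0)); rewrite -fD !addr0.
have fN x : f (- x) = - f x by apply: (addrI (f x)); rewrite -fD !subrr f0.
by rewrite /reval; elim: t => /= [x|c|t1 -> t2 ->|t1 ->|t1 -> t2 ->|j t1 ->|i t1 ->].
Qed.

Lemma qholds_hom (v : X -> R) (phi : qf A X m l) : injective f ->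
  qholds (f \o par) dS pS (f \o v) phi <-> qholds par dR pR v phi.
Proof.
move=> finj; elim: phi => /= [t1 t2|p ih|p ih q ih'|p ih q ih'].
- by rewrite !reval_hom; split=> [/finj|->].
- by rewrite ih.
- by rewrite ih ih'.
- by rewrite ih ih'.
Qed.
End TermHom.

Section TermSubst.
Variables (A X Y : Type) (m l l' : nat).
Variables (s : X -> dterm A Y m l') (h : 'I_l -> 'I_l').

Fixpoint tsubst (t : dterm A X m l) : dterm A Y m l' :=
  match t with
  | TVar x => s x
  | TPar c => TPar _ _ _ c
  | TAdd t1 t2 => TAdd (tsubst t1) (tsubst t2)
  | TOpp t1 => TOpp (tsubst t1)
  | TMul t1 t2 => TMul (tsubst t1) (tsubst t2)
  | TDel i t1 => TDel i (tsubst t1)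
  | TPart i t1 => TPart (h i) (tsubst t1)
  end.

Fixpoint qsubst (phi : qf A X m l) : qf A Y m l' :=
  match phi with
  | FEq t1 t2 => FEq (tsubst t1) (tsubst t2)
  | FNot p => FNot (qsubst p)
  | FAnd p q => FAnd (qsubst p) (qsubst q)
  | FOr p q => FOr (qsubst p) (qsubst q)
  end.

Variables (R : pzRingType) (par : A -> R) (d : 'I_m -> R -> R).
Variables (pr : 'I_l -> R -> R) (pr' : 'I_l' -> R -> R).
Hypothesis hpr : forall i x, pr i x = pr' (h i) x.

Lemma reval_subst (v : Y -> R) t : reval par d pr' v (tsubst t) =
  reval par d pr (fun x => reval par d pr' v (s x)) t.
Proof.
by rewrite /reval; elim: t => /= [x|c|t1 -> t2 ->|t1 ->|t1 -> t2 ->|i t1 ->|i t1 ->] //.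
Qed.

Lemma qholds_subst (v : Y -> R) phi : qholds par d pr' v (qsubst phi) <->
  qholds par d pr (fun x => reval par d pr' v (s x)) phi.
Proof.
elim: phi => /= [t1 t2|p ih|p ih q ih'|p ih q ih'].
- by rewrite !reval_subst.
- by rewrite ih.
- by rewrite ih ih'.
- by rewrite ih ih'.
Qed.
End TermSubst.

Lemma reval_tmap (A A' X : Type) m l (R : pzRingType) (g : A -> A') (par : A' -> R)
  (d : 'I_m -> R -> R) (pr : 'I_l -> R -> R) (v : X -> R) t :
  reval par d pr v (tmap g t) = reval (par \o g) d pr v t.
Proof.
by rewrite /reval; elim: t => /= [x|c|t1 -> t2 ->|t1 ->|t1 -> t2 ->|i t1 ->|i t1 ->].
Qed.

Lemma tmap_cancel (A A' X : Type) m l (g : A -> A') (g' : A' -> A) (t : dterm A' X m l) :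
  cancel g' g -> tmap g (tmap g' t) = t.
Proof.
by move=> K; elim: t => /= [x|c|t1 -> t2 ->|t1 ->|t1 -> t2 ->|i t1 ->|i t1 ->] //; rewrite K.
Qed.

Lemma reval_hom0 (A X : Type) (m : nat) (R S : pzRingType) (f : R -> S)
  (par : A -> R) (dR : 'I_m -> R -> R) (dS : 'I_m -> S -> S) (v : X -> R) (t : dterm A X m 0) :
  (forall x y, f (x + y) = f x + f y) -> (forall x y, f (x * y) = f x * f y) ->
  (forall j x, f (dR j x) = dS j (f x)) ->
  reval (f \o par) dS (@no_ops S) (f \o v) t = f (reval par dR (@no_ops R) v t).
Proof. by move=> fD fM fd; apply: reval_hom => // -[]. Qed.

Definition no_part (l : nat) (i : 'I_0) : 'I_l := False_rect _ (notF (ltn_ord i)).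

(** * Terms for prolongations, projections and nabla *)

Section Terms.
Variables (k : fieldType) (B : falgType k).
Hypothesis hBcomm : forall x y : B, x * y = y * x.
Variables (l : nat) (eps : l.+1.-tuple B).
Hypothesis heps : basis_of fullv eps.
Variable m : nat.
Local Notation D S := (DR hBcomm heps S).
Variables (K : comAlgType k) (prt : 'I_l -> K -> K).

Definition tsum (X : Type) (l' : nat) (I : Type) (s : seq I) (F : I -> dterm K X m l')
  : dterm K X m l' := foldr (fun i t => TAdd (F i) t) (TPar _ _ _ 0) s.

Lemma reval_tsum (X : Type) (l' : nat) (I : Type) (s : seq I) (F : I -> dterm K X m l')
  (R : comAlgType k) (f : K -> R) (d : 'I_m -> R -> R) (pr : 'I_l' -> R -> R) (v : X -> R) :
  khom f -> reval f d pr v (tsum s F) = \sum_(i <- s) reval f d pr v (F i).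
Proof.
move=> hf; elim: s => [|i s ih]; first by rewrite big_nil; exact: khom0 hf.
by rewrite big_cons -ih.
Qed.

Section Prolongation.
Variable X : Type.
Local Notation Y := ('I_l.+1 * X)%type.

(** The differential polynomial f^(q), with products expanded by the structure constants of [B]. *)
Fixpoint Dterm (t : dterm K X m 0) (q : 'I_l.+1) : dterm K Y m 0 :=
  match t with
  | TVar x => TVar _ _ _ (q, x)
  | TPar c => TPar _ _ _ (emap prt c q)
  | TAdd t1 t2 => TAdd (Dterm t1 q) (Dterm t2 q)
  | TOpp t1 => TOpp (Dterm t1 q)
  | TMul t1 t2 =>
      tsum (index_enum 'I_l.+1) (fun i => tsum (index_enum 'I_l.+1) (fun j =>
        TMul (TPar _ _ _ (coord eps q (tnth eps i * tnth eps j))%:A)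
             (TMul (Dterm t1 i) (Dterm t2 j))))
  | TDel i t1 => TDel i (Dterm t1 q)
  | TPart i t1 => Dterm t1 q
  end.

Definition dDR (R : comAlgType k) (d : 'I_m -> R -> R) (j : 'I_m) (u : D R) : D R :=
  fun q => d j (u q).

Lemma dDR_dalg (R : comAlgType k) (d : 'I_m -> R -> R) : dalg d -> dalg (dDR d).
Proof.
move=> hd; split=> [j|i j u]; last by apply/funext => q; rewrite /dDR (dalg_comm hd).
have hj := dalg_der hd j; split; [|split].
- by move=> u v; apply/funext => q; rewrite /dDR !DR_addE hj.1.
- by move=> u v; apply/funext => q; rewrite /dDR derivation_DRmul.
- by move=> c u; apply/funext => q; rewrite /dDR !DR_scaleE hj.2.2.
Qed.

Variables (R : comAlgType k) (f : K -> R) (d : 'I_m -> R -> R).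
Hypothesis hf : khom f.

Lemma scale_par c (x : R) : f c%:A * x = c *: x.
Proof. by rewrite (khomZ hf) (khom1 hf) mulr_algl. Qed.

Definition Dpar (c : K) : D R := fun q => f (emap prt c q).
Definition Dpoint (w : Y -> R) (x : X) : D R := fun q => w (q, x).

Lemma reval_Dterm (w : Y -> R) t q : reval f d (@no_ops R) w (Dterm t q) =
  reval Dpar (dDR d) (@no_ops (D R)) (Dpoint w) t q.
Proof.
elim: t q => /= [x|c|t1 h1 t2 h2|t1 h1|t1 h1 t2 h2|i t1 h1|[]] q //.
- by rewrite !revalD h1 h2.
- by rewrite !revalN h1.
- rewrite reval_tsum // revalM DR_mulE; apply: eq_bigr => i _.
  rewrite reval_tsum //; apply: eq_bigr => j _.
  by rewrite !revalM h1 h2; exact: scale_par.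
- by rewrite !revalDel h1.
Qed.

Definition phterm (p : B -> k) (x : X) : dterm K Y m 0 :=
  tsum (index_enum 'I_l.+1) (fun q =>
    TMul (TPar _ _ _ (p (tnth eps q))%:A) (TVar _ _ _ (q, x))).

Lemma reval_phterm p (w : Y -> R) x :
  reval f d (@no_ops R) w (phterm p x) = DRproj p (Dpoint w x).
Proof.
rewrite reval_tsum //; apply: eq_bigr => q _.
by rewrite revalM; exact: scale_par.
Qed.

End Prolongation.

Definition nabterm (X : Type) (qx : 'I_l.+1 * X) : dterm K X m l :=
  if unlift ord0 qx.1 is Some i then TPart i (TVar _ _ _ qx.2) else TVar _ _ _ qx.2.

Definition nablaX (X : Type) (R : comAlgType k) (pr : 'I_l -> R -> R) (a : X -> R)
  : 'I_l.+1 * X -> R := fun qx => emap pr (a qx.2) qx.1.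

Lemma reval_nabterm (X : Type) (R : comAlgType k) (f : K -> R) (d : 'I_m -> R -> R)
  (pr : 'I_l -> R -> R) (v : X -> R) :
  (fun qx => reval f d pr v (nabterm qx)) = nablaX pr v.
Proof.
apply/funext => -[q x]; rewrite /nabterm /nablaX /emap /=.
by case: unliftP.
Qed.

Section DringFacts.
Variables (R : comAlgType k) (d : 'I_m -> R -> R) (pr : 'I_l -> R -> R).
Hypothesis hR : is_Dring eps d pr.

Lemma Dring_dalg : dalg d.
Proof. by case: hR => h1 [h2 _]; split. Qed.

Lemma Dring_khom : khom (emap pr : R -> D R).
Proof. by case: hR => h1 [h2 [h3 [h4 [h5 [h6 h7]]]]]; split. Qed.

Lemma Dring_del j x q : emap pr (d j x) q = d j (emap pr x q).
Proof. by case: hR => h1 [h2 [h3 [h4 [h5 [h6 h7]]]]]; rewrite h7. Qed.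

Lemma Dring_emap_dhom : dhom d (dDR d) (emap pr : R -> D R).
Proof. by split; [exact: Dring_khom | move=> j x; apply/funext => q; exact: Dring_del]. Qed.

Lemma sigmaE p x : sigma eps pr p x = DRproj p (emap pr x : D R).
Proof. by []. Qed.

Lemma DRproj_dhom p : kalg_hom p -> dhom (dDR d) d (fun u : D R => DRproj p u).
Proof.
move=> hp; split; first exact: DRproj_khom.
by move=> j u; apply: derivation_DRproj; exact: dalg_der Dring_dalg j.
Qed.

Lemma sigma_dhom p : kalg_hom p -> dhom d d (sigma eps pr p).
Proof. by move=> hp; exact: dhom_comp Dring_emap_dhom (DRproj_dhom hp). Qed.

Lemma emap0 x : emap pr x ord0 = x.
Proof. by rewrite /emap unlift_none. Qed.

Lemma emapS x i : emap pr x (lift ord0 i) = pr i x.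
Proof. by rewrite /emap liftK. Qed.

End DringFacts.

End Terms.

Lemma frac_extend_dhom (k : fieldType) (m : nat) (R Q S : comAlgType k) (i : R -> Q)
  (dR : 'I_m -> R -> R) (dQ : 'I_m -> Q -> Q) (dS : 'I_m -> S -> S) (phi : R -> S) :
  is_frac i -> dalg dQ -> dalg dS -> dhom dR dQ i -> dhom dR dS phi ->
  (forall b, b <> 0 -> invertible (phi b)) ->
  exists psi : Q -> S, dhom dQ dS psi /\ forall x, psi (i x) = phi x.
Proof.
move=> hi hdQ hdS hdi hphi hu; have [psi [hpsi e]] := frac_extend hi hphi hu.
exists psi; split=> //; split=> // j.
have [_ [QM _]] := dalg_der hdQ j; have [_ [SM _]] := dalg_der hdS j.
apply: (frac_leibniz_uniq hi (psi := psi) (D1 := psi \o dQ j) (D2 := dS j \o psi) hpsi) => /=.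
- by move=> x y; rewrite QM (khomD hpsi) !(khomM hpsi).
- by move=> x y; rewrite (khomM hpsi) SM.
- by move=> x; rewrite -(dhom_del hdi) !e (dhom_del hphi).
Qed.

Section Coordinate.
Variables (k : fieldType) (m : nat) (K : comAlgType k) (del : 'I_m -> K -> K) (X : Type).
Hypothesis hdel : dalg del.
Variable U : (X -> K) -> Prop.
Hypothesis Uirr : dirreducible del U.
Local Notation term := (dterm K X m 0).

(** Equality of functions on [U]; the quotient is the differential coordinate ring, that is,
    differential polynomials modulo the ideal of [U]. *)
Definition ceq (t t' : term) : Prop := forall w, U w -> peval del t w = peval del t' w.

Definition coord_setoid : setoidalg k.
Proof.
apply: (@SetoidAlg k term ceq (TPar _ _ _ 0) (TPar _ _ _ 1) (@TAdd _ _ _ _) (@TOpp _ _ _ _)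
  (@TMul _ _ _ _) (fun c => TMul (TPar _ _ _ c%:A))).
- by [].
- by move=> x y h w hw; rewrite h.
- by move=> x y z h h' w hw; rewrite h ?h'.
- by move=> x x' y h w hw; congr (_ + _); exact: h.
- by move=> x x' h w hw; congr (- _); exact: h.
- by move=> x x' y h w hw; congr (_ * _); exact: h.
- by move=> a x x' h w hw; congr (_ * _); exact: h.
- by case: Uirr => _ [[w hw] _] /(_ w hw) /eqP; rewrite /peval /reval /= oner_eq0.
- apply: (alg_laws_eval (I := {w | U w}) (ev := fun w t => peval del t (sval w))) => //.
    by move=> x y h w hw; exact: (h (exist _ w hw)).
  by move=> w c x; rewrite /peval revalM; exact: mulr_algl.
Defined.

Definition coord_ring : comAlgType k := quot coord_setoid.
Definition cproj (t : term) : coord_ring := qproj (t : sa_sort coord_setoid).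

Lemma cprojP t t' : cproj t = cproj t' <-> ceq t t'. Proof. exact: qprojP. Qed.
Lemma cproj_surj (x : coord_ring) : exists t, x = cproj t.
Proof. exact (@qproj_surj _ coord_setoid x). Qed.
Lemma cprojD s t : cproj (TAdd s t) = cproj s + cproj t.
Proof. exact (@qprojD _ coord_setoid s t). Qed.
Lemma cprojN s : cproj (TOpp s) = - cproj s.
Proof. exact (@qprojN _ coord_setoid s). Qed.
Lemma cprojM s t : cproj (TMul s t) = cproj s * cproj t.
Proof. exact (@qprojM _ coord_setoid s t). Qed.
Lemma cprojZ c s : cproj (TMul (TPar _ _ _ c%:A) s) = c *: cproj s.
Proof. exact (@qprojZ _ coord_setoid c s). Qed.

Definition cder (j : 'I_m) (x : coord_ring) : coord_ring := cproj (TDel j (qrepr x)).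

Lemma cderE j t : cder j (cproj t) = cproj (TDel j t).
Proof.
apply/cprojP => w hw; rewrite /peval !revalDel; congr del.
exact: (@qrepr_pi _ coord_setoid t).
Qed.

Lemma cder_dalg : dalg cder.
Proof.
split=> [j|i j x]; last first.
  have [t ->] := cproj_surj x; rewrite !cderE; apply/cprojP => w hw.
  exact: dalg_comm.
have [dD [dM dZ]] := dalg_der hdel j; split; [|split].
- move=> x y; have [s ->] := cproj_surj x; have [t ->] := cproj_surj y.
  by rewrite -cprojD !cderE -cprojD; apply/cprojP => w hw; exact: dD.
- move=> x y; have [s ->] := cproj_surj x; have [t ->] := cproj_surj y.
  by rewrite -cprojM !cderE -!cprojM -cprojD; apply/cprojP => w hw; exact: dM.
- move=> c x; have [s ->] := cproj_surj x.
  rewrite -cprojZ !cderE -cprojZ; apply/cprojP => w hw.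
  rewrite /peval revalDel !revalM revalDel /reval /= !mulr_algl; exact: dZ.
Qed.

Definition cconst (c : K) : coord_ring := cproj (TPar _ _ _ c).
Definition cvar (x : X) : coord_ring := cproj (TVar _ _ _ x).

Lemma cconst_dhom : dhom del cder cconst.
Proof.
split; first split.
- by move=> x y; rewrite -cprojD; apply/cprojP.
- by move=> x y; rewrite -cprojM; apply/cprojP.
- by [].
- move=> c x; rewrite -cprojZ; apply/cprojP => w hw.
  by rewrite /peval revalM /reval /= mulr_algl.
- by move=> j x; rewrite cderE; apply/cprojP.
Qed.

Lemma reval_cproj t : reval cconst cder (@no_ops coord_ring) cvar t = cproj t.
Proof.
rewrite /reval; elim: t => /= [x|c|t1 -> t2 ->|t1 ->|t1 -> t2 ->|i t1 ->|[]] //.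
- by rewrite cprojD.
- by rewrite cprojN.
- by rewrite cprojM.
- exact: cderE.
Qed.

Lemma cproj0P t : cproj t = 0 <-> dideal del U t.
Proof. exact: (cprojP t (TPar _ _ _ 0)). Qed.

Lemma dideal_closed g : dclosed del (fun w => U w /\ peval del g w = 0).
Proof.
have [[S hS] _] := Uirr; exists (fun t => S t \/ t = g) => w; rewrite hS.
split=> [[h e] t [|->]|h]; [exact: h|exact: e|].
by split=> [t ht|]; apply: h; [left|right].
Qed.

(** If a product vanishes on [U], then [U] is the union of the closed subsets where one of the
    factors vanishes. *)
Lemma coord_domain : is_domain K -> is_domain coord_ring.
Proof.
move=> hK x y; have [s ->] := cproj_surj x; have [t ->] := cproj_surj y.
rewrite -cprojM !cproj0P => hst.
have [_ [_ irr]] := Uirr.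
have [|h|h] := irr _ _ (dideal_closed s) (dideal_closed t).
- move=> w; split=> [hw|[[]|[]]] //.
  by case: (hK _ _ (hst w hw)) => e; [left|right].
- by left=> w /h[].
- by right=> w /h[].
Qed.

Lemma coord_universal (S : comAlgType k) (dS : 'I_m -> S -> S) (par : K -> S) (v : X -> S) :
  khom par ->
  (forall t, dideal del U t -> reval par dS (@no_ops S) v t = 0) ->
  exists h : coord_ring -> S, dhom cder dS h /\
    forall t, h (cproj t) = reval par dS (@no_ops S) v t.
Proof.
move=> hpar hker; pose h (x : coord_ring) := reval par dS (@no_ops S) v (qrepr x).
have hE t : h (cproj t) = reval par dS (@no_ops S) v t.
  apply/eqP; rewrite -subr_eq0; apply/eqP; rewrite /h.
  set t' := qrepr _; have : dideal del U (TAdd t' (TOpp t)).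
    move=> w hw; rewrite /peval revalD revalN; apply/eqP; rewrite subr_eq0; apply/eqP.
    exact: (@qrepr_pi _ coord_setoid t w hw).
  by move/hker; rewrite revalD revalN.
exists h; split=> //; split; first split.
- by move=> x y; have [s ->] := cproj_surj x; have [t ->] := cproj_surj y; rewrite -cprojD !hE.
- by move=> x y; have [s ->] := cproj_surj x; have [t ->] := cproj_surj y; rewrite -cprojM !hE.
- by rewrite (hE (TPar _ _ _ 1)); exact: khom1.
- move=> c x; have [s ->] := cproj_surj x; rewrite -cprojZ !hE revalM /reval /=.
  by rewrite (khomZ hpar) (khom1 hpar) mulr_algl.
- by move=> j x; have [s ->] := cproj_surj x; rewrite cderE !hE.
Qed.

End Coordinate.

Section ClassK.
Variables (k : fieldType) (B : falgType k).
Hypothesis hBcomm : forall x y : B, x * y = y * x.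
Hypothesis hBres : residue_fields_trivial B.
Variables (l : nat) (eps : l.+1.-tuple B).
Hypothesis heps : basis_of fullv eps.
Variable pi : B -> k.
Hypothesis hpi : kalg_hom pi.
Hypothesis hpi0 : pi (tnth eps ord0) = 1.
Hypothesis hpii : forall i : 'I_l.+1, i != ord0 -> pi (tnth eps i) = 0.
Variable m : nat.
Local Notation D S := (DR hBcomm heps S).

(** Denominators must become units in an algebra that may have zero divisors; [DR_invertible] gives
    this from the injectivity of all residues. *)
Lemma frac_extend_lift (R Q S : comAlgType k) (i : R -> Q)
  (dR : 'I_m -> R -> R) (dQ : 'I_m -> Q -> Q) (dS : 'I_m -> S -> S) (phi : R -> D S) :
  is_frac i -> dalg dQ -> dfield dS -> dhom dR dQ i -> dhom dR (dDR dS) phi ->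
  (forall p, kalg_hom p -> forall x, DRproj p (phi x) = 0 -> x = 0) ->
  exists psi : Q -> D S, dhom dQ (dDR dS) psi /\ forall x, psi (i x) = phi x.
Proof.
move=> hi hdQ hS hdi hphi hinj.
apply: (frac_extend_dhom hi hdQ (dDR_dalg hBcomm heps (dfield_dalg hS)) hdi hphi) => b hb.
apply: (DR_invertible hBres) => p hp; apply: (dfield_field hS).
by move/(hinj p hp).
Qed.

Lemma Dring_of_khom (Q : comAlgType k) (dQ : 'I_m -> Q -> Q) (e : Q -> D Q) :
  dalg dQ -> dhom dQ (dDR dQ) e -> (forall x, e x ord0 = x) ->
  is_Dring eps dQ (fun a x => e x (lift ord0 a)) /\
  forall x, emap (fun a x => e x (lift ord0 a)) x = e x.
Proof.
move=> hdQ he e0.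
have E x : emap (fun a x => e x (lift ord0 a)) x = e x.
  by apply/funext => q; rewrite /emap; case: unliftP => [a ->|->].
split=> //; split; first by move=> j; exact: dalg_der.
split; first by move=> i j x; exact: dalg_comm.
split; first by move=> x y; rewrite !E (khomD he).
split; first by move=> c x; rewrite !E (khomZ he).
split; first by move=> x y; rewrite !E (khomM he).
split; first by rewrite E (khom1 he).
by move=> j x; rewrite !E (dhom_del he).
Qed.

(** Injectivity of the associated endomorphisms, required in the class, is what lets the operators
    pass to the fraction field. *)
Lemma frac_classK (K : comAlgType k) (del : 'I_m -> K -> K) (prt : 'I_l -> K -> K) :
  in_classK eps del prt ->
  exists (Q : comAlgType k) (dQ : 'I_m -> Q -> Q) (prtQ : 'I_l -> Q -> Q) (i : K -> Q),
    [/\ in_classK eps dQ prtQ, is_Demb del prt dQ prtQ i & is_field Q].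
Proof.
case=> hK [hdom hsig]; have [Q [i hi]] := frac_exists hdom.
have [dQ [hdQ hdi]] := frac_dalg hi (Dring_dalg hK).
have hQ : dfield dQ by split=> //; exact: frac_field hi.
pose phi : K -> D Q := DRmap i \o emap prt.
have ihom := frac_khom hi.
have hphi : dhom del (dDR dQ) phi.
  split; first exact: khom_comp (Dring_khom hBcomm heps hK) (DRmap_khom _ _ ihom).
  move=> j x; apply/funext => q; rewrite /phi /= /DRmap /dDR (Dring_del hK).
  by rewrite (dhom_del hdi).
have [p hp x|e [he ei]] := frac_extend_lift hi hdQ hQ hdi hphi.
  rewrite /phi /= DRproj_map // -sigmaE => h; apply: (hsig p hp).
  rewrite (khom0 (sigma_dhom hBcomm heps hK hp)); apply: (frac_inj hi).
  by rewrite h (khom0 ihom).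
have e0 x : e x ord0 = x.
  have hc : khom (fun x => DRproj pi (e x)) by exact: khom_comp he (DRproj_khom _ _ _ hpi).
  rewrite -(DRproj_pi (e x) hpi0 hpii); move: x.
  apply: (frac_khom_uniq hi hc (khom_id Q)) => x.
  by rewrite ei /phi /= DRproj_map // (DRproj_pi _ hpi0 hpii) (emap0 prt x).
have [hDQ eE] := Dring_of_khom hdQ he e0.
exists Q, dQ, (fun a x => e x (lift ord0 a)), i; split=> //; last exact: frac_field hi.
  split=> //; split=> [|p hp]; first exact: field_domain (frac_field hi).
  exact: khom_field_inj (sigma_dhom hBcomm heps hDQ hp) (frac_field hi).
split; first exact: frac_inj hi.
split; first exact: khomD.
split; first exact: khomM.
split; first exact: khom1.
split; first exact: khomZ.
split; first exact: dhom_del hdi.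
by move=> a x; rewrite ei /phi /= /DRmap (emapS prt).
Qed.

Lemma Demb_dhom (R S : comAlgType k) (dR : 'I_m -> R -> R) (pR : 'I_l -> R -> R)
  (dS : 'I_m -> S -> S) (pS : 'I_l -> S -> S) f :
  is_Demb dR pR dS pS f -> dhom dR dS f.
Proof. by case=> h1 [h2 [h3 [h4 [h5 [h6 h7]]]]]. Qed.

Lemma Demb_emap (R S : comAlgType k) (dR : 'I_m -> R -> R) (pR : 'I_l -> R -> R)
  (dS : 'I_m -> S -> S) (pS : 'I_l -> S -> S) f :
  is_Demb dR pR dS pS f -> forall x q, emap pS (f x) q = f (emap pR x q).
Proof.
case=> h1 [h2 [h3 [h4 [h5 [h6 h7]]]]] x q.
by rewrite /emap; case: unliftP => [a _|_]; rewrite ?h7.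
Qed.

Lemma Demb_of_emap (R S : comAlgType k) (dR : 'I_m -> R -> R) (pR : 'I_l -> R -> R)
  (dS : 'I_m -> S -> S) (pS : 'I_l -> S -> S) f :
  injective f -> dhom dR dS f -> (forall x q, emap pS (f x) q = f (emap pR x q)) ->
  is_Demb dR pR dS pS f.
Proof.
move=> hinj hf he; split=> //; split; first exact: (khomD hf).
split; first exact: (khomM hf).
split; first exact: (khom1 hf).
split; first exact: (khomZ hf).
split; first exact: (dhom_del hf).
by move=> a x; rewrite -(emapS pR) -he emapS.
Qed.

Lemma Demb_comp (R S T : comAlgType k) (dR : 'I_m -> R -> R) (pR : 'I_l -> R -> R)
  (dS : 'I_m -> S -> S) (pS : 'I_l -> S -> S) (dT : 'I_m -> T -> T) (pT : 'I_l -> T -> T) f g :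
  is_Demb dR pR dS pS f -> is_Demb dS pS dT pT g -> is_Demb dR pR dT pT (g \o f).
Proof.
move=> hf hg; apply: Demb_of_emap.
- by apply: inj_comp; [case: hg | case: hf].
- exact: dhom_comp (Demb_dhom hf) (Demb_dhom hg).
- by move=> x q /=; rewrite (Demb_emap hg) (Demb_emap hf).
Qed.

Lemma Demb_qholds (R S : comAlgType k) (dR : 'I_m -> R -> R) (pR : 'I_l -> R -> R)
  (dS : 'I_m -> S -> S) (pS : 'I_l -> S -> S) g (A X : Type) (par : A -> R) (v : X -> R) phi :
  is_Demb dR pR dS pS g ->
  qholds (g \o par) dS pS (g \o v) phi <-> qholds par dR pR v phi.
Proof. by case=> h1 [h2 [h3 [h4 [h5 [h6 h7]]]]]; apply: qholds_hom. Qed.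

End ClassK.

Lemma reindex_ord (A : Type) m l (X : finType) (phi : qf A X m l) :
  exists psi : qf A 'I_#|X| m l, forall (R : pzRingType) (par : A -> R) d pr (v : 'I_#|X| -> R),
    qholds par d pr v psi <-> qholds par d pr (v \o enum_rank) phi.
Proof.
exists (qsubst (fun x => TVar _ _ _ (enum_rank x)) id phi) => R par d pr v.
exact: qholds_subst.
Qed.

Section FieldAlgebra.
Variables (k : fieldType) (K : comAlgType k) (L : fieldType) (f : K -> L).
Hypothesis fD : forall x y, f (x + y) = f x + f y.
Hypothesis fM : forall x y, f (x * y) = f x * f y.
Hypothesis f1 : f 1 = 1.

(** The extensions in [diff_closed] are bare differential fields; they receive their [k]-structure
    from [K]. *)
Definition field_scale (c : k) (x : L) : L := f c%:A * x.

Definition field_alg_raw : rawalg k.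
Proof.
apply: (@RawAlg k L 0 1 +%R -%R *%R field_scale); last split.
- by apply/eqP; exact: oner_neq0.
- exact: addrA. - exact: addrC. - exact: add0r. - exact: addNr.
- exact: mulrA. - exact: mulrC. - exact: mul1r. - exact: mulrDl.
- by move=> a b v; rewrite /field_scale mulrA -fM mulr_algl scalerA.
- by move=> v; rewrite /field_scale scale1r f1 mul1r.
- by move=> a u v; exact: mulrDr.
- by move=> a b v; rewrite /field_scale scalerDl fD mulrDl.
- by move=> a u v; exact: mulrA.
Defined.

Definition field_alg : comAlgType k := alg_of field_alg_raw.

Lemma field_alg_field : is_field field_alg.
Proof.
move=> x hx; exists ((x : L)^-1).
have nz : (x : L) != 0 by apply/eqP.
exact: (mulfV nz).
Qed.

Lemma field_alg_khom : khom (f : K -> field_alg).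
Proof.
split; [exact: fD|exact: fM|exact: f1|move=> c x].
by rewrite -mulr_algl fM.
Qed.

Variables (m : nat) (del : 'I_m -> K -> K) (delL : 'I_m -> L -> L).
Hypothesis hdel : dalg del.
Hypothesis delLDM : forall j x y, delL j (x + y) = delL j x + delL j y /\
  delL j (x * y) = x * delL j y + delL j x * y.
Hypothesis delLC : forall i j x, delL i (delL j x) = delL j (delL i x).
Hypothesis fdel : forall j x, f (del j x) = delL j (f x).

(** The given derivations are linear over [k] because scalars come from constants of [K]. *)
Lemma field_alg_dalg : dalg (delL : 'I_m -> field_alg -> field_alg).
Proof.
split; last exact: delLC.
move=> j; split; first by move=> x y; have [h _] := delLDM j x y.
split=> [x y|c x]; first by have [_ h] := delLDM j x y.
have [_ h] := delLDM j (f c%:A) x; rewrite [c *: x]/(field_scale c x) /field_scale h.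
have [_ [_ dZ]] := dalg_der hdel j.
rewrite -fdel dZ (derivation1 (dalg_der hdel j)) scaler0.
have -> : f 0 = 0 by apply: (addrI (f 0)); rewrite -fD !addr0.
by rewrite mul0r addr0.
Qed.
End FieldAlgebra.

Section Forward.
Variables (k : fieldType) (hk : [pchar k] =i pred0) (B : falgType k).
Hypothesis hBcomm : forall x y : B, x * y = y * x.
Hypothesis hBres : residue_fields_trivial B.
Variables (l : nat) (eps : l.+1.-tuple B).
Hypothesis heps : basis_of fullv eps.
Variable pi : B -> k.
Hypothesis hpi : kalg_hom pi.
Hypothesis hpi0 : pi (tnth eps ord0) = 1.
Hypothesis hpii : forall i : 'I_l.+1, i != ord0 -> pi (tnth eps i) = 0.
Variable m : nat.
Variables (K : comAlgType k) (del : 'I_m -> K -> K) (prt : 'I_l -> K -> K).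
Local Notation D S := (DR hBcomm heps S).

Lemma sigma_pi (R : comAlgType k) (pr : 'I_l -> R -> R) x : sigma eps pr pi x = x.
Proof.
by rewrite (sigmaE hBcomm heps) (DRproj_pi _ hpi0 hpii) (emap0 pr).
Qed.

Section EC.
Hypothesis hEC : ec_in_classK eps del prt.

Lemma ec_Dring : is_Dring eps del prt. Proof. by case: hEC => [[]]. Qed.
Let hK := ec_Dring.
Let hd := Dring_dalg hK.

Lemma ec_finite (X : finType) (L : comAlgType k) (delL : 'I_m -> L -> L) (prtL : 'I_l -> L -> L)
  (f : K -> L) (phi : qf K X m l) (b : X -> L) :
  in_classK eps delL prtL -> is_Demb del prt delL prtL f ->
  qholds f delL prtL b phi -> exists a : X -> K, qholds id del prt a phi.
Proof.
move=> hL hf hb; have [psi hpsi] := reindex_ord phi.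
have [_ /(_ L delL prtL hL f hf _ psi)[|a /hpsi ha]] := hEC; last by exists (a \o enum_rank).
exists (b \o enum_val); apply/hpsi; congr qholds: hb; apply/funext => x /=.
by rewrite enum_rankK.
Qed.

Lemma ec_field : is_field K.
Proof.
have [Q [dQ [prtQ [i [hQ hi hF]]]]] := frac_classK hBcomm hBres heps hpi hpi0 hpii hEC.1.
have ih := Demb_dhom hi.
move=> x hx; have ix : i x <> 0.
  move=> h; apply: hx; have [hinj _] := hi; apply: hinj; rewrite h.
  exact: esym (khom0 ih).
have [y hy] := hF _ ix.
have [a ha] := @ec_finite unit Q dQ prtQ i
  (FEq (TMul (TPar _ _ _ x) (TVar _ _ _ tt)) (TPar _ _ _ 1)) (fun=> y) hQ hi (etrans hy (esym (khom1 ih))).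
by exists (a tt).
Qed.
Let hKF : dfield del := DField ec_field hd.

Lemma Dlift_emap (F : comAlgType k) (dF : 'I_m -> F -> F) (f : K -> F) : dhom del dF f ->
  Dlift (eps := eps) (hBcomm := hBcomm) (heps := heps) del dF f (DRmap f \o emap prt).
Proof.
move=> hf; split=> //.
- exact: khom_comp (Dring_khom hBcomm heps hK) (DRmap_khom _ _ hf).
- by move=> j x q; rewrite /= /DRmap (Dring_del hK) (dhom_del hf).
- by move=> x; rewrite /= /DRmap (emap0 prt).
Qed.

(** To solve [sigma_p y = a], [K] is embedded into an extension not by [i] but by [i] after
    [sigma_p], and the residue at [p] on the larger copy of [K] is prescribed to be [sigma_p]. There
    [i a] is a solution. Only [pi] and [p] can be prescribed, since the other associated
    endomorphisms need not commute with [sigma_p]. *)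
Lemma ec_sigma_bijective p : kalg_hom p -> bijective (sigma eps prt p).
Proof.
move=> hp; have hinj : injective (sigma eps prt p) by case: hEC => [[_ [_ h]] _]; exact: h.
have hs q (hq : kalg_hom q) : dhom del del (sigma eps prt q) := sigma_dhom hBcomm heps hK hq.
have surj a : exists b, sigma eps prt p b = a.
  have [||||L [dL [prtL [i [hL hi hLe hLs]]]]] := Dring_extension hk hBres hpi hpi0 hpii hKF hKF
    (Dlift_emap (hs p hp)) (Q := fun q => q = pi \/ q = p) (t0 := fun q => sigma eps prt q).
  - by move=> q [->|->]; exact: hs.
  - move=> q hq x; rewrite DRproj_map; last exact: hs.
    by rewrite -sigmaE; case: hq => ->; rewrite ?sigma_pi.
  - by left.
  - by move=> x; exact: sigma_pi.
  pose f := i \o sigma eps prt p.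
  have hf : is_Demb del prt dL prtL f.
    apply: Demb_of_emap; first exact: inj_comp (khom_field_inj hi ec_field) hinj.
      exact: dhom_comp (hs p hp) hi.
    by move=> x q; rewrite /f /= hLe.
  pose t : dterm K unit m l := tsubst (@nabterm k l m K unit) (no_part l) (phterm eps m K p tt).
  have tE (R : comAlgType k) (g : K -> R) (d : 'I_m -> R -> R) (pr : 'I_l -> R -> R)
      (v : unit -> R) :
      khom g -> reval g d pr v t = sigma eps pr p (v tt).
    move=> hg; rewrite (@reval_subst _ _ _ m 0 l _ _ R g d (@no_ops R) pr); last by case.
    by rewrite reval_nabterm (reval_phterm hBcomm heps).
  have [|b hb] := @ec_finite unit L dL prtL f (FEq t (TPar _ _ _ a)) (fun=> i a) hL hf.
    by rewrite /= tE ?hLs //; [right | exact: Demb_dhom hf].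
  exists (b tt); rewrite -(tE K id del); last exact: khom_id.
  exact: hb.
have [g hg] := choice surj; exists g => x; last exact: hg.
by apply: hinj; rewrite hg.
Qed.

(** Any differential field extension of [K] embeds into a member of the class, with operators
    extending those of [K]. *)
Lemma ec_diff_closed : diff_closed del.
Proof.
split; first exact: ec_field.
split.
  move=> p; rewrite !inE; apply/negP => /andP[pp].
  rewrite -scaler_nat scaler_eq0 oner_eq0 orbF.
  by move/pcharf0P: hk => -> /eqP p0; rewrite p0 in pp.
split; first by move=> j x y; have [dD [dM _]] := dalg_der hd j.
split; first exact: dalg_comm.
move=> L delL _ hdL hcL f fD fM f1 fdel n phi [b hb].
pose A := field_alg fD fM f1.
have hA : dfield (delL : 'I_m -> A -> A).
  by split; [exact: field_alg_field | exact: field_alg_dalg hd hdL hcL fdel].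
have hf : dhom del (delL : 'I_m -> A -> A) (f : K -> A).
  by split; [exact: field_alg_khom | exact: fdel].
have [||||L' [dL [prtL [i [hL hi hLe _]]]]] := Dring_extension hk hBres hpi hpi0 hpii hKF hA
  (Dlift_emap hf) (Q := fun q => q = pi) (t0 := fun=> id).
- by move=> *; exact: dhom_id.
- by move=> q -> x; rewrite (DRproj_pi _ hpi0 hpii) /= /DRmap (emap0 prt).
- by [].
- by [].
have hemb : is_Demb del prt dL prtL (i \o (f : K -> A)).
  apply: Demb_of_emap.
  - exact: inj_comp (khom_field_inj hi (dfield_field hA)) (khom_field_inj hf ec_field).
  - exact: dhom_comp hf hi.
  - by move=> x q; rewrite /= hLe.
pose psi : qf K 'I_n m l := qsubst (fun x => TVar _ _ _ x) (no_part l) phi.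
have psiE (R : comAlgType k) (g : K -> R) (d : 'I_m -> R -> R) (pr : 'I_l -> R -> R)
    (v : 'I_n -> R) :
    qholds g d pr v psi <-> qholds g d (@no_ops R) v phi.
  by apply: qholds_subst; case.
have [|a /psiE ha] := @ec_finite _ L' dL prtL _ psi (i \o (b : 'I_n -> A)) hL hemb.
  have ip (a : 'I_0) (x : A) : i (no_ops a x) = no_ops a (i x) by [].
  apply/psiE; exact: (qholds_hom f (khomD hi) (khomM hi) (dhom_del hi) ip b phi
    (khom_field_inj hi (dfield_field hA))).2 hb.
by exists a.
Qed.

End EC.
End Forward.

Section Geometric.
Variables (k : fieldType) (hk : [pchar k] =i pred0) (B : falgType k).
Hypothesis hBcomm : forall x y : B, x * y = y * x.
Hypothesis hBres : residue_fields_trivial B.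
Variables (l : nat) (eps : l.+1.-tuple B).
Hypothesis heps : basis_of fullv eps.
Variable pi : B -> k.
Hypothesis hpi : kalg_hom pi.
Hypothesis hpi0 : pi (tnth eps ord0) = 1.
Hypothesis hpii : forall i : 'I_l.+1, i != ord0 -> pi (tnth eps i) = 0.
Variable m : nat.
Variables (K : comAlgType k) (del : 'I_m -> K -> K) (prt : 'I_l -> K -> K).
Local Notation D S := (DR hBcomm heps S).
Hypothesis hK : is_Dring eps del prt.
Let hd := Dring_dalg hK.

Lemma Deval_emap n (g : dpoly m K 'I_n) (a : 'I_n -> K) :
  Deval eps del prt g (nabla prt a) = emap prt (peval del g a).
Proof.
have h := Dring_emap_dhom hBcomm heps hK.
by rewrite -(reval_hom0 id a g (khomD h) (khomM h) (dhom_del h)).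
Qed.

(** Coordinate 0 of the prolonged equation at [nabla a] is the equation itself at [a], so membership
    of [nabla a] in [W] already yields [a] in [V]. *)
Lemma prolong_nabla n (V : ('I_n -> K) -> Prop) a : dclosed del V ->
  prolong eps del prt V (nabla prt a) -> V a.
Proof.
case=> S hS hV; apply/hS => g hg.
have := hV g _ ord0; rewrite Deval_emap (emap0 prt); apply.
by move=> v /hS; apply.
Qed.

Lemma peval_phsubst n p (g : dpoly m K 'I_n) (w : 'I_l.+1 * 'I_n -> K) :
  peval del (tsubst (phterm eps m K p (X := 'I_n)) (no_part 0) g) w = peval del g (pihat eps p w).
Proof.
rewrite /peval (@reval_subst _ _ _ m 0 0 _ _ K id del (@no_ops K) (@no_ops K)); last by case.
congr reval; apply/funext => x.
by rewrite (reval_phterm hBcomm heps); last exact: khom_id.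
Qed.

Lemma peval_Dterm n (g : dpoly m K 'I_n) (w : 'I_l.+1 * 'I_n -> K) q :
  peval del (Dterm eps prt g q) w = Deval eps del prt g w q.
Proof. by rewrite /peval (reval_Dterm hBcomm heps); last exact: khom_id. Qed.

Lemma peval_tmap_sigma n p (g : dpoly m K 'I_n) (v : 'I_n -> K) : kalg_hom p ->
  peval del (tmap (sigma eps prt p) g) (sigma eps prt p \o v) = sigma eps prt p (peval del g v).
Proof.
move=> hp; have h := sigma_dhom hBcomm heps hK hp.
by rewrite /peval reval_tmap (reval_hom0 id v g (khomD h) (khomM h) (dhom_del h)).
Qed.

Section Locus.
Variables (n : nat) (V : ('I_n -> K) -> Prop) (W : ('I_l.+1 * 'I_n -> K) -> Prop).
Hypothesis hKF : is_field K.
Hypothesis Virr : dirreducible del V.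
Hypothesis Wirr : dirreducible del W.
Hypothesis WV : forall w, W w -> prolong eps del prt V w.
Hypothesis Wdense : forall p : B -> k, kalg_hom p ->
  ddense_in del (image_pihat eps p W) (conjV del (sigma eps prt p) V).

Lemma dense_ideal p (g : dpoly m K 'I_n) : kalg_hom p ->
  dideal del W (tsubst (phterm eps m K p (X := 'I_n)) (no_part 0) (tmap (sigma eps prt p) g)) ->
  dideal del V g.
Proof.
move=> hp hg v hv; have h := sigma_dhom hBcomm heps hK hp.
apply: (khom_field_inj h hKF); rewrite (khom0 h) -peval_tmap_sigma //.
have hc : conjV del (sigma eps prt p) V (sigma eps prt p \o v).
  by move=> f hf; rewrite peval_tmap_sigma // hf // (khom0 h).
apply: ((Wdense hp).2 _ hc (fun b => peval del (tmap (sigma eps prt p) g) b = 0)).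
  exists (fun t => t = tmap (sigma eps prt p) g) => b.
  by split=> [e t ->|h']; [|apply: h'].
by move=> _ [w [hw ->]]; rewrite -peval_phsubst; exact: hg.
Qed.

(* The generic point of [W] defines a lift of the coordinate ring of [V], whose
   residues are injective because the projections of [W] are dense. *)
Lemma generic_lift (F : comAlgType k) (dF : 'I_m -> F -> F) (iota : K -> F)
  (c : 'I_l.+1 * 'I_n -> F) : dfield dF -> dhom del dF iota ->
  (forall t, reval iota dF (@no_ops F) c t = 0 <-> dideal del W t) ->
  exists h : coord_ring Virr -> D F,
    [/\ dhom (cder (Uirr := Virr)) (dDR dF) h,
        forall x, h (cvar Virr x) = Dpoint hBcomm heps c x,
        forall a, h (cconst Virr a) = Dpar hBcomm heps prt iota a &
        forall p, kalg_hom p -> forall r, DRproj p (h r) = 0 -> r = 0].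
Proof.
move=> hF hi hc.
have hpar : khom (Dpar hBcomm heps prt iota).
  exact: khom_comp (Dring_khom hBcomm heps hK) (DRmap_khom _ _ hi).
have [g hg|h [hh hE]] := @coord_universal _ _ _ del _ V Virr (D F) (dDR dF)
  (Dpar hBcomm heps prt iota) (Dpoint hBcomm heps c) hpar.
  apply/funext => q; rewrite -(reval_Dterm hBcomm heps prt dF hi).
  by apply/hc => w hw; rewrite peval_Dterm; exact: WV.
exists h; split=> //.
- by move=> x; exact: hE (TVar _ _ _ x).
- by move=> a; exact: hE (TPar _ _ _ a).
move=> p hp r; have [t ->] := cproj_surj r; rewrite hE => e.
apply/cproj0P/(dense_ideal hp)/hc.
rewrite (@reval_subst _ _ _ m 0 0 _ _ F iota dF (@no_ops F) (@no_ops F)); last by case.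
rewrite reval_tmap; rewrite -[RHS]e.
have ph := DRproj_khom hBcomm heps F hp.
have pd j u : DRproj p (dDR dF j u : D F) = dF j (DRproj p u).
  by apply: derivation_DRproj; exact: dalg_der (dfield_dalg hF) j.
rewrite -(reval_hom0 (Dpar hBcomm heps prt iota) (Dpoint hBcomm heps c) t (khomD ph) (khomM ph) pd).
congr reval; apply/funext => x /=.
- exact: esym (DRproj_map p (emap prt x : D K) hi).
- by rewrite (reval_phterm hBcomm heps); last exact: hi.
Qed.

End Locus.

Lemma ec_geometric : ec_in_classK eps del prt -> geometric_axioms eps del prt.
Proof.
move=> hEC n V W Virr Wirr WV Wdense.
have hKF := ec_field hBcomm hBres heps hpi hpi0 hpii hEC.
have hdomK := field_domain hKF.
have hdK : dfield del by split.
have [F [iF hiF]] := frac_exists (coord_domain (Uirr := Wirr) hdomK).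
have [dF [hdF hdiF]] := frac_dalg hiF (cder_dalg hd Wirr).
have hF : dfield dF by split=> //; exact: frac_field hiF.
pose iota := iF \o cconst Wirr; pose c := iF \o cvar Wirr.
have hiota : dhom del dF iota := dhom_comp (cconst_dhom Wirr) hdiF.
have hc t : reval iota dF (@no_ops F) c t = 0 <-> dideal del W t.
  rewrite (reval_hom0 _ _ _ (khomD hdiF) (khomM hdiF) (dhom_del hdiF)).
  rewrite reval_cproj -(cproj0P Wirr) -[in iF _ = _](khom0 hdiF).
  by split=> [/(frac_inj hiF)|->].
have [h [hh hvar hconst hinj]] := generic_lift hKF Virr WV Wdense hF hiota hc.
have [F0 [i0 hi0]] := frac_exists (coord_domain (Uirr := Virr) hdomK).
have [d0 [hd0 hdi0]] := frac_dalg hi0 (cder_dalg hd Virr).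
have hF0 : dfield d0 by split=> //; exact: frac_field hi0.
have [e [he ei]] := frac_extend_lift hBres hi0 hd0 hF hdi0 hh hinj.
(* The function field of [V] embeds into that of [W] by the residue at [pi], that is, by the
   coordinates of index 0. *)
pose j x := DRproj pi (e x).
have hpj : dhom (dDR dF) dF (fun u : D F => DRproj pi u).
  split; first exact: DRproj_khom.
  by move=> a u; apply: derivation_DRproj; exact: dalg_der hdF a.
have hlift : Dlift d0 dF j e.
  split; [exact: dhom_comp he hpj|exact: he| |].
  - by move=> a x q; rewrite (dhom_del he).
  - by move=> x; rewrite /j (DRproj_pi _ hpi0 hpii).
have [||||L [dL [prtL [i [hL hi hLe _]]]]] := Dring_extension hk hBres hpi hpi0 hpii hF0 hF
  hlift (Q := fun q => q = pi) (t0 := fun=> id).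
- by move=> *; exact: dhom_id.
- by move=> q ->.
- by [].
- by [].
have jE x : j x = e x ord0 by rewrite (Dlift_pi hlift).
have hLiota a q : emap prtL (i (iota a)) q = i (iota (emap prt a q)).
  have -> : iota a = j (i0 (cconst Virr a)) by rewrite jE ei hconst /Dpar (emap0 prt).
  by rewrite hLe ei hconst.
(* In [L] the generic point of [W] is thus [nabla] of its own coordinates of index 0. *)
have hLc x q : emap prtL (i (c (ord0, x))) q = i (c (q, x)).
  have -> : c (ord0, x) = j (i0 (cvar Virr x)) by rewrite jE ei hvar.
  by rewrite hLe ei hvar.
have hemb : is_Demb del prt dL prtL (i \o iota).
  apply: Demb_of_emap => //.
  - exact: inj_comp (khom_field_inj hi (dfield_field hF)) (khom_field_inj hiota hKF).
  - exact: dhom_comp hiota hi.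
(* Membership in [W] may need infinitely many equations; [phi] replaces them by one formula, as
   existential closedness demands. *)
have [phi [phic hphi]] := generic_formula hk hdK c hdF hiota.
pose psi : qf K 'I_n m l := qsubst (@nabterm k l m K 'I_n) (no_part l) phi.
have psiE (R : comAlgType k) (g : K -> R) (d : 'I_m -> R -> R) (pr : 'I_l -> R -> R)
    (v : 'I_n -> R) : qholds g d pr v psi <-> qholds g d (@no_ops R) (nablaX pr v) phi.
  rewrite -(reval_nabterm g d pr v); apply: qholds_subst; by case.
have [|a /psiE/hphi ha] := ec_finite (X := 'I_n) hEC (phi := psi)
    (b := fun x => i (c (ord0, x))) hL hemb.
  apply/psiE.
  have -> : nablaX prtL (fun x => i (c (ord0, x))) = i \o c.
    by apply/funext => -[q x]; rewrite /nablaX hLc.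
  have ip (s : 'I_0) (x : F) : i (no_ops s x) = no_ops s (i x) by [].
  exact: (qholds_hom iota (khomD hi) (khomM hi) (dhom_del hi) ip c phi
    (khom_field_inj hi (dfield_field hF))).2 phic.
have Wa : W (nabla prt a).
  have [[S hS] _] := Wirr; apply/hS => s hs; apply: ha; apply/hc => w /hS; exact.
exists a; split=> //; apply: (prolong_nabla Virr.1); exact: WV.
Qed.

End Geometric.

(** * The axioms imply existential closedness *)

Section FieldOfAlg.
Variables (k : fieldType) (L : comAlgType k).
Hypothesis hL : is_field L.

(** A copy of [L] tagged with the proof that it is a field, so that a [fieldType] structure,
    required by [diff_closed], can be attached to it. *)
Definition field_of (_ : is_field L) : Type := L.
Local Notation F := (field_of hL).
HB.instance Definition _ := GRing.ComNzRing.copy F L.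

Definition field_of_inv (x : F) : F :=
  if x == 0 then 0 else projT1 (cid (field_inverse hL)) x.

Lemma field_of_mulVf (x : F) : x != 0 -> field_of_inv x * x = 1.
Proof.
move=> hx; rewrite /field_of_inv (negbTE hx) mulrC.
by case: cid => iv /= h; apply: h; apply/eqP.
Qed.

Lemma field_of_inv0 : field_of_inv 0 = 0.
Proof. by rewrite /field_of_inv eqxx. Qed.

HB.instance Definition _ := GRing.ComNzRing_isField.Build F field_of_mulVf field_of_inv0.
End FieldOfAlg.

(** * Loci and the differential Nullstellensatz *)

Section Locus.
Variables (k : fieldType) (hk : [pchar k] =i pred0) (m : nat).
Variables (K : comAlgType k) (del : 'I_m -> K -> K).
Hypothesis hdel : dalg del.
Hypothesis hK : diff_closed del.
Variables (L : comAlgType k) (dL : 'I_m -> L -> L) (f : K -> L).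
Hypothesis hL : is_field L.
Hypothesis hdL : dalg dL.
Hypothesis hf : dhom del dL f.
Variables (X : finType) (a : X -> L).

Definition locus (b : X -> K) : Prop :=
  forall g : dterm K X m 0, reval f dL (@no_ops L) a g = 0 -> peval del g b = 0.

(** The formula of [generic_formula] together with [g <> 0] holds at [a], so differential closedness
    realises it in [K]; the point found satisfies the whole ideal of [a]. *)
Lemma locus_nullstellensatz (g : dterm K X m 0) : reval f dL (@no_ops L) a g <> 0 ->
  exists b, locus b /\ peval del g b <> 0.
Proof.
move=> hg.
have hKF : is_field K by case: hK.
have [phi [phia hphi]] := generic_formula hk (DField hKF hdel) a hdL hf.
pose theta := FAnd phi (FNot (FEq g (TPar _ _ _ 0))).
have [psi hpsi] := reindex_ord theta.
have [_ [_ [_ [_ hcl]]]] := hK.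
have hchar : [pchar field_of hL] =i pred0.
  move=> p; rewrite !inE; apply/negP => /andP[pp].
  rewrite -(@scaler_nat k L) scaler_eq0 oner_eq0 orbF.
  by move/pcharf0P: hk => -> /eqP p0; rewrite p0 in pp.
have hder (j : 'I_m) (x y : field_of hL) :
    (dL j : field_of hL -> field_of hL) (x + y) = dL j x + dL j y /\
    (dL j : field_of hL -> field_of hL) (x * y) = x * dL j y + (dL j x : field_of hL) * y.
  by have [dD [dM _]] := dalg_der hdL j.
have [|b /hpsi[hb1 hb2]] := hcl (field_of hL) dL hchar hder (dalg_comm hdL) f (khomD hf)
  (khomM hf) (khom1 hf) (dhom_del hf) _ psi.
  exists (a \o enum_val); apply/hpsi.
  have -> : (a \o enum_val) \o enum_rank = a by apply/funext => x /=; rewrite enum_rankK.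
  split=> [|e]; first exact: phia.
  by apply: hg; move: e; rewrite /= => e; rewrite -(khom0 hf).
exists (b \o enum_rank); split=> [g' hg'|e]; first exact: (hphi _ hb1).
by apply: hb2; exact: e.
Qed.

Lemma locus_ideal (g : dterm K X m 0) :
  dideal del locus g <-> reval f dL (@no_ops L) a g = 0.
Proof.
split=> [h|h b]; last by apply.
by apply: contrapT => /locus_nullstellensatz[b [hb]]; apply; exact: h.
Qed.

Lemma locus_irreducible : dirreducible del locus.
Proof.
split; first by exists (fun g => reval f dL (@no_ops L) a g = 0).
split.
  have [|b [hb _]] := @locus_nullstellensatz (TPar _ _ _ 1); last by exists b.
  by rewrite /reval /= (khom1 hf); apply/eqP; exact: oner_neq0.
move=> V1 V2 [S1 hS1] [S2 hS2] hV.
have sub V' : (forall b, V' b -> locus b) -> (~ exists b, locus b /\ ~ V' b) ->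
    forall b, locus b <-> V' b.
  move=> sV hno b; split=> [hb|]; last exact: sV.
  by apply: contrapT => nb; apply: hno; exists b.
have sep V' S : (forall b, V' b <-> zero_set del S b) -> (exists b, locus b /\ ~ V' b) ->
    exists2 g, S g & reval f dL (@no_ops L) a g <> 0.
  move=> hS [b [hb nb]]; apply: contrapT => hno; apply: nb; apply/hS => g hg.
  by apply: hb; apply: contrapT => h; apply: hno; exists g.
case: (EM (exists b, locus b /\ ~ V1 b)) => [h1|h1]; last first.
  by left; apply: sub => // b hb; apply/hV; left.
case: (EM (exists b, locus b /\ ~ V2 b)) => [h2|h2]; last first.
  by right; apply: sub => // b hb; apply/hV; right.
have [g1 g1S ng1] := sep _ _ hS1 h1; have [g2 g2S ng2] := sep _ _ hS2 h2.
exfalso; have : reval f dL (@no_ops L) a (TMul g1 g2) = 0.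
  apply/locus_ideal => b /hV[/hS1/(_ _ g1S)|/hS2/(_ _ g2S)] e.
    by rewrite /peval revalM -/(peval del g1 b) e mul0r.
  by rewrite /peval revalM -/(peval del g2 b) e mulr0.
by rewrite revalM => /(field_domain hL)[].
Qed.

End Locus.

Section Backward.
Variables (k : fieldType) (hk : [pchar k] =i pred0) (B : falgType k).
Hypothesis hBcomm : forall x y : B, x * y = y * x.
Variables (l : nat) (eps : l.+1.-tuple B).
Hypothesis heps : basis_of fullv eps.
Variable m : nat.
Variables (K : comAlgType k) (del : 'I_m -> K -> K) (prt : 'I_l -> K -> K).
Hypothesis hK : is_Dring eps del prt.
Hypothesis hdcl : diff_closed del.
Hypothesis hbij : forall p : B -> k, kalg_hom p -> bijective (sigma eps prt p).
Hypothesis hgeom : geometric_axioms eps del prt.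
Local Notation D S := (DR hBcomm heps S).

Variables (L : comAlgType k) (dL : 'I_m -> L -> L) (prtL : 'I_l -> L -> L) (f : K -> L).
Hypothesis hL : is_Dring eps dL prtL.
Hypothesis hLF : is_field L.
Hypothesis hf : is_Demb del prt dL prtL f.
Let hd := Dring_dalg hK.
Let hdL := Dring_dalg hL.
Let hfd := Demb_dhom hf.

Lemma sigma_Demb p x : sigma eps prtL p (f x) = f (sigma eps prt p x).
Proof.
rewrite /sigma (khom_sum hfd); apply: eq_bigr => q _.
by rewrite (Demb_emap hf) (khomZ hfd).
Qed.

Lemma reval_sigma p n (a : 'I_n -> L) (g : dterm K 'I_n m 0) : kalg_hom p ->
  reval f dL (@no_ops L) (sigma eps prtL p \o a) (tmap (sigma eps prt p) g) =
  sigma eps prtL p (reval f dL (@no_ops L) a g).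
Proof.
move=> hp; have h := sigma_dhom hBcomm heps hL hp.
rewrite reval_tmap -(reval_hom0 f a g (khomD h) (khomM h) (dhom_del h)).
by congr reval; apply/funext => x /=; rewrite sigma_Demb.
Qed.

Lemma reval_phsubst_nabla p n (a : 'I_n -> L) (g : dterm K 'I_n m 0) :
  reval f dL (@no_ops L) (nablaX prtL a) (tsubst (phterm eps m K p (X := 'I_n)) (no_part 0) g) =
  reval f dL (@no_ops L) (sigma eps prtL p \o a) g.
Proof.
rewrite (@reval_subst _ _ _ m 0 0 _ _ L f dL (@no_ops L) (@no_ops L)); last by case.
congr reval; apply/funext => x.
by rewrite (reval_phterm hBcomm heps); last exact: hfd.
Qed.

Lemma reval_Dterm_nabla n (a : 'I_n -> L) (g : dterm K 'I_n m 0) q :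
  reval f dL (@no_ops L) (nablaX prtL a) (Dterm eps prt g q) =
  emap prtL (reval f dL (@no_ops L) a g) q.
Proof.
have h := Dring_emap_dhom hBcomm heps hL.
rewrite (reval_Dterm hBcomm heps prt dL hfd).
rewrite -[RHS]/((emap prtL (reval f dL (@no_ops L) a g) : D L) q).
rewrite -(reval_hom0 f a g (khomD h) (khomM h) (dhom_del h)).
have -> : Dpar hBcomm heps prt f = (emap prtL : L -> D L) \o f.
  by apply/funext => x; apply/funext => q' /=; rewrite (Demb_emap hf).
by [].
Qed.

(** The third axiom for the loci of [a] and of [nabla a]. Its hypotheses hold because the ideals of
    these loci are those of the points, and the projection at [p] of [nabla a] is [sigma_p a]. *)
Lemma realize_nabla n (a : 'I_n -> L) : exists a' : 'I_n -> K,
  forall g : dterm K ('I_l.+1 * 'I_n) m 0,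
    reval f dL (@no_ops L) (nablaX prtL a) g = 0 -> peval del g (nablaX prt a') = 0.
Proof.
pose V := locus del dL f a; pose W := locus del dL f (nablaX prtL a).
have idV (g : dterm K 'I_n m 0) : dideal del V g <-> _ := locus_ideal hk hd hdcl hLF hdL hfd a g.
have idW g : dideal del W g <-> _ :=
  locus_ideal hk hd hdcl hLF hdL hfd (nablaX prtL a) g.
have [||w hw g||a' [_ ha']] := hgeom (n := n) (V := V) (W := W).
- exact: locus_irreducible.
- exact: locus_irreducible.
- move=> /idV hg q'; rewrite -(peval_Dterm hBcomm heps).
  apply: hw; rewrite reval_Dterm_nabla hg.
  by have h := Dring_khom hBcomm heps hL; rewrite (khom0 h).
- move=> p hp; have h := sigma_dhom hBcomm heps hL hp; split.
    move=> _ [w [hw ->]] g /idV hg; rewrite -(peval_phsubst hBcomm heps del).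
    by apply: hw; rewrite reval_phsubst_nabla reval_sigma // hg (khom0 h).
  move=> b hb P [S hS] hP; apply/hS => g hg.
  (* Density rests on the second axiom: [g] is the conjugate of [tmap s' g]. If [g] vanishes on the
     projection of [W], it vanishes at [sigma_p a]; by injectivity [tmap s' g] vanishes at [a],
     hence on [V]. *)
  have [s' s'K sK] := hbij hp.
  rewrite -(tmap_cancel g sK); apply: hb; apply/idV.
  apply: (khom_field_inj h hLF); rewrite (khom0 h) -reval_sigma // tmap_cancel //.
  rewrite -reval_phsubst_nabla; apply/idW => w hw.
  rewrite (peval_phsubst hBcomm heps del).
  have : P (pihat eps p w) by apply: hP; exists w.
  by move/hS; apply.
by exists a' => g hg; apply: ha'.
Qed.

End Backward.

(** * Unnesting the operators in a formula *)

Section Flatten.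
Variables (k : fieldType) (m l n : nat) (K L : comAlgType k).
Variables (del : 'I_m -> K -> K) (prt : 'I_l -> K -> K).
Variables (dL : 'I_m -> L -> L) (prtL : 'I_l -> L -> L) (f : K -> L).
Hypothesis hf : is_Demb del prt dL prtL f.
Hypothesis hKF : is_field K.
Variables (iv : L -> L) (b : 'I_n -> L).
Hypothesis hiv : forall x, x <> 0 -> x * iv x = 1.
Let hfd := Demb_dhom hf.
Local Notation val := (reval f dL prtL b).

(** With every subterm value among the entries of [a], an operator applied to a subterm is a
    coordinate of [nabla a], so each node of a term becomes a differential polynomial equation in
    [nabla a]. *)
Fixpoint term_values (t : dterm K 'I_n m l) : seq L :=
  val t :: match t with
  | TAdd t1 t2 | TMul t1 t2 => term_values t1 ++ term_values t2
  | TOpp t1 | TDel _ t1 | TPart _ t1 => term_values t1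
  | _ => [::]
  end.

(* The inverse of [t1 - t2] turns the inequation of [t1] and [t2] into an equation. *)
Fixpoint formula_values (phi : qf K 'I_n m l) : seq L :=
  match phi with
  | FEq t1 t2 => iv (val t1 - val t2) :: term_values t1 ++ term_values t2
  | FNot p => formula_values p
  | FAnd p q | FOr p q => formula_values p ++ formula_values q
  end.

Variables (N : nat) (a : 'I_N -> L) (a' : 'I_N -> K).
Hypothesis ha' : forall g : dterm K ('I_l.+1 * 'I_N) m 0,
  reval f dL (@no_ops L) (nablaX prtL a) g = 0 -> peval del g (nablaX prt a') = 0.
Variable idx : 'I_n -> 'I_N.
Hypothesis hidx : forall x, a (idx x) = b x.
Local Notation val' := (reval id del prt (a' \o idx)).
Local Notation v0 i := (TVar K m 0 (@ord0 l, i)).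

Lemma v0E (R : comAlgType k) (g : K -> R) d (pr : 'I_l -> R -> R) (c : 'I_N -> R) i :
  reval g d (@no_ops R) (nablaX pr c) (v0 i) = c i.
Proof. exact: emap0. Qed.

Lemma transfer i (g : dterm K ('I_l.+1 * 'I_N) m 0) :
  a i = reval f dL (@no_ops L) (nablaX prtL a) g -> a' i = peval del g (nablaX prt a').
Proof.
move=> h; apply/eqP; rewrite -subr_eq0; apply/eqP.
have := ha' (g := TAdd (v0 i) (TOpp g)).
by rewrite /peval !revalD !revalN !v0E h subrr; apply.
Qed.

Definition covered (s : seq L) : Prop := forall y, y \in s -> exists i, a i = y.

Lemma covered_cat s1 s2 : covered (s1 ++ s2) -> covered s1 /\ covered s2.
Proof. by move=> h; split=> y hy; apply: h; rewrite mem_cat hy ?orbT. Qed.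

Lemma covered_cons y s : covered (y :: s) -> (exists i, a i = y) /\ covered s.
Proof. by move=> h; split=> [|z hz]; apply: h; rewrite inE ?eqxx // hz orbT. Qed.

Lemma covered_head t : covered (term_values t) -> exists i, a i = val t.
Proof. by move=> h; apply: h; case: t => *; rewrite inE eqxx. Qed.

Lemma transfer_term t : covered (term_values t) -> forall i, a i = val t -> a' i = val' t.
Proof.
elim: t => /= [x|c|t1 h1 t2 h2|t1 h1|t1 h1 t2 h2|j t1 h1|j t1 h1] /covered_cons[_ hc] i hi.
- by rewrite (transfer (g := v0 (idx x))) ?v0E ?hidx // /peval v0E.
- by rewrite (transfer (g := TPar _ _ _ c)).
- have [c1 c2] := covered_cat hc.
  have [i1 e1] := covered_head c1; have [i2 e2] := covered_head c2.
  rewrite (transfer (g := TAdd (v0 i1) (v0 i2))) ?revalD ?v0E ?e1 ?e2 //.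
  by rewrite /peval !revalD !v0E (h1 c1 i1 e1) (h2 c2 i2 e2).
- have [i1 e1] := covered_head hc.
  rewrite (transfer (g := TOpp (v0 i1))) ?revalN ?v0E ?e1 //.
  by rewrite /peval !revalN !v0E (h1 hc i1 e1).
- have [c1 c2] := covered_cat hc.
  have [i1 e1] := covered_head c1; have [i2 e2] := covered_head c2.
  rewrite (transfer (g := TMul (v0 i1) (v0 i2))) ?revalM ?v0E ?e1 ?e2 //.
  by rewrite /peval !revalM !v0E (h1 c1 i1 e1) (h2 c2 i2 e2).
- have [i1 e1] := covered_head hc.
  rewrite (transfer (g := TDel j (v0 i1))) ?revalDel ?v0E ?e1 //.
  by rewrite /peval !revalDel !v0E (h1 hc i1 e1).
- have [i1 e1] := covered_head hc.
  rewrite (transfer (g := TVar _ _ _ (lift ord0 j, i1))).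
    by rewrite /peval /reval /= /nablaX /= (emapS prt) (h1 hc i1 e1).
  by rewrite hi [RHS]/reval /= /nablaX /= (emapS prtL) e1.
Qed.

Lemma transfer_formula phi : covered (formula_values phi) ->
  qholds id del prt (a' \o idx) phi <-> qholds f dL prtL b phi.
Proof.
elim: phi => /= [t1 t2|p ih|p ih q ih'|p ih q ih'] hc; first last.
- by have [c1 c2] := covered_cat hc; rewrite ih // ih'.
- by have [c1 c2] := covered_cat hc; rewrite ih // ih'.
- by rewrite ih.
have [[i hi] /covered_cat[c1 c2]] := covered_cons hc.
have [i1 e1] := covered_head c1; have [i2 e2] := covered_head c2.
have E1 := transfer_term c1 e1; have E2 := transfer_term c2 e2.
split=> e; last by rewrite -E1; apply: transfer_term => //; rewrite e1.
apply: contrapT => hne; have nz : val t1 - val t2 <> 0.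
  by move/eqP; rewrite subr_eq0 => /eqP.
have := hiv nz; rewrite -hi -e1 -e2 => h.
(* The equation saying that entry [i] inverts the difference passes to [a']; there the difference is
   0, a contradiction. *)
have := ha' (g := TAdd (TMul (TAdd (v0 i1) (TOpp (v0 i2))) (v0 i)) (TOpp (TPar _ _ _ 1))).
rewrite /peval !revalD !revalM !revalD !revalN !v0E h [reval _ _ _ _ (TPar _ _ _ 1)](khom1 hfd).
rewrite subrr E1 E2 e subrr mul0r sub0r => /(_ erefl) /eqP.
by rewrite oppr_eq0 oner_eq0.
Qed.

End Flatten.

Theorem theorem6p1
  (k : fieldType) (hk : [pchar k] =i pred0)
  (B : falgType k) (hBcomm : forall x y : B, x * y = y * x)
  (hBres : residue_fields_trivial B)
  (l : nat) (eps : l.+1.-tuple B) (heps : basis_of fullv eps)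
  (pi : B -> k) (hpi : kalg_hom pi) (hpi0 : pi (tnth eps ord0) = 1)
  (hpii : forall i : 'I_l.+1, i != ord0 -> pi (tnth eps i) = 0)
  (m : nat) (K : comAlgType k) (del : 'I_m -> K -> K) (prt : 'I_l -> K -> K)
  (hK : is_Dring eps del prt) :
  ec_in_classK eps del prt <->
  [/\ diff_closed del,
      (forall p : B -> k, kalg_hom p -> bijective (sigma eps prt p))
    & geometric_axioms eps del prt].
Proof.
split=> [hEC|[hdcl hbij hgeom]].
  split.
  - exact: (ec_diff_closed hk hBcomm hBres heps hpi hpi0 hpii hEC).
  - exact: (ec_sigma_bijective hk hBcomm hBres heps hpi hpi0 hpii hEC).
  - exact: (ec_geometric hk hBcomm hBres heps hpi hpi0 hpii hK hEC).
have hKF : is_field K by case: hdcl.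
split.
  split=> //; split; first exact: field_domain.
  by move=> p hp; apply: bij_inj; exact: hbij.
move=> L' dL' prtL' hL' f' hf' n phi [b' hb'].
(* Passing to a field makes the inverses of the nonzero differences available. *)
have [L [dL [prtL [i [hL hi hLF]]]]] := frac_classK hBcomm hBres heps hpi hpi0 hpii hL'.
pose f := i \o f'; pose b := i \o b'.
have hf : is_Demb del prt dL prtL f := Demb_comp hf' hi.
have hb : qholds f dL prtL b phi by apply/(Demb_qholds f' b' phi hi).
have [iv hiv] := field_inverse hLF.
(* The entries of [b] are included so that the solution in [K] can be read off [a'] through
   [idx]. *)
pose s := codom b ++ formula_values dL prtL f iv b phi.
pose a (j : 'I_(size s)) := nth 0 s j.
have cov : covered a s.
  move=> y hy; rewrite -index_mem in hy; exists (Ordinal hy).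
  by rewrite /a /= nth_index // -index_mem.
have [a' ha'] := realize_nabla hk hBcomm heps hK hdcl hbij hgeom hL.1 hLF hf a.
have /choice[idx hidx] : forall x, exists j, a j = b x.
  by move=> x; apply: cov; rewrite mem_cat codom_f.
exists (a' \o idx); apply/(transfer_formula hf hiv ha' hidx); last exact: hb.
by have [_ h] := covered_cat cov.
Qed.
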